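(* Let $V\in L^1_{loc}(\Omega)$ be such that $Q_V\succeq0$ in $\Omega$. (i) Let $V$ be balanced in $\Omega$. If $-\Delta+V$ is $L^1$-subcritical in $\Omega$, then there exist an a.e. positive function $u_*\in L^1_{loc}(\Omega)$, obtained as $u_*=\mathbf J(u)$ for some $u\in\mathcal H_V(\Omega)$, and $f\in L^1_{loc}(\Omega)$ with $\inf_Bf>0$ for every ball $B\Subset\Omega$, such that $-\Delta u_*+Vu_*=f$ in the sense of distributions in $\Omega$. (ii) Conversely, if there exist a nonnegative function $u\in L^1_{loc}(\Omega)$ and $f\in L^1_{loc}(\Omega)$ with $\inf_Bf>0$ for every ball $B\Subset\Omega$, such that $-\Delta u+Vu=f$ in the sense of distributions in $\Omega$, then $-\Delta+V$ is $L^1$-subcritical in $\Omega$.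
   Context: $\Omega$ is a domain (nonempty connected open set) in $\mathbb R^N$, $N\ge1$. $W^{1,\infty}_c(\Omega)$: Lipschitz functions with compact support in $\Omega$; $Q_V(\xi)=\int_\Omega\{|\nabla\xi|^2+V\xi^2\}\,dx$; $Q_V\succeq0$ in $\Omega$ means $Q_V(\xi)\ge0$ for all $\xi\in W^{1,\infty}_c(\Omega)$; then $\sqrt{Q_V}$ is a norm on $W^{1,\infty}_c(\Omega)$ coming from an inner product. $\mathcal L_V(\Omega)=(W^{1,\infty}_c(\Omega),\sqrt{Q_V})$, and $\mathcal H_V(\Omega)$ is its Hilbert space completion. $-\Delta+V$ is $L^1$-subcritical in $\Omega$ if $Q_V\succeq0$ and $\mathcal L_V(\Omega)\hookrightarrow L^1_{loc}(\Omega)$ continuously; in this case $\mathbf J:\mathcal H_V(\Omega)\to L^1_{loc}(\Omega)$ denotes the unique continuous linear extension of the inclusion. Balanced potentials. For a nonempty open $U\Subset\Omega$ (i.e. $\overline U$ a compact subset of $\Omega$) let $\mathcal B_V(\Omega;U)$ be the completion of $\mathcal L_V(\Omega;U)=(W^{1,\infty}_c(\Omega),\|\cdot\|^U_{V,\Omega})$, $\|\xi\|^U_{V,\Omega}=\sqrt{Q_V(\xi)}+\int_U|\xi|$, and let $\mathbf J_U:\mathcal B_V(\Omega;U)\to L^1(U)$ be the continuous extension of $\xi\mapsto\xi|_U$. For a closed ball $B\subset\Omega$ let $X_B$ be the completion of $C^2_c(B)$ ($C^2$ functions with compact support in the interior of $B$) in the $C^2(B)$ norm and $X_B^*$ its dual,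 with $L^1(B)$ viewed in $X_B^*$ through $g\mapsto(\varphi\mapsto\int_Bg\varphi)$. If $B\subset U$, the map $\xi\mapsto V\xi$ is continuous from $\mathcal L_V(\Omega;U)$ to $X_B^*$; let $\mathbb V_{B,U}:\mathcal B_V(\Omega;U)\to X_B^*$ be its continuous extension. $V\in L^1_{loc}(\Omega)$ is balanced in $\Omega$ if $Q_V\succeq0$ in $\Omega$ and for every closed ball $B\subset\Omega$ there is an open $U\Subset\Omega$ containing $B$ such that, for all $u\in\mathcal B_V(\Omega;U)$, $V\mathbf J_U(u)\in L^1(B)$ and $\mathbb V_{B,U}(u)=V\mathbf J_U(u)$ in $X_B^*$. $-\Delta u+Vu=f$ in the sense of distributions means $u,Vu\in L^1_{loc}(\Omega)$ and $\int_\Omega u(-\Delta\xi+V\xi)=\int_\Omega f\xi$ for all $\xi\in C^\infty_c(\Omega)$. $\inf$ is the essential infimum. *)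

(* Defs.v *)
From HB Require Import structures.
From mathcomp Require Import all_boot all_order all_algebra.
From mathcomp Require Import all_classical all_reals all_analysis.
From mathcomp Require Import ess_sup_inf.
From mathcomp Require Import lra.
Set Implicit Arguments.
Unset Strict Implicit.
Unset Printing Implicit Defensive.
Import Order.TTheory GRing.Theory Num.Theory.
Import numFieldNormedType.Exports.
Local Open Scope classical_set_scope.
Local Open Scope ring_scope.

Section seminorm.
Context {R : realType} {W : lmodType R}.

Definition is_seminorm (p : W -> R) :=
  (forall x y, p (x + y) <= p x + p y) /\
  (forall a x, p (a *: x) = `|a| * p x).

(* [snorm p] is [p] as soon as [p] is a seminorm; the other case is there so that
   [completion p] below is a normed space for every function [p]. *)
Definition snorm (p : W -> R) : W -> R :=
  if `[< is_seminorm p >] then p else fun=> 0.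

Variable p : W -> R.
Local Notation q := (snorm p).

Lemma snormE : is_seminorm p -> q = p.
Proof. by rewrite /snorm => /asboolP ->. Qed.

Lemma snormD x y : q (x + y) <= q x + q y.
Proof. by rewrite /snorm; case: asboolP => [[]//|_]; rewrite addr0. Qed.

Lemma snormZ a x : q (a *: x) = `|a| * q x.
Proof. by rewrite /snorm; case: asboolP => [[]//|_]; rewrite mulr0. Qed.

Lemma snorm0 : q 0 = 0.
Proof. by rewrite -(scale0r 0) snormZ normr0 mul0r. Qed.

Lemma snormN x : q (- x) = q x.
Proof. by rewrite -scaleN1r snormZ normrN1 mul1r. Qed.

Lemma snorm_ge0 x : 0 <= q x.
Proof. by have := snormD x (- x); rewrite subrr snorm0 snormN; lra. Qed.

Lemma snormB x y : q (x - y) <= q x + q y.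
Proof. by rewrite -[q y]snormN snormD. Qed.

Lemma snorm_dist x y : `|q x - q y| <= q (x - y).
Proof.
have xE := snormD (x - y) y; have yE := snormD (y - x) x.
have qC : q (y - x) = q (x - y) by rewrite -snormN opprB.
rewrite subrK in xE; rewrite subrK qC in yE.
by rewrite ler_norml; apply/andP; split; lra.
Qed.

Definition cauchy_seqs : {pred (nat -> W)} := fun u =>
  `[< forall e, 0 < e -> exists n0, forall m n, (n0 <= m)%N -> (n0 <= n)%N ->
      q (u m - u n) < e >].

Lemma cauchy_seqs_submod : submod_closed cauchy_seqs.
Proof.
split => [|a u v].
  by apply/asboolP => e e0; exists 0%N => m n _ _; rewrite subrr snorm0.
move=> /asboolP cu /asboolP cv; apply/asboolP => e e0.
have a1 : 0 < `|a| + 1 by rewrite ltr_wpDl.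
have [n1 H1] := cu (e / 2 / (`|a| + 1)) ltac:(by rewrite !divr_gt0).
have [n2 H2] := cv (e / 2) ltac:(by rewrite divr_gt0).
exists (maxn n1 n2) => m n; rewrite !geq_max => /andP[m1 m2] /andP[n1' n2'].
rewrite (_ : _ - _ = a *: (u m - u n) + (v m - v n)); last first.
  by rewrite scalerBr opprD addrACA.
rewrite (le_lt_trans (snormD _ _))// snormZ.
have h2 := H2 _ _ m2 n2'; have h1 := H1 _ _ m1 n1'.
rewrite ltr_pdivlMr// in h1.
have : `|a| * q (u m - u n) <= q (u m - u n) * (`|a| + 1).
  by rewrite mulrC ler_wpM2l ?snorm_ge0// lerDl.
by lra.
Qed.

HB.instance Definition _ :=
  GRing.isSubmodClosed.Build R (nat -> W) cauchy_seqs cauchy_seqs_submod.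

Record cseq := CSeq { cseq_val :> nat -> W ; _ : cseq_val \in cauchy_seqs }.
HB.instance Definition _ := [isSub for cseq_val].
HB.instance Definition _ := [Choice of cseq by <:].
HB.instance Definition _ := [SubChoice_isSubLmodule of cseq by <:].

Definition null_seqs : {pred cseq} :=
  fun u => `[< (fun n => q (u n)) @ \oo --> (0 : R) >].

Lemma null_seqs_zmod : zmod_closed null_seqs.
Proof.
split => [|u v].
  apply/asboolP; rewrite (_ : (fun n => _) = cst 0); first exact: cvg_cst.
  by apply/funext => n /=; rewrite snorm0.
move=> /asboolP u0 /asboolP v0; apply/asboolP.
apply: (@squeeze_cvgr _ _ _ _ (cst 0) (fun n => q (u n) + q (v n))).
- by apply: nearW => n; rewrite snorm_ge0/= snormB.
- exact: cvg_cst.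
- by rewrite -[X in _ --> X]addr0; exact: cvgD.
Qed.

HB.instance Definition _ :=
  GRing.isZmodClosed.Build cseq null_seqs null_seqs_zmod.

(* The (separated) completion of W for the seminorm p, as the space of Cauchy
   sequences modulo null sequences. *)
Definition completion : Type := Quotient.quot null_seqs.

HB.instance Definition _ := Choice.on completion.
HB.instance Definition _ := GRing.Zmodule.on completion.

Definition cclass (u : cseq) : completion := \pi_(Quotient.quot null_seqs)%qT u.

Lemma cclassK (x : completion) : exists u, x = cclass u.
Proof. by exists (repr (x : Quotient.quot null_seqs)); rewrite /cclass reprK. Qed.

Lemma cclassP (u v : cseq) :
  cclass u = cclass v <-> (fun n => q (u n - v n)) @ \oo --> (0 : R).
Proof.
have E : (cclass u == cclass v) = (u - v \in null_seqs).
  by rewrite Quotient.idealrBE.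
split=> [/eqP|H]; first by rewrite E => /asboolP.
by apply/eqP; rewrite E; exact/asboolP.
Qed.

Lemma cclassD (u v : cseq) : cclass (u + v) = cclass u + cclass v.
Proof. exact: (Quotient.pi_add null_seqs). Qed.

Lemma cclassN (u : cseq) : cclass (- u) = - cclass u.
Proof. exact: (Quotient.pi_opp null_seqs). Qed.


Lemma cseqP (u : cseq) e : 0 < e ->
  exists n0, forall m n, (n0 <= m)%N -> (n0 <= n)%N -> q (u m - u n) < e.
Proof. by case: u => u /= /asboolP; exact. Qed.

Lemma cseq_snorm_cvg (u : cseq) : cvgn (fun n => q (u n)).
Proof.
apply/cauchy_cvgP/cauchy_exP => e e0.
have [n0 H] := cseqP u e0; exists (q (u n0)).
exists n0 => // n /= n0n; rewrite /ball/=.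
by rewrite (le_lt_trans (snorm_dist _ _))// H.
Qed.

Let crepr (x : completion) : cseq := repr (x : Quotient.quot null_seqs).

Let creprK x : cclass (crepr x) = x.
Proof. by rewrite /cclass reprK. Qed.

Definition completion_scale (a : R) (x : completion) : completion :=
  cclass (a *: crepr x).

Definition completion_norm (x : completion) : R :=
  limn (fun n => q (crepr x n)).

Lemma cclassZ a (u : cseq) : completion_scale a (cclass u) = cclass (a *: u).
Proof.
apply/cclassP; have /cclassP := creprK (cclass u).
move=> /(cvgM (cvg_cst `|a|)); rewrite mulr0; apply: cvg_trans.
apply: near_eq_cvg; apply: nearW => n /=.
by rewrite -scalerBr snormZ.
Qed.

Lemma cclass_norm (u : cseq) :
  (fun n => q (u n)) @ \oo --> completion_norm (cclass u).
Proof.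
have /cclassP h := creprK (cclass u).
have c1 := cseq_snorm_cvg (u := crepr (cclass u)); have c2 := cseq_snorm_cvg (u := u).
rewrite /completion_norm.
suff -> : limn (fun n => q (crepr (cclass u) n)) = limn (fun n => q (u n)).
  exact: c2.
apply/eqP; rewrite -subr_eq0 -limB//; apply/eqP; apply: cvg_lim => //.
apply: norm_cvg0; apply: (squeeze_cvgr (f := cst 0) (h := fun n => q (crepr (cclass u) n - u n))); last exact: h.
  by apply: nearW => n; rewrite normr_ge0 snorm_dist.
exact: cvg_cst.
Qed.

Arguments cclass_norm : clear implicits.

Let cnormP (u : cseq) l :
  (fun n => q (u n)) @ \oo --> l -> completion_norm (cclass u) = l.
Proof.
by move=> h; rewrite -(cvg_lim _ h)// -(cvg_lim _ (cclass_norm u)).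
Qed.

Fact completion_scaleA a b x :
  completion_scale a (completion_scale b x) = completion_scale (a * b) x.
Proof. by have [u ->] := cclassK x; rewrite !cclassZ scalerA. Qed.

Fact completion_scale1 : left_id 1 completion_scale.
Proof. by move=> x; have [u ->] := cclassK x; rewrite !cclassZ scale1r. Qed.

Fact completion_scaleDr : right_distributive completion_scale +%R.
Proof.
move=> a x y; have [u ->] := cclassK x; have [v ->] := cclassK y.
by rewrite !(cclassZ, =^~ cclassD) scalerDr.
Qed.

Fact completion_scaleDl x : {morph completion_scale^~ x : a b / a + b}.
Proof.
by move=> a b; have [u ->] := cclassK x; rewrite !(cclassZ, =^~ cclassD) scalerDl.
Qed.

HB.instance Definition _ := GRing.Zmodule_isLmodule.Build R completion
  completion_scaleA completion_scale1 completion_scaleDr completion_scaleDl.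

Lemma scale_cclass a (u : cseq) : a *: cclass u = cclass (a *: u).
Proof. exact: cclassZ. Qed.

Fact completion_normD x y :
  completion_norm (x + y) <= completion_norm x + completion_norm y.
Proof.
have [u ->] := cclassK x; have [v ->] := cclassK y; rewrite -cclassD.
have huv := cclass_norm (u + v).
have h := cvgD (cclass_norm u) (cclass_norm v).
apply: (ler_cvg_to huv (h _)).
by apply: nearW => n; exact: snormD.
Qed.

Fact completion_normZ a x :
  completion_norm (a *: x) = `|a| * completion_norm x.
Proof.
have [u ->] := cclassK x; rewrite scale_cclass; apply: cnormP.
rewrite (_ : (fun n => _) = (cst `|a|) * (fun n => q (u n))).
  by apply: cvgM; [exact: cvg_cst|exact: cclass_norm].
by apply/funext => n /=; rewrite snormZ.
Qed.

Fact completion_norm_eq0 x : completion_norm x = 0 -> x = 0.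
Proof.
have [u ->] := cclassK x => u0.
have -> : (0 : completion) = cclass 0.
  by rewrite -(subrr u) cclassD cclassN subrr.
apply/cclassP; have := cclass_norm u; rewrite u0.
rewrite (_ : (fun n => q (u n - _)) = (fun n => q (u n)))//.
by apply/funext => n /=; rewrite subr0.
Qed.

HB.instance Definition _ := Lmodule_isNormed.Build R completion
  completion_normD completion_normZ completion_norm_eq0.

Lemma norm_cclass (u : cseq) : `|cclass u| = completion_norm (cclass u).
Proof. by []. Qed.

Lemma cst_cseq_subproof (x : W) : (fun=> x : W) \in cauchy_seqs.
Proof. by apply/asboolP => e e0; exists 0%N => m n _ _; rewrite subrr snorm0. Qed.

Definition to_completion (x : W) : completion :=
  cclass (CSeq (cst_cseq_subproof x)).

Lemma to_completion_linear : linear to_completion.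
Proof.
move=> a x y; rewrite scale_cclass -cclassD.
by congr cclass; apply: val_inj.
Qed.

HB.instance Definition _ :=
  GRing.isLinear.Build R W completion _ to_completion to_completion_linear.

Lemma to_completion_norm x : `|to_completion x| = q x.
Proof. by rewrite /to_completion norm_cclass; apply: cnormP => /=; exact: cvg_cst. Qed.

Lemma to_completion_dense (x : completion) e : 0 < e ->
  exists w, `|x - to_completion w| < e.
Proof.
move=> e0; have [u ->] := cclassK x.
have [n0 H] := cseqP u (e := e / 2) ltac:(by rewrite divr_gt0).
exists (u n0); rewrite /to_completion -cclassN -cclassD norm_cclass.
apply: (@le_lt_trans _ _ (e / 2)); last lra.
apply: (ler_cvg_to (cclass_norm _) (cvg_cst _)).
by exists n0 => // n /= n0n; apply/ltW/H.
Qed.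


Lemma completion_complete (F : set_system completion) :
  ProperFilter F -> cauchy F -> cvg F.
Proof.
move=> FF /cauchyP Fc.
have e0 k : 0 < 2^-1 ^+ k :> R by rewrite exprn_gt0// invr_gt0.
have /choice[x Fx] k := Fc _ (e0 k).
have /choice[w wx] k := to_completion_dense (x k) (e0 k).
have wF k : F (ball (to_completion (w k)) (2^-1 ^+ k *+ 2)).
  apply: filterS (Fx k) => y; rewrite -!ball_normE /ball_/= => xy.
  rewrite -(subrK (x k) (to_completion (w k))) -addrA mulr2n.
  by rewrite (le_lt_trans (ler_normD _ _))// ltrD// distrC.
have cw : w \in cauchy_seqs.
  apply/asboolP => e ep.
  have [n0 _ H] : \forall k \near \oo, 2^-1 ^+ k *+ 2 < e / 2 :> R.
    have /cvgMn : (fun k => 2^-1 ^+ k : R) @ \oo --> (0 : R).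
      by apply: cvg_expr; rewrite ger0_norm ?invr_ge0// invf_lt1// ltr1n.
    move=> /(_ 2%N); rewrite mul0rn => /cvgr_lt; apply.
    by rewrite divr_gt0.
  exists n0 => m n nm nn.
  have [y [ym yn]] := filter_ex (filterI (wF m) (wF n)).
  rewrite -to_completion_norm linearB/=.
  rewrite -(subrK y (to_completion (w m))) -addrA.
  rewrite (le_lt_trans (ler_normD _ _))// [e]splitr ltrD//.
    by rewrite (lt_trans _ (H m nm)).
  by rewrite distrC (lt_trans _ (H n nn)).
have wl : (fun k => to_completion (w k)) @ \oo --> cclass (CSeq cw).
  apply/cvgrPdist_le => e ep.
  have [n0 H] := cseqP (CSeq cw) ep.
  exists n0 => // k /= nk; rewrite /to_completion -cclassN -cclassD norm_cclass.
  apply: (ler_cvg_to (cclass_norm _) (cvg_cst _)).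
  by exists n0 => // n /= n0n; apply/ltW/H.
apply/cvg_ex; exists (cclass (CSeq cw)).
apply/cvgrPdist_lt => e ep.
have [n1 _ H1] : \forall k \near \oo, 2^-1 ^+ k *+ 2 < e / 2 :> R.
  have /cvgMn : (fun k => 2^-1 ^+ k : R) @ \oo --> (0 : R).
    by apply: cvg_expr; rewrite ger0_norm ?invr_ge0// invf_lt1// ltr1n.
  move=> /(_ 2%N); rewrite mul0rn => /cvgr_lt; apply.
  by rewrite divr_gt0.
have /cvgrPdist_lt/(_ (e / 2)) [|n2 _ H2] := wl; first by rewrite divr_gt0.
pose k := maxn n1 n2; apply: filterS (wF k) => y.
rewrite -ball_normE /ball_/= => wy.
rewrite -(subrK (to_completion (w k)) (cclass _)) -addrA.
rewrite (le_lt_trans (ler_normD _ _))// [e]splitr ltrD//.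
  by apply: H2; rewrite /= leq_maxr.
by rewrite (lt_trans wy)// H1//= leq_maxl.
Qed.

HB.instance Definition _ := Uniform_isComplete.Build completion
  completion_complete.
End seminorm.

Arguments to_completion {R W} p x.

Definition seminorm_nbhs (R : realType) (W : lmodType R) (p : W -> R) (x : W) :
    set_system W :=
  filter_from [set e : R | 0 < e] (fun e => [set y | p (y - x) < e]).

(* The Borel sets of R^n, as the product sigma-algebra. *)
Section borel_rV.
Context {R : realType} {n : nat}.

Definition rV_coord (i : 'I_n) (x : 'rV[R]_n) : measurableTypeR R := x ord0 i.

Let rV_set0 : g_sigma_preimage rV_coord set0.
Proof. exact: sigma_algebra0. Qed.

Let rV_setC A : g_sigma_preimage rV_coord A -> g_sigma_preimage rV_coord (~` A).
Proof. exact: sigma_algebraC. Qed.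

Let rV_bigcup (F : (set 'rV[R]_n)^nat) :
  (forall i, g_sigma_preimage rV_coord (F i)) ->
  g_sigma_preimage rV_coord (\bigcup_i F i).
Proof. exact: sigma_algebra_bigcup. Qed.

HB.instance Definition _ := @isMeasurable.Build
  (measure_tuple_display default_measure_display) 'rV[R]_n
  (g_sigma_preimage rV_coord) rV_set0 rV_setC rV_bigcup.

Lemma measurable_rV_coord (i : 'I_n) : measurable_fun setT (rV_coord i).
Proof.
move=> _ Y mY; rewrite setTI; apply: sub_sigma_algebra.
rewrite -bigcup_seq; exists i => /=; first by rewrite mem_index_enum.
by exists Y => //; rewrite setTI.
Qed.

Lemma measurable_fun_rV d (T : measurableType d) (f : T -> 'rV[R]_n) :
  (forall i, measurable_fun setT (rV_coord i \o f)) -> measurable_fun setT f.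
Proof.
move=> mf; apply: (@measurability _ _ _ _ setT f _ erefl).
move=> _ [A + <-]; rewrite -bigcup_seq => -[i _ [B mB <-]].
rewrite setTI; have := mf i measurableT B mB; rewrite !setTI; exact.
Qed.
End borel_rV.

Section cons_rV.
Context {R : realType} {n : nat}.

Definition cons_rV (xv : measurableTypeR R * 'rV[R]_n) : 'rV[R]_n.+1 :=
  \row_i oapp (xv.2 ord0) xv.1 (unlift ord0 i).

Definition uncons_rV (v : 'rV[R]_n.+1) : measurableTypeR R * 'rV[R]_n :=
  (v ord0 ord0, \row_i v ord0 (lift ord0 i)).

Lemma cons_rVK : cancel cons_rV uncons_rV.
Proof.
move=> [x v]; rewrite /uncons_rV mxE unlift_none/=; congr pair.
by apply/rowP => i; rewrite !mxE liftK.
Qed.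

Lemma measurable_cons_rV : measurable_fun setT cons_rV.
Proof.
apply: measurable_fun_rV => i.
have [->|[j ->]] : i = ord0 \/ exists j, i = lift ord0 j.
  by case: (unliftP ord0 i) => [j ->|->]; [right; exists j|left].
- rewrite (_ : _ \o _ = fst); first exact: measurable_fst.
  by apply/funext => xv; rewrite /rV_coord/= mxE unlift_none.
- rewrite (_ : _ \o _ = rV_coord j \o snd).
    by apply: measurableT_comp; [exact: measurable_rV_coord|exact: measurable_snd].
  by apply/funext => xv; rewrite /rV_coord/= mxE liftK.
Qed.

Lemma measurable_uncons_rV : measurable_fun setT uncons_rV.
Proof.
apply: measurable_fun_pair; first exact: (measurable_rV_coord ord0).
apply: measurable_fun_rV => i.
rewrite (_ : _ \o _ = rV_coord (lift ord0 i)); first exact: measurable_rV_coord.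
by apply/funext => v; rewrite /rV_coord/= mxE.
Qed.
End cons_rV.

(* The n-dimensional Lebesgue measure, as an iterated product measure; its values
   on boxes are given by [lebesgue_rV_box]. *)
Fixpoint lebesgue_rV (R : realType) (n : nat) : set 'rV[R]_n -> \bar R :=
  match n with
  | 0 => dirac (0 : 'rV[R]_0)
  | n'.+1 => pushforward (lebesgue_measure \x @lebesgue_rV R n')%E cons_rV
  end.
Arguments lebesgue_rV {R n}.


Section lebesgue_rV_measure.
Context {R : realType}.
Local Open Scope ereal_scope.

Section step.
Context (n : nat) (m : {sigma_finite_measure set 'rV[R]_n -> \bar R}).

Let L : {sigma_finite_measure set (measurableTypeR R) -> \bar R} :=
  @lebesgue_measure R.
Let M : {measure set (measurableTypeR R * 'rV[R]_n)%type -> \bar R} :=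
  L \x m.

Definition cons_measure : set 'rV[R]_n.+1 -> \bar R := pushforward M cons_rV.

HB.instance Definition _ := Measure.copy cons_measure
  (measure_function_pushforward__canonical__measure_function_Measure
    M measurable_cons_rV).

Let cons_measure_sigma_finite : sigma_finite setT cons_measure.
Proof.
have /sigma_finiteP[F [TF ndF Foo]] := sigma_finiteT L.
have /sigma_finiteP[G [TG ndG Goo]] := sigma_finiteT m.
exists (fun i => uncons_rV @^-1` (F i `*` G i)) => [|i].
  apply/esym/seteqP; split=> // v _.
  have : [set: measurableTypeR R] (v ord0 ord0) by [].
  rewrite TF => -[i _ Fi].
  have : [set: 'rV[R]_n] (\row_i v ord0 (lift ord0 i)) by [].
  rewrite TG => -[j _ Gj].
  exists (maxn i j) => //; split => /=.
    by move: (_ ord0 ord0) Fi; exact/subsetPset/ndF/leq_maxl.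
  by move: (\row_ _ _) Gj; exact/subsetPset/ndG/leq_maxr.
have [mF Fi] := Foo i; have [mG Gi] := Goo i.
split.
  rewrite -[X in measurable X]setTI; apply: measurable_uncons_rV => //.
  exact: measurableX.
rewrite /cons_measure /pushforward -comp_preimage (_ : _ \o _ = id).
  by rewrite preimage_id [X in (X < _)%E](product_measure1E L m)// lte_mul_pinfty// ge0_fin_numE.
by apply/funext => z /=; rewrite cons_rVK.
Qed.

HB.instance Definition _ := Measure_isSigmaFinite.Build _ _ _ cons_measure
  cons_measure_sigma_finite.

End step.

Let lebesgue_rV_ex n : exists m : {sigma_finite_measure set 'rV[R]_n -> \bar R},
  (m : set 'rV[R]_n -> \bar R) = lebesgue_rV.
Proof.
elim: n => [|n [m mE]]; first by exists (dirac (0%R : 'rV[R]_0)).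
by exists (cons_measure m); rewrite /= -mE.
Qed.

Context {n : nat}.
Local Notation mu := (@lebesgue_rV R n).

Let lebesgue_rV0 : mu set0 = 0.
Proof. by have [m <-] := lebesgue_rV_ex n; exact: measure0. Qed.

Let lebesgue_rV_ge0 A : 0 <= mu A.
Proof. by have [m <-] := lebesgue_rV_ex n; exact: measure_ge0. Qed.

Let lebesgue_rV_sigma_additive : semi_sigma_additive mu.
Proof.
by have [m <-] := lebesgue_rV_ex n; exact: measure_semi_sigma_additive.
Qed.

HB.instance Definition _ := isMeasure.Build _ _ _ mu
  lebesgue_rV0 lebesgue_rV_ge0 lebesgue_rV_sigma_additive.

Let lebesgue_rV_sigma_finite : sigma_finite setT mu.
Proof. by have [m <-] := lebesgue_rV_ex n; exact: sigma_finiteT. Qed.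

HB.instance Definition _ := Measure_isSigmaFinite.Build _ _ _ mu
  lebesgue_rV_sigma_finite.

End lebesgue_rV_measure.

Lemma measurable_rV_box (R : realType) n (A : 'I_n -> set R) :
  (forall i, measurable (A i)) ->
  measurable [set x : 'rV[R]_n | forall i, A i (x ord0 i)].
Proof.
move=> mA.
rewrite (_ : mkset _ = \bigcap_(i in [set: 'I_n]) (rV_coord i @^-1` A i)).
  apply: fin_bigcap_measurable => // i _.
  rewrite -[X in measurable X]setTI; exact: (measurable_rV_coord i measurableT (mA i)).
by apply/seteqP; split=> x /= h i; [move=> _; exact: h|exact: (h i I)].
Qed.

Lemma lebesgue_rV_box (R : realType) n (A : 'I_n -> set R) :
  (forall i, measurable (A i)) ->
  lebesgue_rV [set x : 'rV[R]_n | forall i, A i (x ord0 i)] =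
  (\prod_(i < n) lebesgue_measure (A i))%E.
Proof.
elim: n A => [|n IH] A mA.
  rewrite big_ord0 /= diracE mem_set// => -[].
  by case.
pose B := [set x : 'rV[R]_n | forall i, A (lift ord0 i) (x ord0 i)].
have E : cons_rV @^-1` [set x : 'rV[R]_n.+1 | forall i, A i (x ord0 i)] = A ord0 `*` B.
  apply/seteqP; split=> -[x v] /=.
    move=> h; split => /=; first by have := h ord0; rewrite mxE unlift_none.
    by move=> i; have := h (lift ord0 i); rewrite mxE liftK.
  by move=> [h0 h] i; rewrite mxE; case: unliftP => [j ->|->] /=; [exact: h|exact: h0].
rewrite big_ord_recl -(IH (fun i => A (lift ord0 i)))//.
transitivity ((@lebesgue_measure R \x @lebesgue_rV R n)%E (A ord0 `*` B)).
  by rewrite -E.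
apply: (@product_measure1E _ _ _ _ _ lebesgue_measure lebesgue_rV); first exact: mA.
exact: (measurable_rV_box (A := fun i => A (lift ord0 i))).
Qed.

Section functions_on_rV.
Context {R : realType} {N : nat}.
Local Notation E := 'rV[R]_N.
Local Notation mu := (@lebesgue_rV R N).
Implicit Types (f g V : E -> R) (Omega U B K : set E).

(* The norm of the library on ['rV[R]_N] is the sup norm; it is only used where
   an equivalent norm makes no difference (topology, Lipschitz functions). *)
Definition enorm (x : E) : R := Num.sqrt (\sum_(i < N) x ord0 i ^+ 2).

Definition open_ball (c : E) (r : R) : set E := [set x | enorm (x - c) < r].
Definition closed_ball_e (c : E) (r : R) : set E :=
  [set x | enorm (x - c) <= r].

Definition compactly_inside U Omega :=
  compact (closure U) /\ closure U `<=` Omega.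

Definition compacts_in Omega : set (set E) :=
  [set K | compact K /\ K `<=` Omega].

Definition compactly_supported Omega f :=
  exists2 K, compacts_in Omega K & forall x, ~ K x -> f x = 0.

(* Lipschitz functions have partial derivatives almost everywhere; elsewhere
   ['D_v f x] is a default value. *)
Definition partial (i : 'I_N) f : E -> R := fun x => 'D_(delta_mx ord0 i) f x.
Definition grad_sq f : E -> R := fun x => \sum_(i < N) partial i f x ^+ 2.
Definition laplacian f : E -> R :=
  fun x => \sum_(i < N) partial i (partial i f) x.

Fixpoint Ck (k : nat) f : Prop :=
  match k with
  | 0 => continuous f
  | k'.+1 => [/\ continuous f,
                 forall i x, derivable f x (delta_mx ord0 i) &
                 forall i, Ck k' (partial i f)]
  end.

Definition test_function Omega f :=
  (forall k, Ck k f) /\ compactly_supported Omega f.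

Lemma compactly_supported_lin Omega a f g :
  compactly_supported Omega f -> compactly_supported Omega g ->
  compactly_supported Omega (a *: f + g).
Proof.
move=> [K [cK KO] Kf] [L [cL LO] Lg]; exists (K `|` L) => [|x].
  by split; [exact: compactU|rewrite subUset].
move=> /not_orP[nK nL]; change (a * f x + g x = 0).
by rewrite Kf// Lg// mulr0 addr0.
Qed.

Lemma compactly_supported0 Omega : compactly_supported Omega (0 : E -> R).
Proof. by exists set0 => //; split; [exact: compact0|exact: sub0set]. Qed.

Lemma lipschitzP f : lipschitz f <->
  exists k, forall x y, `|f x - f y| <= k * `|x - y|.
Proof.
split=> [|[k kf]].
  move=> /pinfty_ex_gt0[k k0 kf]; exists k => x y.
  exact: (kf (x, y) (conj I I)).
have PF : ProperFilter (globally ([set: E] `*` [set: E])).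
  exact: (@globally_properfilter _ _ (0, 0)).
by apply: (klipschitzW (k := k)) => -[x y] _; exact: kf.
Qed.

Let cont_lin a f g :
  continuous f -> continuous g -> continuous (a *: f + g).
Proof.
move=> cf cg x.
change ((fun y => a * f y + g y) @ x --> a * f x + g x).
apply: (@cvgD R R^o E (nbhs x) _ (fun y => a * f y) g (a * f x) (g x)); last exact: cg.
apply: cvgM; [exact: cvg_cst|exact: cf].
Qed.

Lemma Ck_lin k a f g : Ck k f -> Ck k g -> Ck k (a *: f + g).
Proof.
elim: k f g => [|k IH] f g /=.
  exact: cont_lin.
move=> [cf df pf] [cg dg pg]; split.
- exact: cont_lin.
- by move=> i x; apply: derivableD => //; exact: derivableZ.
- move=> i; rewrite (_ : partial i _ = a *: partial i f + partial i g).
    by apply: IH; [exact: pf|exact: pg].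
  apply/funext => x; rewrite /partial.
  rewrite [LHS]deriveD//; last exact: derivableZ.
  by congr (_ + _); exact: deriveZ.
Qed.

Lemma Ck0 k : Ck k (0 : E -> R).
Proof.
have c0 : continuous (0 : E -> R) by move=> x; exact: cst_continuous.
elim: k => [|k IH]; first exact: c0.
split=> [|i x|i]; first exact: c0.
  exact: (derivable_cst (0 : R)).
rewrite (_ : partial i _ = 0)//; apply/funext => x.
by rewrite /partial (derive_cst (0 : R)).
Qed.

(* Functions on [Omega] with compact support in [Omega] are identified with
   their extension by 0 to the whole space. *)
Section function_spaces.
Variable Omega : set E.

Definition lip_c : {pred (E -> R)} :=
  fun f => `[< lipschitz f /\ compactly_supported Omega f >].

Lemma lip_c_submod : submod_closed lip_c.
Proof.
split=> [|a f g /asboolP[/lipschitzP[k kf] sf] /asboolP[/lipschitzP[l lg] sg]].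
  apply/asboolP; split; last exact: compactly_supported0.
  by apply/lipschitzP; exists 0 => x y; rewrite subrr normr0 mul0r.
apply/asboolP; split; last exact: compactly_supported_lin.
apply/lipschitzP; exists (`|a| * k + l) => x y.
rewrite (_ : _ - _ = a * (f x - f y) + (g x - g y)); last first.
  by rewrite mulrBr addrACA -opprD.
rewrite (le_trans (ler_normD _ _))// mulrDl lerD// normrM -mulrA.
by rewrite ler_wpM2l.
Qed.

HB.instance Definition _ :=
  GRing.isSubmodClosed.Build R (E -> R) lip_c lip_c_submod.

Record W1inf_c := W1infC { W1inf_c_val :> E -> R; _ : W1inf_c_val \in lip_c }.
HB.instance Definition _ := [isSub for W1inf_c_val].
HB.instance Definition _ := [Choice of W1inf_c by <:].
HB.instance Definition _ := [SubChoice_isSubLmodule of W1inf_c by <:].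

Definition C2_c_pred : {pred (E -> R)} :=
  fun f => `[< Ck 2 f /\ compactly_supported Omega f >].

Lemma C2_c_submod : submod_closed C2_c_pred.
Proof.
split=> [|a f g /asboolP[cf sf] /asboolP[cg sg]]; apply/asboolP; split.
- exact: Ck0.
- exact: compactly_supported0.
- exact: Ck_lin.
- exact: compactly_supported_lin.
Qed.

HB.instance Definition _ :=
  GRing.isSubmodClosed.Build R (E -> R) C2_c_pred C2_c_submod.

Record C2_c := C2C { C2_c_val :> E -> R; _ : C2_c_val \in C2_c_pred }.
HB.instance Definition _ := [isSub for C2_c_val].
HB.instance Definition _ := [Choice of C2_c by <:].
HB.instance Definition _ := [SubChoice_isSubLmodule of C2_c by <:].

End function_spaces.

Definition supnorm B f : R := sup [set `|f x| | x in B].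

Definition C2norm B (phi : C2_c (interior B)) : R :=
  supnorm B phi + \sum_(i < N) supnorm B (partial i phi)
  + \sum_(i < N) \sum_(j < N) supnorm B (partial i (partial j phi)).

Definition L1 B f : Prop := mu.-integrable B (EFin \o f).

(* Measurability on Omega follows, Omega being a countable union of compacts. *)
Definition L1loc Omega f := forall K, compacts_in Omega K -> L1 K f.

Definition Q_V Omega V (xi : W1inf_c Omega) : R :=
  \int[mu]_(x in Omega) (grad_sq xi x + V x * xi x ^+ 2).

Definition Q_nonneg Omega V := forall xi, 0 <= @Q_V Omega V xi.

Definition norm_L Omega V (xi : W1inf_c Omega) : R := Num.sqrt (Q_V V xi).

Definition norm_LU Omega V U (xi : W1inf_c Omega) : R :=
  norm_L V xi + \int[mu]_(x in U) `|xi x|.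

(* Convergence of the functions [g t] to [l] along the filter [F], in the
   topology given by the seminorms [f |-> \int_K |f|] for [K] in [KK]:
   [KK = compacts_in Omega] yields L^1_loc(Omega), [KK = [set U]] yields
   L^1(U). *)
Definition L1_cvg (KK : set (set E)) T (F : set_system T) (g : T -> E -> R)
    (l : E -> R) :=
  forall K, KK K -> \int[mu]_(x in K) `|g t x - l x| @[t --> F] --> (0 : R).

Definition L1_subcritical Omega V :=
  Q_nonneg Omega V /\
  forall xi0 : W1inf_c Omega,
    L1_cvg (compacts_in Omega) (seminorm_nbhs (norm_L V) xi0) id xi0.

(* [J] is, up to almost everywhere equality, the continuous linear extension to
   the completion for [p] of the inclusion of the compactly supported Lipschitz
   functions in L^1_loc(D) or L^1(D), see [L1_cvg]. *)
Record L1_extension Omega (p : W1inf_c Omega -> R) (D : set E)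
    (KK : set (set E)) (J : completion p -> E -> R) : Prop := {
  L1_extension_L1 : forall u K, KK K -> L1 K (J u) ;
  L1_extension_linear : forall a u v,
    J (a *: u + v) = a *: J u + J v %[ae mu in D] ;
  L1_extension_eq : forall xi, J (to_completion p xi) = xi %[ae mu in D] ;
  L1_extension_continuous : forall u, L1_cvg KK (nbhs u) J (J u)
}.

(* The norm of [H_V] comes from an inner product when Q_V is nonnegative, as the
   limit of norms which do. *)
Definition H_V Omega V := completion (@norm_L Omega V).
Definition B_V Omega V U := completion (@norm_LU Omega V U).
Definition X_ B := completion (@C2norm B).

Record dual_element B (L : X_ B -> R) : Prop := {
  dual_linear : forall a phi psi, L (a *: phi + psi) = a * L phi + L psi ;
  dual_continuous : continuous L
}.

(* [L] is the element of the dual of [X_ B] defined by [g] in L^1(B); the values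
   on the dense subspace [C2_c (interior B)] determine it. *)
Definition represents B g (L : X_ B -> R) :=
  dual_element L /\
  forall phi : C2_c (interior B),
    L (to_completion (@C2norm B) phi) = \int[mu]_(x in B) (g x * phi x).

(* [VV] is the continuous linear extension to [B_V Omega V U], with values in
   the dual of [X_ B] with its dual norm, of [xi |-> V xi]. *)
Record potential_extension Omega V U B (VV : B_V Omega V U -> X_ B -> R) : Prop := {
  potential_extension_dual : forall u, dual_element (VV u) ;
  potential_extension_linear : forall a u v phi,
    VV (a *: u + v) phi = a * VV u phi + VV v phi ;
  potential_extension_eq : forall xi : W1inf_c Omega,
    represents (fun x => V x * xi x) (VV (to_completion (norm_LU V U) xi)) ;
  potential_extension_continuous : forall u e, 0 < e ->
    \forall v \near u, forall phi, `|VV v phi - VV u phi| <= e * `|phi|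
}.

(* The extensions [J] and [VV] exist, and are unique up to almost everywhere
   equality in [U] of the values of [J]: quantifying over them amounts to
   speaking of the extensions. *)
Definition balanced Omega V :=
  Q_nonneg Omega V /\
  forall c r, 0 < r -> closed_ball_e c r `<=` Omega ->
  let B := closed_ball_e c r in
  exists U, [/\ open U, compactly_inside U Omega, B `<=` U &
    forall (J : B_V Omega V U -> E -> R) (VV : B_V Omega V U -> X_ B -> R),
      L1_extension U [set U] J -> potential_extension VV ->
    forall u, L1 B (fun x => V x * J u x) /\
      represents (fun x => V x * J u x) (VV u)].

(* Setting f to +oo outside B leaves the essential infimum over B. *)
Definition ess_inf_on B f : \bar R := ess_inf mu (patch (cst +oo%E) B (EFin \o f)).

Definition ball_ess_inf_pos Omega f :=
  forall c r, 0 < r -> compactly_inside (open_ball c r) Omega ->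
    (0 < ess_inf_on (open_ball c r) f)%E.

Definition distributional_solution Omega V u f :=
  [/\ L1loc Omega u, L1loc Omega (fun x => V x * u x) &
    forall xi, test_function Omega xi ->
      \int[mu]_(x in Omega) (u x * (- laplacian xi x + V x * xi x)) =
      \int[mu]_(x in Omega) (f x * xi x)].

End functions_on_rV.

(* Main.v *)
(* For (ii), mollify the supersolution [u >= 0] to a smooth [v] and test its
   equation with [xi ^+ 2 / (v + d)].  Picone's inequality bounds
   [grad (xi ^+ 2 / (v + d)) . grad v] by [|grad xi| ^ 2], so that, after removing
   the mollification,
     int f xi^2 / (u + d) <= int |grad xi|^2 + int V u xi^2 / (u + d).
   Letting [d] tend to 0 first shows that [u > 0] almost everywhere, and then that
   the right-hand side tends to [Q_V xi]; on a compact [K], where [f >= m > 0], the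
   inequality [|xi| <= (t / 2) f xi^2 / (u + d) + (u + d) / (2 t m)] then bounds
   [int_K |xi|] by a multiple of [sqrt (Q_V xi)].

   For (i), L^1-subcriticality provides a bounded weight [om], bounded below on
   compacts, with [int om |xi| <= sqrt (Q_V xi)].  A minimizing sequence
   [xi_n >= 0] of [Q_V xi / 2 - int om xi] is Cauchy by the parallelogram identity;
   its limit [u] in [H_V] satisfies [J u >= 0], and the bilinear form of [Q_V] at
   [(xi_n, phi)] tends to [int om phi].  Since [V] is balanced, the limit of
   [int V xi_n phi] is [int V (J u) phi] for [phi] supported in a small ball, and
   smooth cutoffs extend the equation [- laplacian (J u) + V (J u) = om] to all test
   functions.  Finally [J u > 0] by the first step of (ii). *)
Require Import Defs.
From HB Require Import structures.
From mathcomp Require Import all_boot all_order all_algebra.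
From mathcomp Require Import all_classical all_reals all_analysis.
From mathcomp Require Import ess_sup_inf measurable_realfun.
From mathcomp Require Import ring lra.
From mathcomp Require finmap.
Set Implicit Arguments.
Unset Strict Implicit.
Unset Printing Implicit Defensive.
Import Order.TTheory GRing.Theory Num.Theory.
Import numFieldNormedType.Exports.
Local Open Scope classical_set_scope.
Local Open Scope ring_scope.

(** The low regularity decides the route. For [u] merely in L^1_loc the function [xi ^+ 2 / (u + d)]
    is not an admissible test function, hence the mollification; the shift [d] keeps all quotients
    bounded, so that L^1 convergence of the mollified data suffices to remove it. Positivity of [u]
    has to precede the second limit in [d], because [u / (u + d)] tends to 1 only where [u] is
    positive. Lipschitz functions are derived almost everywhere and integrated by parts through
    difference quotients: translation invariance makes the integrals of these vanish, and dominated
    convergence passes to the limit. In (i), nothing forces [V xi_n] to converge in L^1; it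
    converges in the dual of [X_ B], and being balanced is what identifies this limit with [V] times
    the limit function. The weight [om] has three roles: linear term of the functional, right-hand
    side of the equation, and norm in which [J] is constructed. The minimizing sequence may be taken
    nonnegative since passing to absolute values preserves [Q_V] and does not decrease the linear
    term. *)

Section almost_everywhere_lemmas.
Context d (T : measurableType d) (R : realType) (mu : {measure set T -> \bar R}).
Implicit Types P Q : T -> Prop.

Lemma ae_imp P Q : (forall x, P x -> Q x) ->
  {ae mu, forall x, P x} -> {ae mu, forall x, Q x}.
Proof. by move=> PQ; exact: filterS. Qed.

Lemma ae_imp2 P Q (S : T -> Prop) : (forall x, P x -> Q x -> S x) ->
  {ae mu, forall x, P x} -> {ae mu, forall x, Q x} -> {ae mu, forall x, S x}.
Proof. by move=> PQ; exact: filterS2. Qed.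

Lemma ae_all P : (forall x, P x) -> {ae mu, forall x, P x}.
Proof. by move=> h; exact: aeW. Qed.

Lemma ae_all_count (I : countType) (P : I -> T -> Prop) :
  (forall i, {ae mu, forall x, P i x}) -> {ae mu, forall x, forall i, P i x}.
Proof.
move=> aP; pose P' n x := if unpickle n is Some i then P i x else True.
have : {ae mu, forall x, forall n, P' n x}.
  apply: ae_foralln => n; rewrite /P'; case: (unpickle n) => [i|]; first exact: aP.
  exact: ae_all.
by apply: ae_imp => x + i => /(_ (pickle i)); rewrite /P' pickleK.
Qed.

End almost_everywhere_lemmas.

(** * Boxes, open sets and Borel sets of R^N *)

Section rV_borel.
Context {R : realType} {N : nat}.
Local Notation E := 'rV[R]_N.

Lemma rV_norm_coord (x : E) i : `|x ord0 i| <= `|x|.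
Proof.
rewrite [leRHS]/Num.norm/= mx_normrE.
exact: (le_bigmax _ (fun ij : 'I_1 * 'I_N => `|x ij.1 ij.2|) (ord0, i)).
Qed.

Lemma rV_norm_le (x : E) (r : R) : 0 <= r -> (forall i, `|x ord0 i| <= r) -> `|x| <= r.
Proof.
move=> r0 h; rewrite [leLHS]/Num.norm/= mx_normrE; apply/bigmax_leP; split => // -[i j] _ /=.
by rewrite ord1.
Qed.

Lemma rV_norm_lt (x : E) (r : R) : 0 < r -> (forall i, `|x ord0 i| < r) -> `|x| < r.
Proof.
move=> r0 h; rewrite [ltLHS]/Num.norm/= mx_normrE; apply/bigmax_ltP; split => // -[i j] _ /=.
by rewrite ord1.
Qed.

Definition obox (a b : E) : set E :=
  [set x | forall i, x ord0 i \in `]a ord0 i, b ord0 i[].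

Lemma measurable_obox a b : measurable (obox a b).
Proof.
by apply: (@measurable_rV_box R N (fun i => `]a ord0 i, b ord0 i[%classic)).
Qed.

Lemma oboxI a b c d : obox a b `&` obox c d =
  obox (\row_i Num.max (a ord0 i) (c ord0 i)) (\row_i Num.min (b ord0 i) (d ord0 i)).
Proof.
apply/seteqP; split => x /=.
  move=> [h1 h2] i; have := h1 i; have := h2 i.
  by rewrite !in_itv/= !mxE gt_max lt_min => /andP[-> ->] /andP[-> ->].
by move=> h; split=> i; have := h i; rewrite !in_itv/= !mxE gt_max lt_min;
  move=> /andP[/andP[h1 h2] /andP[h3 h4]]; apply/andP.
Qed.

(** Rational centres and half-sides [k.+1%:R^-1] give countably many boxes, enumerated by
    [unpickle]; those contained in [O] cover it. This links the topology to the product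
    sigma-algebra. *)
Lemma open_bigcup_obox (O : set E) : open O ->
  exists (P : set nat) (a b : nat -> E), O = \bigcup_(n in P) obox (a n) (b n).
Proof.
move=> oO.
pose ctr (p : 'rV[rat]_N * nat) : E := \row_i ratr (p.1 ord0 i).
pose e (p : 'rV[rat]_N * nat) : E := \row_i p.2.+1%:R^-1.
pose q n : 'rV[rat]_N * nat := odflt (0, 0%N) (unpickle n).
exists [set n | obox (ctr (q n) - e (q n)) (ctr (q n) + e (q n)) `<=` O].
exists (fun n => ctr (q n) - e (q n)), (fun n => ctr (q n) + e (q n)).
apply/seteqP; split => x; last by move=> [n /= On /On].
move=> Ox; have /nbhs_ballP[r /= r0 rO] : nbhs x O by exact: open_nbhs_nbhs.
(* The point [x] and any other point of the box are less than two half-sides apart, hence the bound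
   [r / 2]. *)
have [k kr] : exists k : nat, k.+1%:R^-1 < r / 2.
  have [k] := @ltr_add_invr R 0 (r / 2) ltac:(by lra).
  by rewrite add0r => kr; exists k.
have k0 : 0 < k.+1%:R^-1 :> R by rewrite invr_gt0.
have /choice[p hp] i : exists p : rat, x ord0 i - k.+1%:R^-1 < ratr p < x ord0 i + k.+1%:R^-1.
  have /rat_in_itvoo[p] : x ord0 i - k.+1%:R^-1 < x ord0 i + k.+1%:R^-1 by rewrite ltrBlDr -addrA ltrDl addr_gt0.
  by rewrite in_itv/=; exists p.
pose pp : 'rV[rat]_N * nat := (\row_i p i, k).
have qE : q (pickle pp) = pp by rewrite /q pickleK.
exists (pickle pp) => /=; rewrite qE.
  move=> y yb; apply: rO; rewrite -ball_normE /ball_/=.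
  apply: rV_norm_lt => // i; rewrite !mxE.
  have := yb i; rewrite in_itv/= !mxE.
  change pp.2 with k; move: (k.+1%:R^-1) (hp i) kr k0 => d /andP[h1 h2] kr k0 /andP[y1 y2].
  by rewrite ltr_norml; apply/andP; split; lra.
move=> i; rewrite in_itv/= !mxE.
change pp.2 with k; move: (k.+1%:R^-1) (hp i) kr k0 => d /andP[h1 h2] kr k0.
by apply/andP; split; lra.
Qed.

Lemma open_measurable_rV (O : set E) : open O -> measurable O.
Proof.
move=> /open_bigcup_obox[P [a [b ->]]].
apply: bigcup_measurable => // n _; exact: measurable_obox.
Qed.

Lemma closed_measurable_rV (A : set E) : closed A -> measurable A.
Proof. by move=> cA; rewrite -[A]setCK; apply: measurableC; apply: open_measurable_rV; exact: closed_openC. Qed.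

Lemma compact_measurable_rV (A : set E) : compact A -> measurable A.
Proof. by move=> cA; apply: closed_measurable_rV; apply: compact_closed => //; exact: norm_hausdorff. Qed.

Lemma continuous_measurable_rV (f : E -> R) : continuous f -> measurable_fun setT f.
Proof.
move=> cf; apply: (measurability _ (RGenOpens.measurableE R)).
move=> _ [_ [x [y ->]] <-]; rewrite setTI; apply: open_measurable_rV.
by move/continuousP : cf; apply; exact: interval_open.
Qed.

(** Boxes are stable under intersection, so this presentation serves the uniqueness of measures and
    the monotone class argument below. The preimage of an open interval by a coordinate is open,
    hence a countable union of boxes. *)
Lemma measurable_rVE :
  @measurable _ E = <<s [set A | exists a b, A = obox a b] >>.
Proof.
apply/seteqP; split; last first.
  apply: smallest_sub; first exact: sigma_algebra_measurable.
  by move=> _ [a [b ->]]; exact: measurable_obox.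
apply: smallest_sub; first exact: smallest_sigma_algebra.
rewrite -bigcup_seq => _ [i _ [B mB <-]]; rewrite setTI.
suff : (@RGenOpens.G R).-sigma.-measurable `<=`
   [set B | <<s [set A | exists a b, A = obox a b] >> (rV_coord i @^-1` B)].
  by apply; rewrite -RGenOpens.measurableE.
apply: smallest_sub.
  split => [|A|A].
  - by rewrite /= preimage_set0; exact: sigma_algebra0.
  - by rewrite /= setTD -preimage_setC => h; rewrite -setTD; exact: sigma_algebraCD.
  - by move=> h /=; rewrite preimage_bigcup; exact: sigma_algebra_bigcup.
move=> _ [x [y ->]] /=.
have /open_bigcup_obox[P [a [b ->]]] : open (rV_coord i @^-1` `]x, y[%classic : set E).
  have /continuousP : continuous (rV_coord i : E -> R) by exact: coord_continuous.
  by apply; exact: interval_open.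
rewrite bigcup_mkcond.
apply: sigma_algebra_bigcup => n; case: ifPn => _; last exact: sigma_algebra0.
by apply: sub_sigma_algebra; exists (a n), (b n).
Qed.

Lemma setI_closed_obox : setI_closed [set A : set E | exists a b, A = obox a b].
Proof. by move=> _ _ [a [b ->]] [c [d ->]]; rewrite oboxI; eexists; eexists. Qed.

Lemma measurable_rV_addr (h : E) : measurable_fun setT (fun x : E => x + h).
Proof.
apply: measurable_fun_rV => i.
rewrite (_ : _ \o _ = (fun x : E => rV_coord i x + h ord0 i)).
  by apply: measurable_funD => //; exact: measurable_rV_coord.
by apply/funext => x; rewrite /rV_coord /= !mxE.
Qed.

End rV_borel.

(** * Differentiability of Lipschitz functions almost everywhere *)

Section lipschitz_ae_derivable.
Context {R : realType}.
Local Notation lam := (@lebesgue_measure R).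

(* [f + x/2] and [x/2 - f] are nondecreasing and their Stieltjes measures add up
   to the Lebesgue measure, hence are absolutely continuous. *)
Lemma lipschitz_half_ae_derivable (f : R -> R) :
  (forall x y, `|f x - f y| <= `|x - y| / 2) ->
  {ae lam, forall x, derivable f x 1}.
Proof.
move=> fL.
have cf : continuous f.
  move=> x; apply/cvgrPdist_le => e e0; near=> y.
  rewrite (le_trans (fL _ _))// ler_pdivrMr//.
  near: y; apply: cvgr_dist_le; first exact: cvg_id.
  by rewrite mulr_gt0.
pose g x := f x + x / 2; pose h x := x / 2 - f x.
have chalf : continuous (fun x : R => x / 2).
  by move=> x; apply: cvgM; [exact: cvg_id|exact: cvg_cst].
have cg : continuous g by move=> x; apply: cvgD; [exact: cf|exact: chalf].
have ch : continuous h by move=> x; apply: cvgB; [exact: chalf|exact: cf].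
have ndg : {homo g : x y / x <= y}.
  move=> x y xy; have := fL y x; rewrite [X in _ <= X / _]ger0_norm ?subr_ge0//.
  by move=> /ler_normlP[? ?]; rewrite /g; lra.
have ndh : {homo h : x y / x <= y}.
  move=> x y xy; have := fL y x; rewrite [X in _ <= X / _]ger0_norm ?subr_ge0//.
  by move=> /ler_normlP[? ?]; rewrite /h; lra.
pose G : cumulative R R := HB.pack g
  (isCumulative.Build R _ R g ndg (right_continuousW cg)).
pose H : cumulative R R := HB.pack h
  (isCumulative.Build R _ R h ndh (right_continuousW ch)).
pose mG := lebesgue_stieltjes_measure G.
pose mH := lebesgue_stieltjes_measure H.
have LSE (F : cumulative R R) a b : a <= b ->
    lebesgue_stieltjes_measure F `]a, b]%classic = (F b - F a)%:E.
  move=> ab; rewrite /lebesgue_stieltjes_measure /measure_extension.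
  rewrite measurable_mu_extE/=; last exact: is_ocitv.
  by rewrite wlength_itv_bnd.
have addE0 X : ocitv X -> lam X = measure_add mG mH X.
  move=> /ocitvP[->|[[a b]/= ab ->]].
    by rewrite !measure0.
  transitivity (mG `]a, b]%classic + mH `]a, b]%classic)%E; last by rewrite measure_addE.
  rewrite /mG /mH !LSE ?ltW// [LHS]LSE ?ltW//.
  by rewrite -EFinD /= /g /h; congr _%:E; lra.
have addE A : measurable A -> lam A = measure_add mG mH A.
  exact: lebesgue_measure_unique.
have dom A : measurable A -> lam A = 0%E -> mG A = 0%E.
  move=> mA; rewrite addE// measure_addE => /eqP.
  by rewrite padde_eq0 ?measure_ge0// => /andP[/eqP].
(* On a bounded interval the Stieltjes measure of [g] is finite, so its Radon-Nikodym density is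
   integrable. *)
suff derM (M : nat) : {ae lam, forall x, x \in `]- M%:R, M%:R[ -> derivable f x 1}.
  have : {ae lam, forall x, forall M : nat, x \in `]- M%:R, M%:R[ -> derivable f x 1}.
    exact: ae_foralln.
  apply: ae_imp => x /(_ (Num.bound `|x : R|)); apply.
  by rewrite in_itv/= -ltr_norml; exact: archi_boundP.
pose D : set (measurableTypeR R) := `]- M%:R, M%:R]%classic.
have mD : measurable D by exact: measurable_itv.
have Doo : (mG D < +oo)%E.
  by rewrite /D [mG _]LSE ?ltry//; rewrite ler_oppl oppr0 ler0n || (have := ler0n R M; lra).
pose nu : {finite_measure set (measurableTypeR R) -> \bar R} := mfrestr mD Doo.
have nulam : nu `<< lam.
  apply/null_content_dominatesP => A mA A0.
  change (mG (A `&` D) = 0%E); rewrite dom//; first exact: measurableI.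
  by apply/eqP; rewrite -measure_le0 -A0 le_measure ?inE//; exact: measurableI.
have [d [d0 dfin dint nuE]] := @radon_nikodym_sigma_finite _ _ _ lam nu nulam.
have dE : d = EFin \o (fine \o d) by apply/funext => x /=; rewrite fineK.
have fdint : lam.-integrable setT (EFin \o (fine \o d)) by rewrite -dE.
(* The primitive [F] of the density is derivable almost everywhere by Lebesgue differentiation, and
   [g] differs from it by a constant on the interval. *)
have := @FTC1 R (fine \o d) (BRight (- M%:R)) _ _; set F := (fun x => _).
have intS y : lam.-integrable [set` Interval (BRight (- M%:R)) (BRight y)] (EFin \o (fine \o d)).
  by apply: integrableS fdint.
have locint : locally_integrable [set: R] (fine \o d).
  have := integrable_locally measurableT fdint.
  by rewrite patch_setT.
move=> /(_ intS locint); apply: ae_imp => x hx /[dup] xM; rewrite in_itv/= => /andP[Mx xM'].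
have [dF _] := hx Mx.
have gE y : y \in `]- M%:R, M%:R[ -> g y = F y + g (- M%:R).
  rewrite in_itv/= => /andP[My yM].
  apply: (@addIr _ (- g (- M%:R))); rewrite addrK.
  apply: EFin_inj; rewrite -[LHS](LSE G) ?ltW//.
  rewrite /F /Rintegral fineK; last exact: integrable_fin_num.
  under eq_integral do rewrite /= fineK//.
  rewrite -nuE//.
  change (mG `]- M%:R, y]%classic = mG (`]- M%:R, y]%classic `&` D)).
  rewrite setIidl// => z /=.
  by rewrite /D /= !in_itv/= => /andP[-> /le_trans]; apply; exact: ltW.
have : derivable g x 1.
  apply: (@near_eq_derivable R R^o R^o (F + cst (g (- M%:R)))).
  - by apply: filterS (near_in_itvoo xM) => y /gE ->.
  - exact: (@derivableD R R^o R^o _ _ _ _ dF (derivable_cst _ _ _)).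
move=> dg; have -> : f = g - (fun x => x * 2^-1).
  by apply/funext => y; rewrite /g !fctE addrK.
have d2 : derivable (fun x : R^o => x * 2^-1 : R^o) x 1.
  by apply: derivableM; [exact: derivable_id|exact: derivable_cst].
exact: (@derivableB R R^o R^o _ _ _ _ dg d2).
Unshelve. all: by end_near. Qed.

Lemma lipschitz_ae_derivable (f : R -> R) k :
  (forall x y, `|f x - f y| <= k * `|x - y|) ->
  {ae lam, forall x, derivable f x 1}.
Proof.
(* The factor 2 brings the Lipschitz constant of [c^-1 *: f] below 1/2; the summand 1 keeps [c]
   positive for every [k]. *)
move=> fL; pose c := 2 * (`|k| + 1).
have c0 : 0 < c by rewrite mulr_gt0// ltr_wpDl.
have : {ae lam, forall x, derivable (c^-1 *: f) x 1}.
  apply: lipschitz_half_ae_derivable => x y.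
  rewrite !fctE -mulrBr normrM gtr0_norm ?invr_gt0// mulrC ler_pdivrMr//.
  rewrite (le_trans (fL _ _))// /c mulrCA -mulrA.
  have := ler_norm k; have := normr_ge0 (x - y); rewrite [2 * _]mulrC.
  by move: (`|x - y|) (`|k|) => u v; nra.
apply: ae_imp => x dx.
rewrite (_ : f = c *: (c^-1 *: f)); first exact: derivableZ.
by rewrite scalerA divff ?scale1r// gt_eqF.
Qed.

End lipschitz_ae_derivable.

Section null_lines.
Context {R : realType}.
Local Notation lam := (@lebesgue_measure R).
Local Notation mu N := (@lebesgue_rV R N).

Local Notation e_ i := (delta_mx (ord0 : 'I_1) i).

(** Fubini, by induction on the dimension. In direction 0 the first coordinate must be integrated
    first, which calls for the other order of the product measure; in any other direction it is
    frozen and the induction hypothesis applies to the slice. *)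
Lemma null_lines N (i : 'I_N) (A : set 'rV[R]_N) : measurable A ->
  (forall x, lam.-negligible [set t | A (x + t *: e_ i)]) -> mu N A = 0%E.
Proof.
elim: N i A => [[]//|N IH] i A mA lA.
have mA' : measurable (cons_rV @^-1` A).
  by rewrite -[X in measurable X]setTI; apply: measurable_cons_rV.
have -> : mu N.+1 A = (lam \x mu N)%E (cons_rV @^-1` A) by [].
have [i0|[j ij]] : i = ord0 \/ exists j, i = lift ord0 j.
  by case: (unliftP ord0 i) => [j ->|->]; [right; exists j|left].
- rewrite (@product_measure_unique _ _ _ _ R lam (mu N) (lam \x^ mu N)%E)//; last first.
    by move=> B C mB mC; exact: product_measure2E.
  rewrite /product_measure2; apply: integral0_eq => v _ /=.
  apply: measure_negligible; first exact: measurable_ysection.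
  have := lA (cons_rV (0, v)); congr (lam.-negligible _).
  apply/seteqP; split => t /=; rewrite /ysection/= inE i0; congr (A _);
    apply/rowP => k; rewrite !mxE eqxx/=;
    case: (unliftP ord0 k) => [l ->|->] /=;
    by rewrite ?liftK ?unlift_none /= ?eqxx ?mulr0 ?mulr1 ?addr0 ?add0r.
- rewrite /product_measure1; apply: integral0_eq => t _ /=.
  apply: (IH j); first exact: measurable_xsection.
  move=> v; have := lA (cons_rV (t, v)); congr (lam.-negligible _).
  apply/seteqP; split => s /=; rewrite /xsection/= inE ij; congr (A _);
    apply/rowP => k; rewrite !mxE eqxx/=;
    case: (unliftP ord0 k) => [l ->|->] /=;
    by rewrite ?liftK ?unlift_none /= ?mxE ?eqxx ?(inj_eq lift_inj) ?mulr0 ?addr0.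
Qed.

End null_lines.

(** These steps turn derivatives into limits of sequences, the form required by measurability and
    dominated convergence. *)
Lemma harmonic_dnbhs (R : realType) : (fun n => n.+1%:R^-1 : R) @ \oo --> (0 : R)^'.
Proof.
move=> A [e /= e0 eA].
have /cvgrPdist_lt/(_ _ e0) := @cvg_harmonic R.
apply: filterS => n; rewrite /harmonic/= => h; exact: eA.
Qed.

Section continuous_real_functions.
Context {R : realType} {T : topologicalType}.
Implicit Types f g : T -> R.

Lemma contB f g : continuous f -> continuous g -> continuous (fun x => f x - g x).
Proof. by move=> cf cg x; apply: cvgB; [exact: cf|exact: cg]. Qed.

Lemma contM f g : continuous f -> continuous g -> continuous (fun x => f x * g x).
Proof. by move=> cf cg x; apply: cvgM; [exact: cf|exact: cg]. Qed.

Lemma cont_norm f : continuous f -> continuous (fun x => `|f x|).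
Proof. by move=> cf x; apply: cvg_norm; exact: cf. Qed.

Lemma cont_cst (c : R) : continuous (fun _ : T => c).
Proof. by move=> x; exact: cvg_cst. Qed.

Lemma cont_comp (h : R -> R) f : continuous h -> continuous f -> continuous (fun x => h (f x)).
Proof. by move=> ch cf x; apply: (continuous_comp (f := f) (g := h)); [exact: cf|exact: ch]. Qed.

End continuous_real_functions.

Section directional_derivative.
Context {R : realType} {E : normedModType R}.
Implicit Types (f : E -> R) (v x : E).

(** The order of the summands makes this convertible to the quotient inside [derivable], so that
    [derivable_dquot] holds by computation. *)
Definition dquot f v (h : R) x : R := h^-1 * (f (h *: v + x) - f x).

Lemma continuous_dquot f v h : continuous f -> continuous (dquot f v h).
Proof.
move=> cf; apply: contM; first exact: cont_cst.
apply: contB; last exact: cf.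
move=> x; apply: (continuous_comp (f := fun y => h *: v + y)); last exact: cf.
by apply: cvgD; [exact: cvg_cst|exact: cvg_id].
Qed.

Lemma continuous_dquot_step f v x h : continuous f -> h != 0 ->
  {for h, continuous (fun h => dquot f v h x)}.
Proof.
move=> cf h0.
have ct : continuous (fun t : R => f (t *: v + x)).
  move=> t; apply: (continuous_comp (f := fun t : R => t *: v + x)); last exact: cf.
  by apply: cvgD; [apply: cvgZr_tmp; exact: cvg_id|exact: cvg_cst].
apply: cvgM; first exact: cvgV.
by apply: cvgB; [exact: ct|exact: cvg_cst].
Qed.

Lemma derivable_dquot f v x : derivable f x v <-> cvg (dquot f v h x @[h --> 0^']).
Proof. by []. Qed.

(* Cauchy's criterion along the rationals makes derivability a countable
   condition, whence the measurability of its domain. *)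
Lemma derivable_rat_cauchyP f v x : continuous f ->
  derivable f x v <->
  forall m : nat, exists n : nat, forall p q : rat,
    p != 0 -> q != 0 -> `|ratr p| < n.+1%:R^-1 :> R -> `|ratr q| < n.+1%:R^-1 :> R ->
    `|dquot f v (ratr p) x - dquot f v (ratr q) x| <= m.+1%:R^-1.
Proof.
move=> cf; rewrite derivable_dquot; split.
  move=> /cvg_ex[l /= /cvgrPdist_lt lP] m.
  have [|e /= e0 eP] := lP (m.+1%:R^-1 / 2); first by rewrite divr_gt0.
  have [n] := @ltr_add_invr R 0 e e0; rewrite add0r => ne.
  exists n => p q p0 q0 pn qn.
  have h (r : rat) : r != 0 -> `|ratr r : R| < n.+1%:R^-1 ->
      `|l - dquot f v (ratr r) x| < m.+1%:R^-1 / 2.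
    move=> r0 rn; apply: eP => /=.
      by rewrite sub0r normrN (lt_trans rn).
    by rewrite fmorph_eq0.
  have := h _ p0 pn; have := h _ q0 qn.
  rewrite -[X in `|X| <= _](subrKA l) => h1 h2.
  rewrite (le_trans (ler_normD _ _))// [leRHS]splitr lerD// 1?ltW//.
  by rewrite distrC.
move=> H.
apply/cauchy_cvgP/cauchyP => e e0.
have [m] := @ltr_add_invr R 0 e e0; rewrite add0r => me.
have [n nP] := H m.
have n0 : 0 < n.+1%:R^-1 :> R by rewrite invr_gt0.
(* Continuity of the quotient in the step, away from 0, carries the estimate from rational to real
   steps. *)
have HR (h k : R) : h != 0 -> k != 0 -> `|h| < n.+1%:R^-1 -> `|k| < n.+1%:R^-1 ->
    `|dquot f v h x - dquot f v k x| <= m.+1%:R^-1.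
  move=> h0 k0 hn kn.
  have app (r : R) : r != 0 -> `|r| < n.+1%:R^-1 -> exists a : nat -> rat,
     [/\ forall j, a j != 0, forall j, `|ratr (a j) : R| < n.+1%:R^-1 &
     (fun j => ratr (a j) : R) @ \oo --> r].
    move=> r0 rn.
    (* The three bounds respectively give convergence, exclude the approximant 0, and keep the
       approximants within [n.+1%:R^-1] of 0. *)
    pose d (j : nat) := Num.min j.+1%:R^-1 (Num.min `|r| (n.+1%:R^-1 - `|r|)).
    have d0 j : 0 < d j by rewrite !lt_min invr_gt0 ltr0Sn normr_gt0 r0 subr_gt0.
    have /choice[a aP] j : exists p : rat, `|r - ratr p| < d j.
      have /rat_in_itvoo[p] : r - d j < r + d j by have := d0 j; lra.
      rewrite in_itv/= => /andP[h1 h2]; exists p.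
      by rewrite ltr_norml; apply/andP; split; lra.
    exists a; split.
    - move=> j; apply/eqP => aj; have := aP j.
      by rewrite aj rmorph0 subr0 /d !lt_min ltxx/= andbF.
    - move=> j; have := aP j; rewrite /d !lt_min => /and3P[_ _ h3].
      have := lerB_dist (ratr (a j)) r; rewrite distrC lerBlDr => /le_lt_trans; apply.
      by rewrite -ltrBrDr.
    - apply/cvgrPdist_lt => e' e'0.
      have /cvgrPdist_lt/(_ _ e'0) := @cvg_harmonic R.
      apply: filterS => j; rewrite sub0r normrN /harmonic/= ger0_norm ?invr_ge0// => je.
      by have := aP j; rewrite /d lt_min => /andP[h1 _]; exact: lt_trans h1 je.
  have [a [a0 an ah]] := app _ h0 hn; have [b [b0 bn bk]] := app _ k0 kn.
  have ca := cvg_comp _ _ ah (continuous_dquot_step (v := v) (x := x) cf h0).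
  have cb := cvg_comp _ _ bk (continuous_dquot_step (v := v) (x := x) cf k0).
  have cab : (fun j => `|dquot f v (ratr (a j)) x - dquot f v (ratr (b j)) x|) @ \oo -->
      `|dquot f v h x - dquot f v k x|.
    by apply: cvg_norm; apply: cvgB.
  apply: (ler_cvg_to cab (cvg_cst _)); apply: nearW => j /=.
  exact: nP.
exists (dquot f v (n.+1%:R^-1 / 2) x).
exists n.+1%:R^-1 => //= h /=; rewrite sub0r normrN => hn h0.
rewrite /ball/= (le_lt_trans _ me)// HR//.
by rewrite gtr0_norm ?divr_gt0// ltr_pdivrMr// ltr_pMr// ltr1n.
Qed.

Lemma cvg_dquot_harmonic f v x : derivable f x v ->
  (fun n => dquot f v n.+1%:R^-1 x) @ \oo --> 'D_v f x.
Proof. by move=> d; exact: cvg_comp _ _ (@harmonic_dnbhs R) d. Qed.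

Lemma derive_not_derivable f v x : ~ derivable f x v -> 'D_v f x = 0.
Proof. by move=> d; rewrite /derive dvgP. Qed.

(** At a point without derivative the default value 0 satisfies the bound, so the partial
    derivatives of a Lipschitz function are bounded everywhere and not only almost everywhere. *)
Lemma derive_lipschitz_le f v k x :
  (forall x y, `|f x - f y| <= k * `|x - y|) -> `|'D_v f x| <= k * `|v|.
Proof.
move=> fk; have [d|nd] := pselect (derivable f x v); last first.
  rewrite derive_not_derivable// normr0.
  by rewrite (le_trans (normr_ge0 (f v - f 0)))// (le_trans (fk _ _))// subr0.
apply: (ler_cvg_to (cvg_norm (cvg_dquot_harmonic d)) (cvg_cst _)).
apply: nearW => n; rewrite /dquot normrM gtr0_norm ?invr_gt0//.
rewrite mulrC ler_pdivrMr// (le_trans (fk _ _))// addrK normrZ.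
by rewrite gtr0_norm ?invr_gt0// [leRHS]mulrAC -mulrA.
Qed.

Lemma lipschitz_cont f k : (forall x y, `|f x - f y| <= k * `|x - y|) ->
  continuous f.
Proof.
move=> fk x; apply/cvgrPdist_le => e e0.
have k0 : 0 < `|k| + 1 by rewrite ltr_wpDl.
near=> y; rewrite (le_trans (fk _ _))//.
apply: (@le_trans _ _ ((`|k| + 1) * `|x - y|)).
  by rewrite ler_wpM2r// (le_trans (ler_norm _))// lerDl.
rewrite mulrC -ler_pdivlMr//; near: y.
by apply: cvgr_dist_le; [exact: cvg_id|rewrite divr_gt0].
Unshelve. all: by end_near. Qed.

Lemma derivable_line f x v t :
  derivable (fun s : R => f (x + s *: v)) t 1 <-> derivable f (x + t *: v) v.
Proof.
rewrite /derivable/=.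
rewrite (_ : (fun h : R => _) = (fun h => h^-1 *: ((f \o shift (x + t *: v)) (h *: v) - f (x + t *: v))))//.
apply/funext => h /=; congr (_ *: (f _ - _)).
by rewrite scalerDl [_ *: 1]mulr1 addrCA.
Qed.

End directional_derivative.

Section partial_lipschitz.
Context {R : realType} {N : nat}.
Local Notation E := 'rV[R]_N.
Local Notation mu := (@lebesgue_rV R N).
Implicit Types (f : E -> R) (v : E).

Lemma measurable_derivable f v : continuous f -> measurable [set x | derivable f x v].
Proof.
move=> cf.
pose P (m n : nat) (pq : rat * rat) : set E := [set x |
   pq.1 != 0 -> pq.2 != 0 -> `|ratr pq.1| < n.+1%:R^-1 :> R -> `|ratr pq.2| < n.+1%:R^-1 :> R ->
    `|dquot f v (ratr pq.1) x - dquot f v (ratr pq.2) x| <= m.+1%:R^-1].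
have -> : [set x | derivable f x v] = \bigcap_m \bigcup_n \bigcap_k
    P m n (odflt (0, 0) (unpickle k)).
  apply/seteqP; split=> x /=.
    move=> /(derivable_rat_cauchyP _ _ cf) H m _; have [n nP] := H m.
    by exists n => // k _; exact: nP.
  move=> H; apply/(derivable_rat_cauchyP _ _ cf) => m; have [n _ nP] := H m I.
  by exists n => p q; have := nP (pickle (p, q)) I; rewrite pickleK.
apply: bigcapT_measurable => m; apply: bigcupT_measurable => n.
apply: bigcapT_measurable => k; rewrite /P; move: (odflt _ _) => [p q]/=.
have [p0|p0] := eqVneq p 0.
  by rewrite (_ : mkset _ = setT)//; apply/seteqP; split.
have [q0|q0] := eqVneq q 0.
  by rewrite (_ : mkset _ = setT)//; apply/seteqP; split.
have [pn|pn] := ltP `|ratr p : R| n.+1%:R^-1; last first.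
  by rewrite (_ : mkset _ = setT)//; apply/seteqP; split.
have [qn|qn] := ltP `|ratr q : R| n.+1%:R^-1; last first.
  by rewrite (_ : mkset _ = setT)//; apply/seteqP; split.
rewrite (_ : mkset _ = (fun x => `|dquot f v (ratr p) x - dquot f v (ratr q) x|) @^-1`
   [set r | r <= m.+1%:R^-1]); last first.
  by apply/seteqP; split => x /=; [exact|move=> ->].
apply: closed_measurable_rV; apply: closed_comp; last exact: closed_le.
by move=> x _; apply: cont_norm; apply: contB; exact: continuous_dquot.
Qed.

Lemma measurable_derive f v : continuous f -> measurable_fun setT (fun x => 'D_v f x).
Proof.
move=> cf; have mD := measurable_derivable v cf.
(* The indicator makes the sequence converge at every point, to the default value 0 where [f] is not
   derivable. *)
apply: (@measurable_fun_cvg _ _ _ _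
  (fun n x => dquot f v n.+1%:R^-1 x * \1_[set x | derivable f x v] x)).
  move=> n; apply: measurable_funM.
    by apply: continuous_measurable_rV; exact: continuous_dquot.
  exact: measurable_indic.
move=> x _; have [d|nd] := pselect (derivable f x v).
  rewrite indicE mem_set//=.
  under eq_fun do rewrite mulr1.
  exact: cvg_dquot_harmonic.
rewrite derive_not_derivable// indicE memNset//=.
under eq_fun do rewrite mulr0.
exact: cvg_cst.
Qed.

Lemma norm_delta_mx i : `|delta_mx (ord0 : 'I_1) i : E| <= 1.
Proof.
apply: rV_norm_le => // j; rewrite mxE eqxx/=; case: (j == i) => /=.
  by rewrite normr1.
by rewrite normr0.
Qed.

(** The exceptional set is measurable and meets every line of direction [i] in a null set, by the
    one-dimensional result; [null_lines] concludes. *)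
Lemma lipschitz_ae_partial f k i : (forall x y, `|f x - f y| <= k * `|x - y|) ->
  {ae mu, forall x, derivable f x (delta_mx ord0 i)}.
Proof.
move=> fk; have cf := lipschitz_cont fk.
have mD := measurable_derivable (delta_mx ord0 i) cf.
apply/negligibleP; first exact: measurableC.
apply: (@null_lines _ _ i); first exact: measurableC.
move=> x; have k0 : `|k| >= 0 by [].
have : {ae lebesgue_measure, forall t, derivable (fun s : R => f (x + s *: delta_mx ord0 i)) t 1}.
  apply: (@lipschitz_ae_derivable _ _ `|k|) => s t.
  rewrite (le_trans (fk _ _))// opprD addrACA subrr add0r -scalerBl normrZ.
  apply: (@le_trans _ _ (`|k| * (`|s - t| * `|delta_mx ord0 i : E|))).
    by rewrite ler_wpM2r ?mulr_ge0// ler_norm.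
  by rewrite ler_wpM2l// ler_piMr// norm_delta_mx.
apply: negligibleS => t /= nd d; apply: nd.
by apply/derivable_line.
Qed.

Lemma measurable_partial f i : continuous f -> measurable_fun setT (partial i f).
Proof. exact: measurable_derive. Qed.

Lemma partial_lipschitz_le f k i x : (forall x y, `|f x - f y| <= k * `|x - y|) ->
  `|partial i f x| <= `|k|.
Proof.
move=> fk; apply: (le_trans (derive_lipschitz_le (k := `|k|) _ _ _)).
  by move=> y z; rewrite (le_trans (fk _ _))// ler_wpM2r// ler_norm.
by rewrite ler_piMr// norm_delta_mx.
Qed.

Lemma partial_near_eq f g i x : (\near x, f x = g x) -> partial i f x = partial i g x.
Proof. exact: near_eq_derive. Qed.

Lemma partial_eq0 f i (K : set E) : closed K -> (forall x, ~ K x -> f x = 0) ->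
  forall x, ~ K x -> partial i f x = 0.
Proof.
move=> cK fK x Kx.
rewrite (@partial_near_eq _ (cst 0)); first by rewrite /partial derive_cst.
have : nbhs x (~` K) by apply: open_nbhs_nbhs; split => //; exact: closed_openC.
by apply: filterS => y; exact: fK.
Qed.

End partial_lipschitz.

(** * Real-valued integrals and translations *)

Section real_integrals.
Context d (T : measurableType d) (R : realType) (mu : {measure set T -> \bar R}).
Implicit Types f g h : T -> R.
Local Notation intg f := (mu.-integrable setT (EFin \o f)).
Local Notation itg f := (\int[mu]_x f x).

Lemma intg_measurable f : intg f -> measurable_fun setT f.
Proof. by move=> /measurable_int /measurable_EFinP. Qed.

Lemma eq_intg f g : (forall x, f x = g x) -> intg f -> intg g.
Proof. by move=> fg; rewrite (_ : g = f)//; apply/funext => x; rewrite fg. Qed.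

Lemma intgD f g : intg f -> intg g -> intg (fun x => f x + g x).
Proof. by move=> If Ig; have := integrableD measurableT If Ig. Qed.

Lemma intgZ c f : intg f -> intg (fun x => c * f x).
Proof. by move=> If; have := integrableZl measurableT c If. Qed.

Lemma intgB f g : intg f -> intg g -> intg (fun x => f x - g x).
Proof. by move=> If Ig; have := integrableB measurableT If Ig. Qed.

Lemma intg0 : intg (fun=> 0).
Proof. exact: integrable0. Qed.

Lemma intg_sum (I : Type) (s : seq I) (F : I -> T -> R) :
  (forall i, intg (F i)) -> intg (fun x => \sum_(i <- s) F i x).
Proof.
move=> IF; elim: s => [|i s IH].
  by apply: eq_intg intg0 => x; rewrite big_nil.
by apply: eq_intg (intgD (IF i) IH) => x; rewrite big_cons.
Qed.

Lemma intg_norm f : intg f -> intg (fun x => `|f x|).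
Proof. exact: integrable_norm. Qed.

Lemma le_intg f g : measurable_fun setT f -> (forall x, `|f x| <= g x) ->
  intg g -> intg f.
Proof.
move=> mf fg; apply: le_integrable => //; first exact/measurable_EFinP.
by move=> x _ /=; rewrite lee_fin (le_trans (fg x))// ler_norm.
Qed.

Lemma intgM f g (M : R) : intg f -> measurable_fun setT g ->
  (forall x, `|g x| <= M) -> intg (fun x => f x * g x).
Proof.
move=> If mg gM; apply: le_intg (intgZ M (intg_norm If)) => [|x].
  by apply: measurable_funM => //; exact: intg_measurable.
by rewrite normrM mulrC ler_wpM2r.
Qed.

Lemma intg_indic (A : set T) : measurable A -> (mu A < +oo)%E -> intg (\1_A).
Proof.
move=> mA Aoo; apply/integrableP; split; first exact/measurable_EFinP/measurable_indic.
by under eq_integral do rewrite /= ger0_norm//; rewrite integral_indic// setIT.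
Qed.

Lemma intg_bounded (A : set T) f (M : R) : measurable A -> (mu A < +oo)%E ->
  measurable_fun setT f -> (forall x, `|f x| <= M) -> (forall x, ~ A x -> f x = 0) ->
  intg f.
Proof.
move=> mA Aoo mf fM fA.
have IA := intg_indic mA Aoo.
apply: eq_intg (intgM IA mf fM) => x.
rewrite indicE; case: (boolP (x \in A)); first by rewrite mul1r.
by rewrite notin_setE mul0r => /fA ->.
Qed.

Lemma itgD f g : intg f -> intg g -> itg (fun x => f x + g x) = itg f + itg g.
Proof. exact: RintegralD. Qed.

Lemma itgB f g : intg f -> intg g -> itg (fun x => f x - g x) = itg f - itg g.
Proof. exact: RintegralB. Qed.

Lemma itgZ c f : intg f -> itg (fun x => c * f x) = c * itg f.
Proof. exact: RintegralZl. Qed.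

Lemma itg0 : itg (fun=> 0) = 0.
Proof. by rewrite /Rintegral integral0. Qed.

Lemma itg_sum (I : Type) (s : seq I) (F : I -> T -> R) :
  (forall i, intg (F i)) -> itg (fun x => \sum_(i <- s) F i x) = \sum_(i <- s) itg (F i).
Proof.
move=> IF; elim: s => [|i s IH].
  by rewrite big_nil -[RHS]itg0; apply: eq_Rintegral => x _; rewrite big_nil.
rewrite big_cons -IH -itgD//; last exact: intg_sum.
by apply: eq_Rintegral => x _; rewrite big_cons.
Qed.

Lemma normr_itg_le f : intg f -> `|itg f| <= itg (fun x => `|f x|).
Proof. exact: le_normr_Rintegral. Qed.

Lemma itg_ae_eq f g : measurable_fun setT f -> measurable_fun setT g ->
  {ae mu, forall x, f x = g x} -> itg f = itg g.
Proof.
move=> mf mg fg; congr fine; apply: ae_eq_integral => //;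
  [exact/measurable_EFinP|exact/measurable_EFinP|].
by apply: ae_imp fg => x fgx _; rewrite fgx.
Qed.

Lemma intg_ae_eq f g : intg f -> measurable_fun setT g -> {ae mu, forall x, f x = g x} -> intg g.
Proof.
move=> If mg fg; have mf := intg_measurable If.
apply/integrableP; split; first exact/measurable_EFinP.
have /integrableP[_] := If; apply: le_lt_trans; rewrite le_eqVlt; apply/orP; left; apply/eqP.
apply: ae_eq_integral => //; first by apply: measurableT_comp => //; exact/measurable_EFinP.
  by apply: measurableT_comp => //; exact/measurable_EFinP.
by apply: ae_imp fg => x /= -> _.
Qed.

Lemma itg_ge0 f : (forall x, 0 <= f x) -> 0 <= itg f.
Proof. by move=> f0; exact: Rintegral_ge0. Qed.

Lemma itg_ge0_ae f : measurable_fun setT f -> {ae mu, forall x, 0 <= f x} -> 0 <= itg f.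
Proof.
move=> mf f0; rewrite (@itg_ae_eq _ (fun x => `|f x|))//; first exact: itg_ge0.
- exact: measurableT_comp.
- by apply: ae_imp f0 => x fx0; rewrite ger0_norm.
Qed.

Lemma le_itg_ae f g : intg f -> intg g -> {ae mu, forall x, f x <= g x} -> itg f <= itg g.
Proof.
move=> If Ig fg; rewrite -subr_ge0 -itgB//; apply: itg_ge0_ae.
  by apply: measurable_funB; exact: intg_measurable.
by apply: ae_imp fg => x; rewrite subr_ge0.
Qed.

Lemma le_itg f g : intg f -> intg g -> (forall x, f x <= g x) -> itg f <= itg g.
Proof. by move=> If Ig fg; apply: le_itg_ae => //; exact: ae_all. Qed.

Lemma itgE f : intg f -> (itg f)%:E = (\int[mu]_x (f x)%:E)%E.
Proof. by move=> If; rewrite fineK//; exact: integrable_fin_num. Qed.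

Lemma itg_le0_ae f : intg f -> (forall x, 0 <= f x) -> itg f <= 0 ->
  {ae mu, forall x, f x = 0}.
Proof.
move=> If f0 If0.
have : ae_eq mu setT (EFin \o f) (cst 0%E).
  apply/ae_eq_integral_abs => //; first exact: measurable_int If.
  under eq_integral do rewrite /= ger0_norm//.
  by rewrite -itgE//; congr _%:E; apply/eqP; rewrite eq_le If0 itg_ge0.
by apply: ae_imp => x /(_ I) [].
Qed.

Lemma itg_dct (f_ : nat -> T -> R) f g : (forall n, measurable_fun setT (f_ n)) ->
  measurable_fun setT f -> {ae mu, forall x, (fun n => f_ n x) @ \oo --> f x} ->
  intg g -> (forall n x, `|f_ n x| <= g x) ->
  intg f /\ (fun n => itg (f_ n)) @ \oo --> itg f.
Proof.
move=> mf_ mf ff Ig fg.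
have mEf_ n : measurable_fun setT (EFin \o f_ n) by exact/measurable_EFinP.
have mEf : measurable_fun setT (EFin \o f) by exact/measurable_EFinP.
have cEf : {ae mu, forall x, setT x -> (fun n => (EFin \o f_ n) x) @ \oo --> (EFin \o f) x}.
  by apply: ae_imp ff => x fx _; apply/fine_cvgP; split => //; exact: nearW.
have dom : {ae mu, forall x n, setT x -> (`|(EFin \o f_ n) x| <= (EFin \o g) x)%E}.
  by apply: ae_all => x n _ /=; rewrite lee_fin.
have [If _ cf] := dominated_convergence measurableT mEf_ mEf cEf Ig dom.
split => //.
by apply: fine_cvg; rewrite itgE.
Qed.

End real_integrals.

Section lebesgue_rV_shift.
Context {R : realType} {N : nat}.
Local Notation E := 'rV[R]_N.
Local Notation mu := (@lebesgue_rV R N).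
Local Notation intg f := (mu.-integrable setT (EFin \o f)).
Local Notation itg f := (\int[mu]_x f x).
Implicit Types (f : E -> R) (h : E).

Lemma lebesgue_rV_obox (a b : E) :
  mu (obox a b) = (\prod_(i < N) lebesgue_measure `]a ord0 i, b ord0 i[%classic)%E.
Proof. exact: (@lebesgue_rV_box R N (fun i => `]a ord0 i, b ord0 i[%classic)). Qed.

Lemma lebesgue_rV_obox_lty (a b : E) : (mu (obox a b) < +oo)%E.
Proof.
rewrite lebesgue_rV_obox.
rewrite (eq_bigr (fun i => (Num.max 0 (b ord0 i - a ord0 i))%:E)).
  by rewrite prodEFin ltry.
move=> i _; rewrite lebesgue_measure_itv/= lte_fin.
by case: ltP => ab; rewrite ?EFinB /Num.max subr_gt0 ?ab// ltNge ab.
Qed.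

Lemma bigcup_obox : \bigcup_k obox (- const_mx k%:R) (const_mx k%:R : E) = setT.
Proof.
apply/seteqP; split => // x _; exists (Num.bound `|x|) => // i.
rewrite in_itv/= !mxE -ltr_norml (le_lt_trans (rV_norm_coord _ _))//.
exact: archi_boundP.
Qed.

(** The measure and its image under the translation agree on boxes, which are stable under
    intersection, generate the sigma-algebra and contain an exhausting sequence of finite
    measure. *)
Lemma lebesgue_rV_shift h (A : set E) : measurable A ->
  mu ((fun x => x + h) @^-1` A) = mu A.
Proof.
move=> mA; apply/esym.
pose m2 : {measure set E -> \bar R} :=
  measure_function_pushforward__canonical__measure_function_Measure
    mu (measurable_rV_addr h).
apply: (@measure_unique _ _ _ _ _ measurable_rVE setI_closed_obox _ bigcup_obox mu m2) => //.
- by move=> k; eexists; eexists; reflexivity.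
- move=> _ [a [b ->]]; rewrite /m2/= /pushforward.
  have -> : (fun x => x + h) @^-1` (obox a b) = obox (a - h) (b - h).
    by apply/seteqP; split => x /= H i; have := H i;
       rewrite !in_itv/= !mxE ltrBlDr ltrBrDr.
  rewrite !lebesgue_rV_obox; apply: eq_bigr => i _.
  rewrite !lebesgue_measure_itv/= !mxE !lte_fin ltrD2r; case: ifP => // _.
  by rewrite -!EFinB; congr _%:E; ring.
- by move=> k; exact: lebesgue_rV_obox_lty.
Qed.

Lemma measurable_shift h f : measurable_fun setT f -> measurable_fun setT (fun x : E => f (x + h)).
Proof. by move=> mf; apply: measurableT_comp => //; exact: measurable_rV_addr. Qed.

Lemma ge0_integral_shift h (F : E -> \bar R) : measurable_fun setT F ->
  (forall x, 0 <= F x)%E -> (\int[mu]_x F ((x : E) + h)%R = \int[mu]_x F x)%E.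
Proof.
move=> mF F0.
pose m2 : {measure set E -> \bar R} :=
  measure_function_pushforward__canonical__measure_function_Measure
    mu (measurable_rV_addr h).
rewrite -(@ge0_integral_pushforward _ _ _ _ R _ (measurable_rV_addr h) mu setT F)//.
apply: (@eq_measure_integral _ _ _ setT mu m2) => A mA _; exact: lebesgue_rV_shift.
Qed.

Lemma intg_shift h f : intg f -> intg (fun x : E => f (x + h)).
Proof.
move=> If; apply/integrableP; split.
  by apply/measurable_EFinP; apply: measurable_shift; exact: intg_measurable If.
rewrite (@ge0_integral_shift h (fun x => `|(f x)%:E|%E))//.
  by move/integrableP : If => [].
by apply: measurableT_comp => //; apply/measurable_EFinP; exact: intg_measurable If.
Qed.

Lemma itg_shift h f : intg f -> itg (fun x : E => f (x + h)) = itg f.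
Proof.
move=> If; congr fine.
pose m2 : {measure set E -> \bar R} :=
  measure_function_pushforward__canonical__measure_function_Measure
    mu (measurable_rV_addr h).
rewrite -(@integral_pushforward _ _ _ _ R _ (measurable_rV_addr h) mu setT (EFin \o f))//.
- by apply: (@eq_measure_integral _ _ _ setT mu m2) => A mA _; exact: lebesgue_rV_shift.
- by apply/measurable_EFinP; exact: intg_measurable If.
- by rewrite preimage_setT; exact: intg_shift.
Qed.

Definition cball0 (M : R) : set E := [set x | `|x| <= M].

Lemma closed_cball0 M : closed (cball0 M).
Proof.
rewrite (_ : cball0 M = (fun x : E => `|x|) @^-1` [set r | r <= M])//.
by apply: closed_comp; [move=> x _; exact: norm_continuous|exact: closed_le].
Qed.

Lemma measurable_cball0 M : measurable (cball0 M).
Proof. by apply: closed_measurable_rV; exact: closed_cball0. Qed.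

Lemma cball0_lty M : (mu (cball0 M) < +oo)%E.
Proof.
apply: (le_lt_trans _ (lebesgue_rV_obox_lty (- const_mx (M + 1)) (const_mx (M + 1)))).
apply: le_measure; rewrite ?inE; [exact: measurable_cball0|exact: measurable_obox|].
move=> x /= xM i; rewrite in_itv/= !mxE -ltr_norml.
by rewrite (le_lt_trans (rV_norm_coord _ _))// (le_lt_trans xM)// ltrDl.
Qed.

Definition bounded_support f := exists M : R, forall x, M < `|x| -> f x = 0.

Lemma intg_bounded_support f (k : R) : measurable_fun setT f -> (forall x, `|f x| <= k) ->
  bounded_support f -> intg f.
Proof.
move=> mf fk [M fM].
apply: (intg_bounded (measurable_cball0 M) (cball0_lty M) mf fk) => x.
by move=> /negP; rewrite -ltNge => /fM.
Qed.

Lemma bounded_support_partial f i : bounded_support f -> bounded_support (partial i f).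
Proof.
move=> [M fM]; exists M => x Mx.
apply: (@partial_eq0 _ _ _ _ (cball0 M)); first exact: closed_cball0.
- by move=> y /negP; rewrite -ltNge => /fM.
- by apply/negP; rewrite -ltNge.
Qed.

Lemma lipschitz_bounded_support_bounded f (k : R) :
  (forall x y, `|f x - f y| <= k * `|x - y|) -> bounded_support f ->
  exists2 C, 0 <= C & forall x, `|f x| <= C.
Proof.
move=> fk [M fM]; exists (`|f 0| + `|k| * `|M|) => [|x].
  by rewrite addr_ge0// mulr_ge0.
have [/fM ->|xM] := ltP M `|x|; first by rewrite normr0 addr_ge0// mulr_ge0.
rewrite -[X in `|X| <= _](subrK (f 0)) addrC (le_trans (ler_normD _ _))// lerD2l.
rewrite (le_trans (fk _ _))// subr0.
rewrite (le_trans (ler_wpM2r _ (ler_norm k)))// ler_wpM2l//.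
by rewrite (le_trans xM)// ler_norm.
Qed.

(** Every difference quotient has integral 0 by translation invariance; the quotients are bounded by
    the Lipschitz constant and converge almost everywhere to the partial derivative. *)
Lemma itg_partial_eq0 f (k : R) i : (forall x y, `|f x - f y| <= k * `|x - y|) ->
  bounded_support f -> itg (partial i f) = 0.
Proof.
move=> fk sf; have cf := lipschitz_cont fk.
have [C C0 fC] := lipschitz_bounded_support_bounded fk sf.
have If : intg f.
  by apply: intg_bounded_support sf => //; exact: continuous_measurable_rV.
pose e : E := delta_mx ord0 i.
have [M fM] := sf.
(* The radius [M + 1] accounts for the translation in the quotient, whose steps are at most 1. *)
have Ig : intg (fun x => `|k| * \1_(cball0 (M + 1)) x).
  by apply: intgZ; apply: intg_indic; [exact: measurable_cball0|exact: cball0_lty].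
have dom n x : `|dquot f e n.+1%:R^-1 x| <= `|k| * \1_(cball0 (M + 1)) x.
  rewrite /dquot normrM gtr0_norm ?invr_gt0// mulrC ler_pdivrMr//.
  rewrite indicE; case: (boolP (x \in _)).
    rewrite mulr1 => _; rewrite (le_trans (fk _ _))// addrK normrZ.
    rewrite gtr0_norm ?invr_gt0// (le_trans (ler_wpM2r _ (ler_norm k)))//.
    rewrite ler_wpM2l//.
    rewrite (le_trans (ler_wpM2l _ (norm_delta_mx i)))// mulr1.
    by [].
  rewrite notin_setE/= => /negP; rewrite -ltNge => Mx.
  have M1 : M < `|x| by rewrite (lt_trans _ Mx)// ltrDl.
  have M2 : M < `|n.+1%:R^-1 *: e + x|.
    rewrite -(ltrD2r 1) (lt_le_trans Mx)//.
    rewrite -[x in leLHS](addKr (n.+1%:R^-1 *: e)) addrC.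
    rewrite (le_trans (ler_normD _ _))// lerD2l normrN.
    rewrite normrZ gtr0_norm ?invr_gt0//.
    rewrite (le_trans (ler_wpM2l _ (norm_delta_mx i)))// mulr1.
    by rewrite invf_le1 ?ler1n.
  by rewrite mulr0 mul0r !fM ?subrr ?normr0.
have [||//|_] := itg_dct (f_ := fun n => dquot f e n.+1%:R^-1) (f := partial i f) _ _ _ Ig dom.
- by move=> n; apply: continuous_measurable_rV; exact: continuous_dquot.
- exact: measurable_partial.
- apply: ae_imp (lipschitz_ae_partial i fk) => x; exact: cvg_dquot_harmonic.
have -> : (fun n => itg (dquot f e n.+1%:R^-1)) = cst 0.
  apply/funext => n; rewrite /dquot itgZ ?itgB//.
  - under eq_Rintegral do rewrite addrC.
    by rewrite itg_shift// subrr mulr0.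
  - by apply: eq_intg (intg_shift (n.+1%:R^-1 *: e) If) => x; rewrite addrC.
  - by apply: intgB => //; apply: eq_intg (intg_shift (n.+1%:R^-1 *: e) If) => x; rewrite addrC.
by move=> /(cvg_lim (@Rhausdorff R)) <-; rewrite lim_cst.
Qed.

End lebesgue_rV_shift.

Import HBSimple.

(** * Continuity of translations in L^1 *)

Section translation_continuity.
Context {R : realType} {N : nat}.
Local Notation E := 'rV[R]_N.
Local Notation mu := (@lebesgue_rV R N).
Local Notation intg f := (mu.-integrable setT (EFin \o f)).
Local Notation itg f := (\int[mu]_x f x).
Implicit Types (f g : E -> R) (h : E).

Definition L1_shift_continuous f := intg f /\ forall e : R, 0 < e ->
  exists2 d : R, 0 < d & forall h, `|h| < d -> itg (fun x : E => `|f (x + h) - f x|) <= e.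

Lemma intg_shift_dist f h : intg f -> intg (fun x : E => `|f (x + h) - f x|).
Proof. by move=> If; apply: intg_norm; apply: intgB => //; exact: intg_shift. Qed.

Lemma L1_shift_continuousZ c f : L1_shift_continuous f -> L1_shift_continuous (fun x => c * f x).
Proof.
move=> [If Tf]; split; first exact: intgZ.
move=> e e0; have c0 : 0 < `|c| + 1 by rewrite ltr_wpDl.
have [d d0 dP] := Tf (e / (`|c| + 1)) ltac:(by rewrite divr_gt0).
exists d => // h hd; have := dP h hd; rewrite ler_pdivlMr// => he.
apply: le_trans he; rewrite mulrC.
have Id := intg_shift_dist h If.
rewrite (@eq_Rintegral _ _ _ mu _ (fun x : E => `|c| * `|f (x + h) - f x|)); last first.
  by move=> x _; rewrite -mulrBr normrM.
by rewrite itgZ// ler_wpM2r ?lerDl// itg_ge0.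
Qed.

Lemma L1_shift_continuousD f g : L1_shift_continuous f -> L1_shift_continuous g ->
  L1_shift_continuous (fun x => f x + g x).
Proof.
move=> [If Tf] [Ig Tg]; split; first exact: intgD.
move=> e e0.
have [d1 d10 d1P] := Tf (e / 2) ltac:(by rewrite divr_gt0).
have [d2 d20 d2P] := Tg (e / 2) ltac:(by rewrite divr_gt0).
exists (Num.min d1 d2) => [|h]; first by rewrite lt_min d10.
rewrite lt_min => /andP[/d1P h1 /d2P h2].
rewrite [leRHS]splitr; apply: le_trans (lerD h1 h2).
have I1 := intg_shift_dist h If; have I2 := intg_shift_dist h Ig.
rewrite -itgD//; apply: le_itg.
- by apply: intg_shift_dist; exact: intgD.
- exact: intgD.
- by move=> x; rewrite opprD addrACA ler_normD.
Qed.

Lemma L1_shift_continuous_sum (I : Type) (s : seq I) (F : I -> E -> R) :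
  (forall i, L1_shift_continuous (F i)) -> L1_shift_continuous (fun x => \sum_(i <- s) F i x).
Proof.
move=> TF; elim: s => [|i s IH].
  rewrite (_ : (fun x => _) = fun=> 0).
    split; first exact: intg0.
    move=> e e0; exists 1 => // h _.
    by under eq_Rintegral do rewrite subrr normr0; rewrite itg0 ltW.
  by apply/funext => x; rewrite big_nil.
under eq_fun do rewrite big_cons.
exact: L1_shift_continuousD.
Qed.

(** An argument with [e / 3]: the error of the approximation enters twice, once translated, with the
    same integral. *)
Lemma L1_shift_continuous_lim f : intg f ->
  (forall e : R, 0 < e -> exists2 g, L1_shift_continuous g & itg (fun x => `|f x - g x|) <= e) ->
  L1_shift_continuous f.
Proof.
move=> If app; split => // e e0.
have e3 : 0 < e / 3 by rewrite divr_gt0.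
have [g [Ig Tg] fg] := app _ e3.
have [d d0 dP] := Tg _ e3; exists d => // h hd.
have Ifg : intg (fun x => `|f x - g x|) by apply: intg_norm; exact: intgB.
have Isfg := intg_shift h Ifg.
have Igg := intg_shift_dist h Ig.
apply: (@le_trans _ _ (itg (fun x : E => `|f (x + h) - g (x + h)| + `|g (x + h) - g x| + `|f x - g x|))).
  apply: le_itg; first exact: intg_shift_dist.
    by apply: intgD => //; exact: intgD.
  move=> x; rewrite (_ : f (x + h) - f x = f (x + h) - g (x + h) + (g (x + h) - g x) + (g x - f x)); last ring.
  rewrite (le_trans (ler_normD _ _))// lerD//; first by rewrite ler_normD.
  by rewrite distrC.
rewrite itgD//; last exact: intgD.
rewrite itgD// (@itg_shift _ _ h (fun x => `|f x - g x|))//.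
have := dP _ hd; lra.
Qed.

(** Each line of direction [i] meets the hyperplane in a single point. The boundaries of boxes are
    thereby negligible. *)
Lemma null_hyperplane (i : 'I_N) (c : R) : mu [set x : E | x ord0 i = c] = 0%E.
Proof.
apply: (null_lines (i := i)).
  apply: closed_measurable_rV.
  apply: (@closed_comp _ _ (fun x : E => x ord0 i) [set c]).
    by move=> x _; exact: coord_continuous.
  exact: closed_eq.
move=> x; apply: (@negligibleS _ _ _ lebesgue_measure [set c - x ord0 i]).
  by move=> t /=; rewrite !mxE !eqxx/= mulr1 => <-; rewrite addrAC subrr add0r.
by apply/negligibleP; [exact: measurable_set1|exact: lebesgue_measure_set1].
Qed.

(** Off the hyperplanes that bound the box, its indicator is locally constant. The exceptional set
    is independent of the sequence, which is quantified inside. *)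
Lemma indic_obox_shift_cvg a b : {ae mu, forall x : E, forall h_ : nat -> E,
  h_ @ \oo --> (0 : E) -> (fun n => \1_(obox a b) (x + h_ n) : R) @ \oo --> (\1_(obox a b) x : R)}.
Proof.
have off : {ae mu, forall x : E, forall i, x ord0 i != a ord0 i /\ x ord0 i != b ord0 i}.
  apply: ae_all_count => i.
  have off1 (c : R) : {ae mu, forall x : E, x ord0 i != c}.
    apply: (@negligibleS _ _ _ _ [set x : E | x ord0 i = c]).
      by move=> x /= /negP; rewrite negbK => /eqP.
    apply/negligibleP; last exact: null_hyperplane.
    apply: closed_measurable_rV.
    apply: (@closed_comp _ _ (fun x : E => x ord0 i) [set c]); last exact: closed_eq.
    by move=> x _; exact: coord_continuous.
  exact: ae_imp2 (off1 (a ord0 i)) (off1 (b ord0 i)).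
apply: ae_imp off => x offx h_ h0.
have hlt (e : R) : 0 < e -> \forall n \near \oo, forall i, `|h_ n ord0 i| < e.
  move=> e0; have /cvgr0Pnorm_lt/(_ _ e0) := h0.
  by apply: filterS => n hn i; rewrite (le_lt_trans (rV_norm_coord _ _)).
apply: cvg_near_cst.
have [xab|xab] := pselect (obox a b x).
  have : \forall n \near \oo, forall i, (x + h_ n) ord0 i \in `]a ord0 i, b ord0 i[.
    apply: filter_forall => i.
    have := xab i; rewrite in_itv/= => /andP[ax xb].
    have d0 : 0 < Num.min (x ord0 i - a ord0 i) (b ord0 i - x ord0 i).
      by rewrite lt_min !subr_gt0 ax.
    apply: filterS (hlt _ d0) => n /(_ i); rewrite lt_min => /andP[].
    rewrite !ltr_norml => /andP[? ?] /andP[? ?].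
    by rewrite in_itv/= mxE; apply/andP; split; lra.
  by apply: filterS => n xhn; rewrite !indicE !mem_set.
have [i xi] : exists i, x ord0 i \notin `]a ord0 i, b ord0 i[.
  by apply: contrapT => nx; apply: xab => i; apply: contrapT => /negP xi; apply: nx; exists i.
have [xa xb] := offx i.
have d0 : 0 < Num.min `|x ord0 i - a ord0 i| `|b ord0 i - x ord0 i|.
  by rewrite lt_min !normr_gt0 !subr_eq0 xa eq_sym.
apply: filterS (hlt _ d0) => n /(_ i) hn; rewrite !indicE !memNset//.
move=> /(_ i); apply/negP; move: xi hn; rewrite !in_itv/= mxE !negb_and -!leNgt lt_min.
move=> /orP[xi|xi] /andP[h1 h2]; apply/orP.
  have e1 : `|x ord0 i - a ord0 i| = a ord0 i - x ord0 i.
    by rewrite ler0_norm ?subr_le0// opprB.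
  by left; move: h1; rewrite e1 ltr_norml => /andP[_ ?]; lra.
have e2 : `|b ord0 i - x ord0 i| = x ord0 i - b ord0 i.
  by rewrite ler0_norm ?subr_le0// opprB.
by right; move: h2; rewrite e2 ltr_norml => /andP[? _]; lra.
Qed.

(** Failure would yield translations [h_ n] tending to 0 whose integrals all exceed [e], against
    dominated convergence. *)
Lemma L1_shift_continuous_obox a b : L1_shift_continuous (\1_(obox a b)).
Proof.
have Iab : intg (\1_(obox a b)).
  by apply: intg_indic; [exact: measurable_obox|exact: lebesgue_rV_obox_lty].
split => // e e0; apply: contrapT => nd.
have /choice[h_ hP] n : exists h : E, `|h| < n.+1%:R^-1 /\
    e < itg (fun x : E => `|\1_(obox a b) (x + h) - \1_(obox a b) x| : R).
  apply: contrapT => nh; apply: nd; exists n.+1%:R^-1 => // h hn.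
  by rewrite leNgt; apply/negP => he; apply: nh; exists h.
have h0 : h_ @ \oo --> (0 : E).
  apply/cvgr0Pnorm_lt => e' e'0.
  have /cvgrPdist_lt/(_ _ e'0) := @cvg_harmonic R.
  apply: filterS => n; rewrite sub0r normrN /harmonic/= ger0_norm ?invr_ge0// => ne.
  by have [+ _] := hP n; move=> /lt_trans; exact.
have [M abM] : exists M : R, forall x h : E, `|h| < 1 -> M < `|x| ->
    \1_(obox a b) (x + h) = 0 :> R /\ \1_(obox a b) x = 0 :> R.
  exists (`|a| + `|b| + 1) => x h h1 xM.
  have out (y : E) : `|a| + `|b| < `|y| -> \1_(obox a b) y = 0 :> R.
    move=> yM; rewrite indicE memNset// => yab; move: yM; apply/negP; rewrite -leNgt.
    apply: rV_norm_le; first by rewrite addr_ge0.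
    move=> i; have := yab i; rewrite in_itv/= => /andP[y1 y2].
    have := rV_norm_coord a i; have := rV_norm_coord b i.
    rewrite !ler_norml => /andP[? ?] /andP[? ?].
    have := normr_ge0 a; have := normr_ge0 b.
    by move=> ? ?; apply/andP; split; lra.
  split; last by apply: out; rewrite (lt_trans _ xM)// ltrDl.
  apply: out; rewrite -(ltrD2r 1) (lt_le_trans xM)//.
  rewrite -[x in leLHS](addrK h) (le_trans (ler_normB _ _))// lerD2l ltW//.
have IM : intg (\1_(cball0 M : set E)).
  by apply: intg_indic; [exact: measurable_cball0|exact: cball0_lty].
have h1 n : `|h_ n| < 1.
  by have [+ _] := hP n; move=> /lt_le_trans; apply; rewrite invf_le1 ?ler1n.
have [||||_] := @itg_dct _ E R mu
    (fun n x => `|\1_(obox a b) (x + h_ n) - \1_(obox a b) x|) (fun=> 0) _ _ _ _ IM.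
- move=> n; apply: measurableT_comp => //; apply: measurable_funB.
    by apply: measurable_shift; apply: measurable_indic; exact: measurable_obox.
  by apply: measurable_indic; exact: measurable_obox.
- by [].
- apply: ae_imp (indic_obox_shift_cvg a b) => x /(_ _ h0) cx.
  have : (fun n => \1_(obox a b) (x + h_ n) - \1_(obox a b) x : R) @ \oo --> (0 : R).
    by rewrite -[X in _ --> X](subrr (\1_(obox a b) x : R)); apply: cvgB => //; exact: cvg_cst.
  by move=> /cvg_norm; rewrite normr0.
- move=> n x; rewrite normr_id [leRHS]indicE; case: (boolP (x \in _)) => /=.
    by rewrite !indicE => _; do 2 case: (_ \in _) => /=; rewrite ?subrr ?subr0 ?sub0r ?normrN ?normr1 ?normr0.
  rewrite notin_setE/= => /negP; rewrite -ltNge => /(abM _ _ (h1 n))[-> ->].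
  by rewrite subrr normr0.
rewrite itg0 => /cvgrPdist_lt/(_ _ e0)[n _ /(_ n (leqnn n))].
rewrite sub0r normrN ger0_norm ?itg_ge0//.
by have [_] := hP n; move=> /lt_trans h /h; rewrite ltxx.
Qed.

(** The sets with this property form a Dynkin system containing the boxes; cutting by a fixed box
    keeps complements and increasing unions of finite measure. *)
Lemma L1_shift_continuous_bounded_indic (k : nat) (A : set E) : measurable A ->
  L1_shift_continuous (\1_(A `&` obox (- const_mx k%:R) (const_mx k%:R))).
Proof.
set Q := obox _ _.
have mQ : measurable Q by exact: measurable_obox.
have Qoo : (mu Q < +oo)%E by exact: lebesgue_rV_obox_lty.
have IQ B : measurable B -> intg (\1_(B `&` Q)).
  move=> mB; apply: intg_indic; first exact: measurableI.
  apply: le_lt_trans Qoo; apply: le_measure; rewrite ?inE//; exact: measurableI.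
rewrite measurable_rVE.
pose H := [set A : set E | measurable A /\ L1_shift_continuous (\1_(A `&` Q))].
suff : <<s [set A : set E | exists a b, A = obox a b] >> `<=` H by move=> sH /sH [].
apply: lambda_system_subset => //; first exact: setI_closed_obox.
- split => //.
  + by split => //; rewrite setTI; exact: L1_shift_continuous_obox.
  + move=> A1 B1 BA [mA TA] [mB TB]; split; first exact: measurableD.
    have := L1_shift_continuousD TA (L1_shift_continuousZ (-1) TB).
    congr L1_shift_continuous; apply/funext => x.
    rewrite !indicE setDE !in_setI in_setC.
    case: (boolP (x \in Q)) => xQ; rewrite ?andbF ?andbT ?mulr0 ?addr0//.
    have [xB|xB] := boolP (x \in B1); last by rewrite mulr0 addr0 andbT.
    have -> : x \in A1 by rewrite inE; apply: BA; rewrite -[B1 x]in_setE.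
    by rewrite mulr1 subrr.
  + move=> F ndF FH; have mF n : measurable (F n) by have [] := FH n.
    have mUF : measurable (\bigcup_n F n) by exact: bigcupT_measurable.
    split => //; apply: L1_shift_continuous_lim; first exact: IQ.
    have [||||_] := @itg_dct _ E R mu (fun n x => `|\1_((\bigcup_n F n) `&` Q) x - \1_(F n `&` Q) x|)
        (fun=> 0) _ _ _ _ (IQ _ measurableT).
    * by move=> n; apply: measurableT_comp => //; apply: measurable_funB;
        apply: measurable_indic; exact: measurableI.
    * by [].
    * apply: ae_all => x; apply: cvg_near_cst.
      have [Ux|nUx] := pselect ((\bigcup_n F n) x).
        have [n _ Fx] := Ux; exists n => // m /= nm.
        rewrite !indicE !in_setI [x \in \bigcup_n F n]mem_set// [x \in F m]mem_set ?subrr ?normr0//.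
        by have /subsetPset := ndF _ _ nm; exact.
      apply: nearW => m; rewrite !indicE !in_setI [x \in \bigcup_n F n]memNset// [x \in F m]memNset ?subrr ?normr0//.
      by move=> Fx; apply: nUx; exists m.
    * move=> n x; rewrite normr_id !indicE !in_setI in_setT/=.
      by case: (x \in Q); case: (x \in F n); case: (x \in \bigcup_n F n) => /=; rewrite ?subrr ?subr0 ?sub0r ?normrN ?normr1 ?normr0.
    rewrite itg0 => c e e0; move/cvgrPdist_lt : c => /(_ _ e0)[n _ /(_ n (leqnn n))].
    rewrite sub0r normrN ger0_norm ?itg_ge0// => /ltW ne.
    by exists (\1_(F n `&` Q)) => //; have [] := FH n.
- move=> _ [a [b ->]]; split; first exact: measurable_obox.
  by rewrite oboxI; exact: L1_shift_continuous_obox.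
Qed.

Lemma L1_shift_continuous_indic (A : set E) : measurable A -> intg (\1_A) ->
  L1_shift_continuous (\1_A).
Proof.
move=> mA IA; apply: L1_shift_continuous_lim => //.
pose Q k : set E := obox (- const_mx k%:R) (const_mx k%:R).
have mQ k : measurable (Q k) by exact: measurable_obox.
have [||||_] := @itg_dct _ E R mu (fun k x => `|\1_A x - \1_(A `&` Q k) x|) (fun=> 0) _ _ _ _ IA.
- by move=> n; apply: measurableT_comp => //; apply: measurable_funB;
    apply: measurable_indic => //; exact: measurableI.
- by [].
- apply: ae_all => x; apply: cvg_near_cst.
  exists (Num.bound `|x|) => // m /= nm; rewrite !indicE in_setI [x \in Q m]mem_set ?andbT ?subrr ?normr0//.
  move=> i; rewrite in_itv/= !mxE -ltr_norml (le_lt_trans (rV_norm_coord _ _))//.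
  by rewrite (lt_le_trans (archi_boundP _))// ler_nat.
- move=> n x; rewrite normr_id !indicE !in_setI.
  by case: (x \in A); case: (x \in Q n) => /=; rewrite ?subrr ?subr0 ?sub0r ?normrN ?normr1 ?normr0.
rewrite itg0 => c e e0; move/cvgrPdist_lt : c => /(_ _ e0)[n _ /(_ n (leqnn n))].
rewrite sub0r normrN ger0_norm ?itg_ge0// => /ltW ne.
by exists (\1_(A `&` Q n)) => //; exact: L1_shift_continuous_bounded_indic.
Qed.

Lemma intg_shift_continuous f : intg f -> L1_shift_continuous f.
Proof.
move=> If; apply: L1_shift_continuous_lim => // e e0.
have [g_ [Ig_ _ cg]] := approximation_sfun_integrable measurableT If.
have Ifg n : intg (fun x => `|f x - g_ n x|) by apply: intg_norm; apply: intgB => //; exact: Ig_.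
have {}cg : (fun n => itg (fun x => `|f x - g_ n x|)) @ \oo --> (0 : R).
  by apply: fine_cvg.
move/cvgrPdist_lt : cg => /(_ _ e0)[n _ /(_ n (leqnn n))].
rewrite sub0r normrN ger0_norm ?itg_ge0// => /ltW ne.
exists (g_ n) => //.
have mg : measurable_fun setT (g_ n) by exact: measurable_funP.
rewrite (_ : (g_ n : E -> R) = (fun x => \sum_(y <- finmap.enum_fset (fset_set (range (g_ n)))) (y * \1_(g_ n @^-1` [set y]) x))); last first.
  by apply/funext => x; rewrite [LHS]fimfunE fsbig_finite.
apply: L1_shift_continuous_sum => y.
(* The level set of the value 0 may have infinite measure, so its term, which is the zero function,
   is rewritten with the empty set. *)
have [->|y0] := eqVneq y 0.
  rewrite (_ : (fun x => _) = fun x => 0 * \1_(set0 : set E) x).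
    apply: L1_shift_continuousZ; apply: L1_shift_continuous_indic => //.
    by apply: intg_indic; rewrite ?measure0.
  by apply/funext => x; rewrite !mul0r.
have mA : measurable (g_ n @^-1` [set y]) by rewrite -[X in measurable X]setTI; exact: mg.
apply: L1_shift_continuousZ; apply: L1_shift_continuous_indic => //.
apply: le_intg (intgZ `|y|^-1 (intg_norm (Ig_ n))); first exact: measurable_indic.
move=> x; rewrite indicE; case: (boolP (x \in _)) => /=.
  rewrite inE/= => ->; rewrite normr1 mulVf// normr_eq0//.
by rewrite normr0 mulr_ge0// invr_ge0.
Qed.

End translation_continuity.

(** * Smooth functions and convolution *)

Section smooth_functions.
Context {R : realType} {N : nat}.
Local Notation E := 'rV[R]_N.
Local Notation e_ i := (delta_mx (ord0 : 'I_1) i : E).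
Implicit Types (f g : E -> R) (c x y : E) (k : nat).

Lemma derivableT_M f g x v : derivable f x v -> derivable g x v ->
  derivable (fun x => f x * g x) x v.
Proof. by move=> df dg; exact: (derivableM df dg). Qed.

Lemma partialD i f g x : derivable f x (e_ i) -> derivable g x (e_ i) ->
  partial i (fun x => f x + g x) x = partial i f x + partial i g x.
Proof. by move=> df dg; rewrite /partial; exact: (deriveD df dg). Qed.

Lemma partialM i f g x : derivable f x (e_ i) -> derivable g x (e_ i) ->
  partial i (fun x => f x * g x) x = f x * partial i g x + g x * partial i f x.
Proof. by move=> df dg; rewrite /partial; exact: (deriveM df dg). Qed.

Lemma partialZ i (c : R) f x : derivable f x (e_ i) ->
  partial i (fun x => c * f x) x = c * partial i f x.
Proof. by move=> df; rewrite /partial; exact: (deriveZ c df). Qed.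

Lemma Ck_continuous k f : Ck k f -> continuous f.
Proof. by case: k => [//|k] []. Qed.

Lemma Ck_derivable k f x i : Ck k.+1 f -> derivable f x (e_ i).
Proof. by case. Qed.

Lemma Ck_partial k f i : Ck k.+1 f -> Ck k (partial i f).
Proof. by move=> [_ _]; apply. Qed.

Lemma CkS k f : Ck k.+1 f -> Ck k f.
Proof.
elim: k f => [|k IH] f; first exact: Ck_continuous.
move=> [cf df pf]; split => // i; apply: IH; exact: pf.
Qed.

Lemma CkD k f g : Ck k f -> Ck k g -> Ck k (fun x => f x + g x).
Proof.
move=> cf cg; have := Ck_lin 1 cf cg; congr Ck.
by apply/funext => x; rewrite !fctE scale1r.
Qed.

Lemma CkZ k (c : R) f : Ck k f -> Ck k (fun x => c * f x).
Proof.
move=> cf; have := Ck_lin c cf (Ck0 k); congr Ck.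
by apply/funext => x; rewrite !fctE addr0.
Qed.

Lemma CkM k f g : Ck k f -> Ck k g -> Ck k (fun x => f x * g x).
Proof.
elim: k f g => [|k IH] f g cf cg; first exact: contM.
split.
- by apply: contM; [exact: (Ck_continuous cf)|exact: (Ck_continuous cg)].
- by move=> i x; apply: derivableT_M; [case: cf|case: cg].
- move=> i; rewrite (_ : partial i _ = (fun x => f x * partial i g x + g x * partial i f x)).
    by apply: CkD; apply: IH; by [exact: CkS|exact: Ck_partial].
  by apply/funext => x; rewrite partialM//; [case: cf|case: cg].
Qed.

Lemma Ck_cst k (c : R) : Ck k (fun _ : E => c).
Proof.
elim: k c => [|k IH] c; first exact: cont_cst.
split; first exact: cont_cst.
  by move=> i x; exact: derivable_cst.
move=> i; rewrite (_ : partial i _ = fun=> 0); first exact: IH.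
by apply/funext => x; rewrite /partial derive_cst.
Qed.

Lemma Ck_sum k (I : Type) (s : seq I) (F : I -> E -> R) :
  (forall i, Ck k (F i)) -> Ck k (fun x => \sum_(i <- s) F i x).
Proof.
move=> cF; elim: s => [|i s IH].
  by under eq_fun do rewrite big_nil; exact: Ck_cst.
by under eq_fun do rewrite big_cons; exact: CkD.
Qed.

Lemma derivable_coord_partial (i j : 'I_N) x :
  is_derive x (e_ j) (fun y : E => y ord0 i) (i == j)%:R.
Proof.
have E0 (h : R) : h != 0 -> h^-1 *: ((h *: e_ j + x) ord0 i - x ord0 i) = (i == j)%:R.
  by move=> h0; rewrite !mxE eqxx addrK/= [LHS]mulrA mulVf// mul1r.
have cv : h^-1 *: (((fun y : E => y ord0 i) \o shift x) (h *: e_ j) - x ord0 i) @[h --> 0^'] -->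
    ((i == j)%:R : R).
  apply: cvg_near_cst; exists 1 => //= h _ h0; exact: E0.
by split; [apply/cvg_ex; exists (i == j)%:R|exact/cvg_lim].
Qed.

Lemma Ck_coord k i : Ck k (fun x : E => x ord0 i).
Proof.
have cc : continuous (fun x : E => x ord0 i) by exact: coord_continuous.
case: k => [//|k]; split => //.
  by move=> j x; exact: (@ex_derive _ _ _ _ _ _ _ (derivable_coord_partial i j x)).
move=> j; rewrite (_ : partial j _ = fun=> (i == j)%:R); first exact: Ck_cst.
by apply/funext => x; exact: (@derive_val _ _ _ _ _ _ _ (derivable_coord_partial i j x)).
Qed.

Lemma dquot_shift f c v h x : dquot (fun y : E => f (y - c)) v h x = dquot f v h (x - c).
Proof. by rewrite /dquot addrA. Qed.

Lemma derivable_shift f c v x : derivable f (x - c) v -> derivable (fun y : E => f (y - c)) x v.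
Proof.
rewrite !derivable_dquot.
by rewrite (_ : (dquot (fun y => f (y - c)) v)^~ x = (dquot f v)^~ (x - c))//;
  apply/funext => h; rewrite dquot_shift.
Qed.

Lemma partial_shift i f c x : partial i (fun y : E => f (y - c)) x = partial i f (x - c).
Proof.
have shE : (dquot (fun y : E => f (y - c)) (e_ i))^~ x = (dquot f (e_ i))^~ (x - c).
  by apply/funext => h; rewrite dquot_shift.
change (lim ((dquot (fun y : E => f (y - c)) (e_ i))^~ x @ 0^') =
        lim ((dquot f (e_ i))^~ (x - c) @ 0^')).
by rewrite shE.
Qed.

Lemma cont_shift f c : continuous f -> continuous (fun y : E => f (y - c)).
Proof.
move=> cf; have cs : continuous (fun y : E => y - c).
  by move=> x; apply: (@cvgB _ _ _ (nbhs x)); [exact: cvg_id|exact: cvg_cst].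
by move=> x; apply: (continuous_comp (f := fun y : E => y - c)); [exact: cs|exact: cf].
Qed.

Lemma Ck_shift k f c : Ck k f -> Ck k (fun y : E => f (y - c)).
Proof.
elim: k f => [|k IH] f; first exact: cont_shift.
move=> [cf df pf]; split; first exact: cont_shift.
  by move=> i x; exact: derivable_shift.
move=> i; rewrite (_ : partial i _ = fun y => partial i f (y - c)).
  by apply: IH; exact: pf.
by apply/funext => x; rewrite partial_shift.
Qed.

Lemma continuous_bounded_support_bounded f : continuous f -> bounded_support f ->
  exists2 C, 0 <= C & forall x, `|f x| <= C.
Proof.
move=> cf [M fM].
have cK : compact (cball0 `|M| : set E).
  apply: bounded_closed_compact; last exact: closed_cball0.
  by exists `|M|; split => // y My x /= /le_trans; apply; exact: ltW.
have [||c _ cP] := @EVT_max_rV R N (fun x => `|f x|) (cball0 `|M|) _ cK.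
- by exists 0; rewrite /cball0/= normr0.
- by apply: continuous_subspaceT; exact: cont_norm.
exists `|f c| => // x; have [xM|Mx] := leP `|x| `|M|; first by apply: cP; rewrite inE.
by rewrite fM ?normr0// (le_lt_trans (ler_norm M)).
Qed.

Lemma MVT_partial f i x (h : R) : (forall y, derivable f y (e_ i)) ->
  exists2 s : R, `|s| <= `|h| & f (x + h *: e_ i) - f x = partial i f (x + s *: e_ i) * h.
Proof.
move=> df.
have pos (z : E) (t : R) : 0 <= t ->
    exists2 s : R, 0 <= s <= t & f (z + t *: e_ i) - f z = partial i f (z + s *: e_ i) * t.
  move=> t0.
  have dphi (s : R) : is_derive s (1 : R) (fun s : R => f (z + s *: e_ i)) (partial i f (z + s *: e_ i)).
    have ds : derivable (fun s : R => f (z + s *: e_ i)) s 1 by apply/derivable_line.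
    split => //.
    have dE : (dquot (fun s : R => f (z + s *: e_ i)) 1)^~ s = (dquot f (e_ i))^~ (z + s *: e_ i).
      by apply/funext => u; rewrite /dquot scalerDl [_ *: 1]mulr1 addrCA.
    change (lim ((dquot (fun s : R => f (z + s *: e_ i)) 1)^~ s @ 0^') =
            lim ((dquot f (e_ i))^~ (z + s *: e_ i) @ 0^')).
    by rewrite dE.
  have [|s] := @MVT_segment R (fun s => f (z + s *: e_ i)) (fun s => partial i f (z + s *: e_ i)) 0 t t0.
    apply: derivable_within_continuous => s _; exact: ex_derive.
  by rewrite in_itv/= subr0 scale0r addr0 => s0t sE; exists s.
have [h0|h0] := leP 0 h.
  have [s /andP[s0 sh] sE] := pos x _ h0; exists s => //.
  by rewrite !ger0_norm.
(* For a negative [h] the mean value theorem is applied from the other endpoint of the segment. *)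
have [s /andP[s0 sh] sE] := pos (x + h *: e_ i) (- h) ltac:(by rewrite oppr_ge0 ltW).
exists (h + s).
  by rewrite (ler0_norm (ltW h0)) ler_norml; apply/andP; split; lra.
move: sE; rewrite scaleNr addrK => /eqP; rewrite -addrA -scalerDl mulrN -opprB eqr_opp.
by move=> /eqP.
Qed.

(** The path [z j] replaces the coordinates of [x] by those of [y] one at a time, and each move is
    estimated by the mean value theorem; hence the factor [N]. *)
Lemma partial_bounded_lipschitz f (C : R) : (forall i y, derivable f y (e_ i)) ->
  (forall i y, `|partial i f y| <= C) ->
  forall x y, `|f x - f y| <= N%:R * C * `|x - y|.
Proof.
move=> df fC x y.
pose z (j : nat) : E := \row_i (if (i < j)%N then y ord0 i else x ord0 i).
have z0 : z 0%N = x by apply/rowP => i; rewrite mxE ltn0.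
have zN : z N = y by apply/rowP => i; rewrite mxE ltn_ord.
have step (j : 'I_N) : `|f (z j.+1) - f (z j)| <= C * `|x - y|.
  have -> : z j.+1 = z j + (y ord0 j - x ord0 j) *: e_ j.
    apply/rowP => i; rewrite !mxE eqxx/= ltnS leq_eqVlt.
    have [->|ij] := eqVneq i j.
      by rewrite eqxx/= ltnn mulr1 addrC subrK.
    by rewrite -val_eqE/= in ij; rewrite (negbTE ij) mulr0 addr0.
  have [s _ ->] := MVT_partial (z j) (y ord0 j - x ord0 j) (df j).
  rewrite normrM ler_pM// distrC.
  by have := rV_norm_coord (x - y) j; rewrite !mxE.
have -> : f x - f y = - \sum_(0 <= j < N) (f (z j.+1) - f (z j)).
  by rewrite (telescope_sumr (fun j => f (z j)) (leq0n N)) z0 zN opprB.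
rewrite normrN big_mkord (le_trans (ler_norm_sum _ _ _))//.
rewrite (le_trans (ler_sum _ (fun j _ => step j)))//.
by rewrite sumr_const card_ord -mulrA mulr_natl.
Qed.

Lemma C1_lipschitz f : Ck 1 f -> bounded_support f ->
  exists2 L, 0 <= L & forall x y, `|f x - f y| <= L * `|x - y|.
Proof.
move=> [cf df pf] sf.
have /choice[C CP] i : exists C : R, 0 <= C /\ forall x, `|partial i f x| <= C.
  have [C C0 CP] := continuous_bounded_support_bounded (pf i) (bounded_support_partial i sf).
  by exists C.
exists (N%:R * \sum_i C i).
  by rewrite mulr_ge0// sumr_ge0// => i _; have [] := CP i.
apply: partial_bounded_lipschitz => // i y.
have [_ /(_ y) h] := CP i; rewrite (le_trans h)// (bigD1 i)//= lerDl sumr_ge0// => j _.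
by have [] := CP j.
Qed.

(** The remainder is uniform in [x], which allows differentiation of a convolution under the
    integral sign. *)
Lemma partial_taylor f i (L : R) x h : (forall y, derivable f y (e_ i)) ->
  (forall y z, `|partial i f y - partial i f z| <= L * `|y - z|) ->
  `|f (x + h *: e_ i) - f x - h * partial i f x| <= `|L| * `|h| ^+ 2.
Proof.
move=> df Lf; have [s sh ->] := MVT_partial x h df.
rewrite mulrC -mulrBr normrM expr2 mulrCA ler_wpM2l//.
rewrite (le_trans (Lf _ _))// addrAC subrr add0r normrZ.
apply: (@le_trans _ _ (`|L| * (`|s| * `|e_ i|))).
  by rewrite ler_wpM2r ?mulr_ge0// ler_norm.
rewrite ler_wpM2l//; apply: le_trans sh.
by rewrite ler_piMr// norm_delta_mx.
Qed.

End smooth_functions.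

Section convolution.
Context {R : realType} {N : nat}.
Local Notation E := 'rV[R]_N.
Local Notation mu := (@lebesgue_rV R N).
Local Notation intg f := (mu.-integrable setT (EFin \o f)).
Local Notation itg f := (\int[mu]_x f x).
Local Notation e_ i := (delta_mx (ord0 : 'I_1) i : E).
Implicit Types (f k : E -> R) (x y : E) (M L : R).

(** The kernel is not reflected: the translate of [k] can directly serve as a test function in [y].
    In exchange each derivative in [x] brings a sign, see [partial_conv]. *)
Definition conv f k x : R := itg (fun y : E => f y * k (y - x)).

Lemma intg_conv f k M x : intg f -> measurable_fun setT k -> (forall y, `|k y| <= M) ->
  intg (fun y : E => f y * k (y - x)).
Proof. by move=> If mk kM; apply: (intgM (M := M)) => //; exact: (@measurable_shift R N (- x)). Qed.

Lemma conv_lipschitz f k M L x x' : intg f -> (forall y, `|k y| <= M) ->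
  (forall y z, `|k y - k z| <= L * `|y - z|) ->
  `|conv f k x - conv f k x'| <= L * itg (fun y => `|f y|) * `|x - x'|.
Proof.
move=> If kM kL; have mk := continuous_measurable_rV (lipschitz_cont kL).
have I1 := intg_conv x If mk kM; have I2 := intg_conv x' If mk kM.
rewrite /conv -itgB// (le_trans (normr_itg_le (intgB I1 I2)))//.
rewrite mulrAC -itgZ; last exact: intg_norm.
apply: le_itg.
- by apply: intg_norm; exact: intgB.
- by apply: intgZ; exact: intg_norm.
- move=> y; rewrite -mulrBr normrM mulrC ler_wpM2r// (le_trans (kL _ _))//.
  by rewrite opprB addrC addrA subrK distrC.
Qed.

(** By [partial_taylor] for the kernel, the difference quotient deviates from its limit by at most a
    multiple of the step times the L^1 norm of [f]. *)
Lemma conv_is_derive f k M L i x : intg f -> (forall y, `|k y| <= M) -> continuous k ->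
  (forall y, derivable k y (e_ i)) ->
  (forall y, `|partial i k y| <= M) ->
  (forall y z, `|partial i k y - partial i k z| <= L * `|y - z|) ->
  is_derive x (e_ i) (conv f k) (- conv f (partial i k) x).
Proof.
move=> If kM ck dk pkM pkL.
have mk := continuous_measurable_rV ck.
have mpk := measurable_partial i ck.
pose A := itg (fun y => `|f y|); have A0 : 0 <= A by exact: itg_ge0.
have est (h : R) : h != 0 ->
    `|dquot (conv f k) (e_ i) h x + conv f (partial i k) x| <= `|L| * A * `|h|.
  move=> h0.
  have I1 := intg_conv (h *: e_ i + x) If mk kM.
  have I2 := intg_conv x If mk kM.
  have I3 := intg_conv x If mpk pkM.
  rewrite /dquot /conv -itgB// -itgZ; last exact: intgB.
  rewrite -itgD//; last by apply: intgZ; exact: intgB.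
  set F := (fun y : E => _ + _).
  have IF : intg F by apply: intgD => //; apply: intgZ; exact: intgB.
  rewrite (le_trans (normr_itg_le IF))// mulrAC -itgZ; last exact: intg_norm.
  apply: le_itg; [exact: intg_norm|by apply: intgZ; exact: intg_norm|].
  move=> y; rewrite /F.
  have T := partial_taylor (y - x) (- h) dk pkL.
  have -> : h^-1 * (f y * k (y - (h *: e_ i + x)) - f y * k (y - x)) + f y * partial i k (y - x) =
     f y * (h^-1 * (k (y - x + (- h) *: e_ i) - k (y - x) - (- h) * partial i k (y - x))).
    rewrite scaleNr opprD [- (h *: _) - x]addrC addrA.
    by move: (k _) (k _) (partial _ _ _) => a b p; field.
  rewrite normrM mulrC ler_wpM2r// normrM normfV mulrC ler_pdivrMr ?normr_gt0//.
  by rewrite (le_trans T)// normrN expr2 mulrA.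
have cv : dquot (conv f k) (e_ i) h x @[h --> 0^'] --> - conv f (partial i k) x.
  apply/cvgrPdist_le => e e0.
  have c0 : 0 < `|L| * A + 1 by rewrite ltr_wpDl// mulr_ge0.
  exists (e / (`|L| * A + 1)) => /=; first by rewrite divr_gt0.
  move=> h; rewrite /= sub0r normrN ltr_pdivlMr// => he h0.
  rewrite distrC opprK (le_trans (est _ h0))// (le_trans _ (ltW he))// mulrC.
  by rewrite ler_wpM2l// lerDl.
by split; [apply/cvg_ex; exists (- conv f (partial i k) x)|exact/cvg_lim].
Qed.

Lemma conv_smooth_is_derive f k i x : intg f -> (forall l, Ck l k) -> bounded_support k ->
  is_derive x (e_ i) (conv f k) (- conv f (partial i k) x).
Proof.
move=> If sk bk.
have [M M0 kM] := continuous_bounded_support_bounded (sk 0%N) bk.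
have bpk := bounded_support_partial i bk.
have spk l : Ck l (partial i k) by apply: Ck_partial; exact: sk.
have [M' M'0 pkM] := continuous_bounded_support_bounded (spk 0%N) bpk.
have [L L0 pkL] := C1_lipschitz (spk 1%N) bpk.
apply: (@conv_is_derive f k (M + M') L) => //.
- by move=> y; rewrite (le_trans (kM y))// lerDl.
- exact: (sk 0%N).
- by move=> y; have [_ + _] := sk 1%N; exact.
- by move=> y; rewrite (le_trans (pkM y))// lerDr.
Qed.

Lemma partial_conv i f k x : intg f -> (forall l, Ck l k) -> bounded_support k ->
  partial i (conv f k) x = - conv f (partial i k) x.
Proof. by move=> If sk bk; have [_ <-] := conv_smooth_is_derive i x If sk bk. Qed.

Lemma Ck_conv m f k : intg f -> (forall l, Ck l k) -> bounded_support k -> Ck m (conv f k).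
Proof.
move=> If; elim: m k => [|m IH] k sk bk.
  have [M M0 kM] := continuous_bounded_support_bounded (sk 0%N) bk.
  have [L L0 kL] := C1_lipschitz (sk 1%N) bk.
  apply: (@lipschitz_cont _ _ _ (L * itg (fun y => `|f y|))) => x y.
  exact: conv_lipschitz kM kL.
split.
- by apply: (@Ck_continuous _ _ m); exact: IH.
- by move=> i x; have [] := conv_smooth_is_derive i x If sk bk.
- move=> i; rewrite (_ : partial i _ = fun x => -1 * conv f (partial i k) x).
    apply: CkZ; apply: IH; last exact: bounded_support_partial.
    by move=> l; apply: Ck_partial; exact: sk.
  by apply/funext => x; rewrite mulN1r partial_conv.
Qed.

Lemma bounded_support_conv f k : bounded_support f -> bounded_support k -> bounded_support (conv f k).
Proof.
move=> [M fM] [M' kM']; exists (`|M| + `|M'|) => x xM.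
rewrite /conv (_ : (fun y => _) = fun=> 0); first exact: itg0.
apply/funext => y; have [/fM ->|yM] := ltP M `|y|; first by rewrite mul0r.
rewrite kM' ?mulr0//.
have h1 : `|x| <= `|y| + `|y - x|.
  by rewrite -[x in leLHS](subKr y) (le_trans (ler_normB _ _)).
have := ler_norm M; have := ler_norm M'; lra.
Qed.

Lemma laplacian_conv f k x : intg f -> (forall l, Ck l k) -> bounded_support k ->
  laplacian (conv f k) x = conv f (laplacian k) x.
Proof.
move=> If sk bk.
have sp i l : Ck l (partial i k) by apply: Ck_partial; exact: sk.
have bp i := bounded_support_partial i bk.
have bpp i := bounded_support_partial i (bp i).
have Ipp i : intg (fun y : E => f y * partial i (partial i k) (y - x)).
  have spp l : Ck l (partial i (partial i k)) by apply: Ck_partial; exact: sp.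
  have [M _ kM] := continuous_bounded_support_bounded (spp 0%N) (bpp i).
  apply: intg_conv kM => //; apply: continuous_measurable_rV; exact: (spp 0%N).
transitivity (\sum_i conv f (partial i (partial i k)) x).
  apply: eq_bigr => i _.
  rewrite (_ : partial i (conv f k) = fun x => -1 * conv f (partial i k) x); last first.
    by apply/funext => y; rewrite partial_conv// mulN1r.
  rewrite partialZ; last by have [_ + _] := Ck_conv 1 If (sp i) (bp i); exact.
  by rewrite partial_conv// mulN1r opprK.
rewrite /conv -itg_sum//; apply: eq_Rintegral => y _.
by rewrite mulr_sumr.
Qed.

Lemma conv_shift f k x : intg (fun y : E => f y * k (y - x)) ->
  conv f k x = itg (fun z : E => f (z + x) * k z).
Proof.
move=> I; rewrite /conv -(itg_shift x I); apply: eq_Rintegral => z _.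
by rewrite addrK.
Qed.

Lemma measurable_rV_add : measurable_fun setT (fun xy : E * E => xy.1 + xy.2).
Proof.
apply: measurable_fun_rV => i.
rewrite (_ : _ \o _ = (fun xy : E * E => rV_coord i xy.1 + rV_coord i xy.2)).
  by apply: measurable_funD; apply: measurableT_comp;
   [exact: measurable_rV_coord|exact: measurable_fst|
   exact: measurable_rV_coord|exact: measurable_snd].
by apply/funext => -[x y]; rewrite /rV_coord /= !mxE.
Qed.

(** As [k] has integral 1, the error at [x] is at most the integral of [|f (x + z) - f x| * k z] in
    [z]. Tonelli's theorem integrates in [x] first, where the continuity of translations gives [e]
    for each [z] in the support of [k]. The radius [d] depends on [f] and [e] alone. *)
Lemma conv_L1_close f (e : R) : intg f -> 0 < e -> exists2 d : R, 0 < d &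
  forall k M, continuous k -> (forall z, `|k z| <= M) -> (forall z, 0 <= k z) -> intg k ->
    itg k = 1 -> (forall z, d <= `|z| -> k z = 0) -> intg (conv f k) ->
    itg (fun x => `|conv f k x - f x|) <= e.
Proof.
move=> If e0; have [_ /(_ _ e0)[d d0 dP]] := intg_shift_continuous If.
exists d => // k M ck kM k0 Ik Ik1 kd Ic.
have mk := continuous_measurable_rV ck; have mf := intg_measurable If.
have Icf : intg (fun x => `|conv f k x - f x|) by apply: intg_norm; exact: intgB.
pose F (xz : E * E) : \bar R := (`|f (xz.2 + xz.1) - f xz.1| * k xz.2)%:E.
have mF : measurable_fun setT F.
  apply/measurable_EFinP; apply: measurable_funM; last first.
    by apply: measurableT_comp => //; exact: measurable_snd.
  apply: measurableT_comp => //; apply: measurable_funB; last first.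
    by apply: measurableT_comp => //; exact: measurable_fst.
  rewrite (_ : (fun xz => _) = f \o (fun xy : E * E => xy.1 + xy.2)).
    by apply: measurableT_comp => //; exact: measurable_rV_add.
  by apply/funext => -[a b] /=; rewrite addrC.
have F0 xz : (0 <= F xz)%E by rewrite lee_fin mulr_ge0.
have Ix (x : E) : intg (fun z : E => f (z + x) * k z - f x * k z).
  apply: intgB; last exact: intgZ.
  by apply: (intgM (M := M)) => //; exact: intg_shift.
rewrite -lee_fin itgE//.
apply: (@le_trans _ _ (\int[mu]_x \int[mu]_z F (x, z))%E).
  apply: ge0_le_integral => //.
  - by apply/measurable_EFinP; exact: (intg_measurable Icf).
  - exact: measurable_fun_fubini_tonelli_F.
  move=> x _; rewrite conv_shift; last exact: intg_conv kM.
  rewrite -[f x]mulr1 -Ik1 -itgZ// -itgB//; last 2 first.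
  - by apply: (intgM (M := M)) => //; exact: intg_shift.
  - exact: intgZ.
  rewrite (le_trans (y := (itg (fun z : E => `|f (z + x) * k z - f x * k z|))%:E))//.
    by rewrite lee_fin; exact: normr_itg_le.
  rewrite itgE; last exact: intg_norm.
  rewrite le_eqVlt; apply/orP; left; apply/eqP; apply: eq_integral => z _.
  by rewrite /F/= -mulrBl normrM (ger0_norm (k0 z)).
rewrite fubini_tonelli//.
apply: (@le_trans _ _ (\int[mu]_z (e * k z)%:E)%E); last first.
  by rewrite -itgE ?itgZ ?Ik1 ?mulr1//; exact: intgZ.
apply: ge0_le_integral => //.
- by move=> z _; apply: integral_ge0 => x _; exact: F0.
- exact: measurable_fun_fubini_tonelli_G.
- by apply/measurable_EFinP; exact: (intg_measurable (intgZ e Ik)).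
move=> z _.
have [zd|dz] := ltP `|z| d; last first.
  by rewrite kd// mulr0 integral0_eq// => x _; rewrite /F/= kd// mulr0.
have Is := intg_shift_dist z If.
rewrite (_ : (fun x => F (x, z)) = fun x : E => (k z * `|f (x + z) - f x|)%:E); last first.
  by apply/funext => x; rewrite /F/= [z + x]addrC mulrC.
rewrite -itgE; last exact: intgZ.
by rewrite itgZ// lee_fin mulrC ler_wpM2r// dP.
Qed.

End convolution.

(** * Smooth cutoffs and mollifiers *)

Section flat_functions.
Context {R : realType}.
Implicit Types (P : {poly R}) (t : R).

(* This family of functions, flat at the origin, is closed under
   differentiation, see [is_derive_flat]. *)
Definition flat P t : R := if 0 < t then P.[t^-1] * expR (- t^-1) else 0.

(** The exponential dominates each term of its own series, so [s ^+ i * expR (- s)] is at most [i!]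
    for nonnegative [s]. *)
Lemma polynomial_expR_bound P : exists2 C : R, 0 <= C &
  forall s : R, 0 <= s -> `|P.[s]| * expR (- s) <= C.
Proof.
exists (\sum_(i < size P) `|P`_i| * i`!%:R).
  by rewrite sumr_ge0// => i _; rewrite mulr_ge0.
move=> s s0; rewrite horner_coef.
rewrite (le_trans (ler_wpM2r (expR_ge0 _) (ler_norm_sum _ _ _)))// mulr_suml.
apply: ler_sum => i _; rewrite normrM -mulrA ler_wpM2l// expRN ler_pdivrMr ?expR_gt0//.
rewrite normrX ger0_norm//.
case: (i : nat) => [|j]; first by rewrite expr0 fact0 mul1r -expR0 ler_expR.
have := expR_ge1Dxn j s0; rewrite -ler_pdivrMl ?ltr0n ?fact_gt0// mulrC.
by apply: le_trans; rewrite lerDr.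
Qed.

(** At [t^-1], multiplication by ['X] is division by [t]. Applied to [P * 'X], the bound also shows
    that the difference quotient of [flat P] at 0 tends to 0. *)
Lemma flat_bound P : exists2 C : R, 0 <= C & forall t, `|flat P t| <= C * `|t|.
Proof.
have [C C0 CP] := polynomial_expR_bound (P * 'X).
exists C => // t; rewrite /flat; case: ifPn => t0; last by rewrite normr0 mulr_ge0.
have := CP t^-1; rewrite invr_ge0 ltW// => /(_ isT).
rewrite hornerM hornerX normrM (gtr0_norm t0) normfV (gtr0_norm t0).
rewrite mulrAC ler_pdivrMr// => h.
by rewrite normrM [`|expR _|]ger0_norm ?expR_ge0.
Qed.

Lemma is_derive_flat P t : is_derive t 1 (flat P) (flat ('X^2 * (P - P^`())) t).
Proof.
have [t0|t0|t0] := ltgtP 0 t.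
- rewrite [X in is_derive _ _ _ X]/flat t0.
  apply: (@near_eq_is_derive _ R^o R^o (fun s => P.[s^-1] * expR (- s^-1))).
    near=> s; rewrite /flat ifT//; near: s; exact: lt_nbhsr.
  have t1 : t != 0 by rewrite gt_eqF.
  have dV : is_derive t (1 : R) (fun s : R => s^-1) (- t ^- 2 *: 1) by exact: is_deriveV.
  have dP : is_derive t (1 : R) (horner P \o (fun s : R => s^-1)) (P^`().[t^-1] * (- t ^- 2 *: 1)).
    exact: is_derive1_comp.
  have dE : is_derive t (1 : R) (expR \o (fun s : R => - s^-1)) (expR (- t^-1) * (- (- t ^- 2 *: 1))).
    exact: is_derive1_comp.
  have := is_deriveM dP dE; congr is_derive.
  rewrite !hornerE/= /GRing.scale/=; field.
  exact: t1.
- rewrite [X in is_derive _ _ _ X]/flat ltNge ltW//=.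
  apply: (@near_eq_is_derive _ R^o R^o (fun=> 0)).
  near=> s; rewrite /flat ifF//; apply/negbTE; rewrite -leNgt ltW//; near: s; exact: lt_nbhsl.
- rewrite -t0 [X in is_derive _ _ _ X]/flat ltxx.
  have [C C0 CP] := flat_bound (P * 'X).
  have est (h : R) : h != 0 -> `|h^-1 *: (flat P (h *: 1 + 0) - flat P 0)| <= C * `|h|.
    move=> h0; rewrite addr0 [h *: 1]mulr1 [flat P 0]/flat ltxx subr0.
    apply: le_trans (CP h); rewrite le_eqVlt; apply/orP; left; apply/eqP; congr (`| _ |).
    rewrite /flat; case: ifP => hp; last by rewrite scaler0.
    by rewrite hornerM hornerX /GRing.scale/= mulrCA mulrA.
  have cv : h^-1 *: (flat P (h *: 1 + 0) - flat P 0) @[h --> (0 : R)^'] --> (0 : R).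
    apply/cvgrPdist_le => e e0.
    have c0 : 0 < C + 1 by rewrite ltr_wpDl.
    exists (e / (C + 1)) => /=; first by rewrite divr_gt0.
    move=> h; rewrite /= sub0r normrN ltr_pdivlMr// => he h0.
    rewrite sub0r normrN (le_trans (est _ h0))// (le_trans _ (ltW he))// mulrC.
    by rewrite ler_wpM2l// lerDl.
  by split; [apply/cvg_ex; exists (0 : R)|exact/cvg_lim].
Unshelve. all: by end_near. Qed.

Lemma continuous_flat P : continuous (flat P).
Proof.
move=> t; apply/differentiable_continuous/derivable1_diffP.
by have [] := is_derive_flat P t.
Qed.

Lemma flat_ge0 t : 0 <= flat 1 t.
Proof. by rewrite /flat; case: ifP => // _; rewrite hornerC mul1r expR_ge0. Qed.

Lemma flat_gt0 t : 0 < t -> 0 < flat 1 t.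
Proof. by rewrite /flat => ->; rewrite hornerC mul1r expR_gt0. Qed.

Lemma flat_le0 P t : t <= 0 -> flat P t = 0.
Proof. by rewrite /flat leNgt => /negbTE ->. Qed.

End flat_functions.

Section smooth_bumps.
Context {R : realType} {N : nat}.
Local Notation E := 'rV[R]_N.
Local Notation mu := (@lebesgue_rV R N).
Local Notation intg f := (mu.-integrable setT (EFin \o f)).
Local Notation itg f := (\int[mu]_x f x).
Local Notation e_ i := (delta_mx (ord0 : 'I_1) i : E).
Implicit Types (f g : E -> R) (x y c : E).

(** A chain rule for a single direction: the one-dimensional rule is applied to the restriction of
    [g] to the line through [x]. *)
Lemma is_derive_comp1 (h : R -> R) (dh : R) g x v : derivable g x v ->
  is_derive (g x) (1 : R) h dh -> is_derive x v (fun y => h (g y)) (dh * 'D_v g x).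
Proof.
move=> dg hh.
have dl : derivable (fun s : R => g (x + s *: v)) 0 1.
  by apply/derivable_line; rewrite scale0r addr0.
have lineE (f : E -> R) : (dquot (fun s : R => f (x + s *: v)) 1)^~ 0 = (dquot f v)^~ x.
  by apply/funext => u; rewrite /dquot addr0 scale0r addr0 [_ *: 1]mulr1 [x + _]addrC.
have dlE (f : E -> R) : 'D_1 (fun s : R => f (x + s *: v)) (0 : R) = 'D_v f x.
  change (lim ((dquot (fun s : R => f (x + s *: v)) 1)^~ 0 @ 0^') = lim ((dquot f v)^~ x @ 0^')).
  by rewrite lineE.
have D : is_derive (0 : R) (1 : R) (h \o (fun s : R => g (x + s *: v))) (dh * 'D_v g x).
  apply: is_derive1_comp; first by rewrite scale0r addr0.
  by split => //; rewrite dlE.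
have [D1 D2] := D.
split; last by rewrite -D2 -(dlE (fun y => h (g y))).
have /(derivable_line (fun y => h (g y)) x v 0) := D1.
by rewrite scale0r addr0.
Qed.

(** Differentiation changes the polynomial, so the induction on [k] must leave [P] free. *)
Lemma Ck_flat_comp k (P : {poly R}) g : Ck k g -> Ck k (fun x => flat P (g x)).
Proof.
elim: k P g => [|k IH] P g cg; first by apply: cont_comp => //; exact: continuous_flat.
have dg i x : derivable g x (e_ i) by have [_ + _] := cg; exact.
have df i x := is_derive_comp1 (dg i x) (is_derive_flat P (g x)).
split.
- by apply: cont_comp; [exact: continuous_flat|exact: Ck_continuous cg].
- by move=> i x; have [] := df i x.
- move=> i; rewrite (_ : partial i _ = fun x => flat ('X^2 * (P - P^`())) (g x) * partial i g x).
    by apply: CkM; [apply: IH; exact: CkS|exact: Ck_partial].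
  by apply/funext => x; have [_ <-] := df i x.
Qed.

Definition sq_dist c x : R := \sum_i (x - c) ord0 i ^+ 2.

Lemma sq_dist_ge0 c x : 0 <= sq_dist c x.
Proof. by rewrite sumr_ge0// => i _; exact: sqr_ge0. Qed.

Lemma Ck_sq_dist k c : Ck k (sq_dist c).
Proof.
apply: Ck_sum => i.
rewrite (_ : (fun x => _) = (fun x : E => (x ord0 i - c ord0 i) * (x ord0 i - c ord0 i))); last first.
  by apply/funext => x; rewrite !mxE expr2.
have cc : Ck k (fun x : E => x ord0 i - c ord0 i) by apply: CkD; [exact: Ck_coord|exact: Ck_cst].
exact: CkM.
Qed.

Lemma enorm_sq c x : enorm (x - c) ^+ 2 = sq_dist c x.
Proof. by rewrite /enorm sqr_sqrtr// sq_dist_ge0. Qed.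

Lemma enorm_ge0 x : 0 <= enorm x.
Proof. exact: sqrtr_ge0. Qed.

Lemma norm_le_enorm x : `|x| <= enorm x.
Proof.
apply: rV_norm_le => [|i]; first exact: enorm_ge0.
rewrite -sqrtr_sqr; apply: ler_wsqrtr.
by rewrite (bigD1 i)//= lerDl sumr_ge0// => j _; exact: sqr_ge0.
Qed.

Lemma enorm_le_norm x : enorm x <= N%:R * `|x|.
Proof.
have N0 : 0 <= N%:R * `|x| by rewrite mulr_ge0.
rewrite -(ger0_norm N0) -sqrtr_sqr ler_sqrt ?sqr_ge0//.
apply: (@le_trans _ _ (\sum_(i < N) `|x| ^+ 2)).
  apply: ler_sum => i _; rewrite -(real_normK (num_real (x ord0 i))).
  by rewrite ler_pXn2r ?nnegrE// rV_norm_coord.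
rewrite sumr_const card_ord -[leLHS]mulr_natl exprMn ler_wpM2r ?sqr_ge0//.
by rewrite -natrX ler_nat; case: N => // n; rewrite -[leqLHS]muln1 expnS leq_mul2l/= expn1.
Qed.

Definition bump c (r : R) x : R := flat 1 (r ^+ 2 - sq_dist c x).

Lemma Ck_bump k c r : Ck k (bump c r).
Proof.
apply: Ck_flat_comp; rewrite (_ : (fun x => _) = (fun x => r ^+ 2 + -1 * sq_dist c x)).
  by apply: CkD; [exact: Ck_cst|apply: CkZ; exact: Ck_sq_dist].
by apply/funext => x; rewrite mulN1r.
Qed.

Lemma bump_ge0 c r x : 0 <= bump c r x.
Proof. exact: flat_ge0. Qed.

Lemma bump_eq0 c r x : 0 <= r -> r <= enorm (x - c) -> bump c r x = 0.
Proof.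
move=> r0 rx; apply: flat_le0; rewrite subr_le0 -enorm_sq.
by rewrite ler_pXn2r ?nnegrE// (le_trans r0).
Qed.

Lemma bounded_support_bump c (r : R) : 0 <= r -> bounded_support (bump c r).
Proof.
move=> r0; exists (`|c| + r) => x h; apply: bump_eq0 => //.
apply: le_trans (norm_le_enorm _).
have := lerB_dist x c; have := ltW h; lra.
Qed.

(* [bump c r] is at least [flat 1 (3 / 4 * r ^+ 2)] on the ball of radius [r / 2],
   where the inner [flat] therefore vanishes. *)
Definition plateau c (r : R) x : R :=
  1 - (flat 1 1)^-1 * flat 1 (1 - (flat 1 (3 / 4 * r ^+ 2))^-1 * bump c r x).

Lemma Ck_plateau k c r : Ck k (plateau c r).
Proof.
rewrite (_ : plateau c r = (fun x => 1 +
   (- (flat 1 1)^-1) * flat 1 (1 + (- (flat 1 (3 / 4 * r ^+ 2))^-1) * bump c r x))).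
  apply: CkD; first exact: Ck_cst.
  apply: CkZ; apply: Ck_flat_comp; apply: CkD; first exact: Ck_cst.
  by apply: CkZ; exact: Ck_bump.
by apply/funext => x; rewrite !mulNr.
Qed.

Lemma plateau_eq0 c r x : 0 <= r -> r <= enorm (x - c) -> plateau c r x = 0.
Proof.
move=> r0 rx; rewrite /plateau bump_eq0// mulr0 subr0 mulVf ?subrr//.
by rewrite gt_eqF// flat_gt0.
Qed.

Lemma flat1_le (s t : R) : s <= t -> flat 1 s <= flat 1 t.
Proof.
move=> st; rewrite {1}/flat; case: ifPn => [s0|_]; last exact: flat_ge0.
rewrite /flat (lt_le_trans s0 st) !hornerC !mul1r ler_expR lerN2.
by rewrite lef_pV2// posrE// (lt_le_trans s0 st).
Qed.

Lemma plateau_eq1 c r x : 0 < r -> enorm (x - c) <= r / 2 -> plateau c r x = 1.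
Proof.
move=> r0 xr; rewrite /plateau [flat 1 (1 - _)]flat_le0 ?mulr0 ?subr0//.
rewrite subr_le0 mulrC ler_pdivlMr ?mul1r; last first.
  by apply: flat_gt0; rewrite mulr_gt0 ?exprn_gt0// divr_gt0.
apply: flat1_le; rewrite -enorm_sq.
have : enorm (x - c) ^+ 2 <= (r / 2) ^+ 2.
  by rewrite ler_pXn2r ?nnegrE ?enorm_ge0// divr_ge0// ltW.
by rewrite expr_div_n => h; lra.
Qed.

(* The mollifiers are not obtained from one another by scaling, which dispenses
   with the change of variables [x |-> x / d]. *)
Lemma mollifier (d : R) : 0 < d -> exists k : E -> R,
  [/\ forall l, Ck l k, forall z, 0 <= k z, intg k, itg k = 1 &
      forall z, d <= `|z| -> k z = 0].
Proof.
move=> d0.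
have Cb : continuous (bump (0 : E) d) by exact: (Ck_continuous (Ck_bump 0 0 d)).
have bb := bounded_support_bump (0 : E) (ltW d0).
have [C _ bC] := continuous_bounded_support_bounded Cb bb.
have Ib : intg (bump (0 : E) d).
  by apply: intg_bounded_support bb => //; exact: continuous_measurable_rV.
have itg0 : 0 < itg (bump (0 : E) d).
  rewrite lt_neqAle itg_ge0 ?andbT; last by move=> x; exact: bump_ge0.
  apply/eqP => I0.
  have H := itg_le0_ae Ib (bump_ge0 0 d) ltac:(by rewrite -I0).
  (* On the box of half-side [a] the Euclidean norm is at most [N%:R * (a + a)], which is less than
     [d]; the bump is positive there although the box has positive measure. *)
  pose a := d / (N%:R + 1) / 2.
  have N1 : 0 < N%:R + 1 :> R by rewrite ltr_wpDl.
  have a0 : 0 < a by rewrite /a !divr_gt0.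
  have : mu (obox (- const_mx a) (const_mx a)) = 0%E.
    apply: measure_negligible; first exact: measurable_obox.
    apply: negligibleS H => x xa /=; apply/eqP; rewrite gt_eqF// flat_gt0// subr_gt0.
    rewrite -enorm_sq subr0 ltr_pXn2r ?nnegrE ?enorm_ge0 ?ltW//.
    rewrite (le_lt_trans (enorm_le_norm x))//.
    have xa' : `|x| < a + a.
      apply: rV_norm_lt => [|i]; first by rewrite addr_gt0.
      have := xa i; rewrite in_itv/= !mxE -ltr_norml => /lt_trans; apply; lra.
    rewrite (le_lt_trans (y := (N%:R) * (a + a)))//.
      by rewrite ler_wpM2l// ltW.
    have -> : a + a = d / (N%:R + 1) by rewrite /a -splitr.
    by rewrite mulrA ltr_pdivrMr// mulrC ltr_pM2l// ltrDl.
  rewrite lebesgue_rV_obox => /eqP.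
  rewrite (eq_bigr (fun=> (a + a)%:E)).
    by rewrite prodEFin eqe prodf_seq_eq0 => /hasP[i _] /=; rewrite gt_eqF// addr_gt0.
  move=> i _; rewrite !mxE lebesgue_measure_itv/= lte_fin ifT; last lra.
  by rewrite -EFinB opprK.
exists (fun z => (itg (bump (0 : E) d))^-1 * bump 0 d z); split.
- by move=> l; apply: CkZ; exact: Ck_bump.
- by move=> z; rewrite mulr_ge0 ?invr_ge0 ?bump_ge0// ltW.
- exact: intgZ.
- by rewrite itgZ// mulVf// gt_eqF.
- move=> z dz; rewrite bump_eq0 ?mulr0 ?(ltW d0)// subr0.
  by rewrite (le_trans dz)// norm_le_enorm.
Qed.

End smooth_bumps.

(** * The quadratic form *)

Section positive_forms.
Context {R : realType} {W : lmodType R} (B : W -> W -> R).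
Hypothesis Bsym : forall x y, B x y = B y x.
Hypothesis Blin : forall a x y z, B (a *: x + y) z = a * B x z + B y z.
Hypothesis Bpos : forall x, 0 <= B x x.

Lemma formD x y z : B (x + y) z = B x z + B y z.
Proof. by rewrite -{1}(scale1r x) Blin mul1r. Qed.

Lemma form0 z : B 0 z = 0.
Proof. by have := formD 0 0 z; rewrite addr0; lra. Qed.

Lemma formZ a x z : B (a *: x) z = a * B x z.
Proof. by rewrite -{1}[a *: x]addr0 Blin form0 addr0. Qed.

Lemma form_expand a x y : B (a *: x + y) (a *: x + y) = a ^+ 2 * B x x + 2 * a * B x y + B y y.
Proof. by rewrite Blin [B x _]Bsym [B y _]Bsym !Blin (Bsym y x); ring. Qed.

Lemma quadratic_ge0_discriminant (a b c : R) : 0 <= a ->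
  (forall t : R, 0 <= a * t ^+ 2 + 2 * b * t + c) -> b ^+ 2 <= a * c.
Proof.
move=> a0 H; have [a_eq0|a_neq0] := eqVneq a 0.
  have [->|b0] := eqVneq b 0; first by rewrite a_eq0 expr0n/= mul0r.
  (* With [a = 0] and [b] nonzero this value of [t] makes the affine function equal to -1. *)
  have := H (- (c + 1) / (2 * b)); rewrite a_eq0 mul0r add0r.
  by rewrite mulrC divfK ?mulf_neq0// => h; exfalso; lra.
have a1 : 0 < a by rewrite lt_neqAle eq_sym a_neq0.
have := H (- b / a).
have -> : a * (- b / a) ^+ 2 + 2 * b * (- b / a) + c = (a * c - b ^+ 2) / a by field.
by rewrite pmulr_lge0 ?invr_gt0// subr_ge0.
Qed.

Lemma form_cauchy_schwarz x y : `|B x y| <= Num.sqrt (B x x) * Num.sqrt (B y y).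
Proof.
rewrite -sqrtrM// -sqrtr_sqr; apply: ler_wsqrtr.
apply: quadratic_ge0_discriminant => // t.
by have := Bpos (t *: x + y); rewrite form_expand; lra.
Qed.

Lemma form_seminorm : is_seminorm (fun x => Num.sqrt (B x x)).
Proof.
split => [x y|a x]; last first.
  by rewrite formZ Bsym formZ mulrA -expr2 sqrtrM ?sqr_ge0// sqrtr_sqr.
have s0 : 0 <= Num.sqrt (B x x) + Num.sqrt (B y y) by rewrite addr_ge0 ?sqrtr_ge0.
rewrite -(ger0_norm s0) -sqrtr_sqr; apply: ler_wsqrtr.
rewrite -{1 2}(scale1r x) form_expand sqrrD !sqr_sqrtr// expr1n mul1r mulr1.
have := form_cauchy_schwarz x y; rewrite ler_norml => /andP[_ h].
by rewrite mulr2n; lra.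
Qed.

(** Written with the midpoint, the competitor that near-minimality will be tested against. *)
Lemma form_parallelogram x y :
  B (2^-1 *: (x + y)) (2^-1 *: (x + y)) + B (x - y) (x - y) / 4 = (B x x + B y y) / 2.
Proof.
rewrite formZ Bsym formZ.
rewrite -{1 2}(scale1r x) form_expand addrC -[x - y]addrC -scaleN1r.
by rewrite form_expand (Bsym y x); field.
Qed.

End positive_forms.

Section lipschitz_compact_support.
Context {R : realType} {N : nat}.
Local Notation E := 'rV[R]_N.
Local Notation mu := (@lebesgue_rV R N).
Local Notation intg f := (mu.-integrable setT (EFin \o f)).
Local Notation itg f := (\int[mu]_x f x).
Local Notation e_ i := (delta_mx (ord0 : 'I_1) i : E).
Implicit Types (f g phi : E -> R) (x y c : E).

Definition lipschitz_bs f :=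
  (exists k : R, forall x y, `|f x - f y| <= k * `|x - y|) /\ bounded_support f.

Lemma lipschitz_bs_cont f : lipschitz_bs f -> continuous f.
Proof. by move=> [[k fk] _]; exact: lipschitz_cont fk. Qed.

Lemma lipschitz_bs_measurable f : lipschitz_bs f -> measurable_fun setT f.
Proof. by move=> lf; apply: continuous_measurable_rV; exact: lipschitz_bs_cont. Qed.

Lemma lipschitz_bs_bounded f : lipschitz_bs f -> exists2 C : R, 0 <= C & forall x, `|f x| <= C.
Proof. by move=> [[k fk] sf]; exact: lipschitz_bounded_support_bounded fk sf. Qed.

Lemma lipschitz_bs_intg f : lipschitz_bs f -> intg f.
Proof.
move=> lf; have [C _ fC] := lipschitz_bs_bounded lf.
by apply: intg_bounded_support fC lf.2; exact: lipschitz_bs_measurable.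
Qed.

Lemma lipschitz_bs_measurable_partial i f : lipschitz_bs f -> measurable_fun setT (partial i f).
Proof. by move=> lf; apply: measurable_partial; exact: lipschitz_bs_cont. Qed.

Lemma lipschitz_bs_partial_bounded f : lipschitz_bs f ->
  exists C : R, forall i x, `|partial i f x| <= C.
Proof. by move=> [[k fk] _]; exists `|k| => i x; exact: partial_lipschitz_le. Qed.

Lemma lipschitz_bs_ae f : lipschitz_bs f -> {ae mu, forall x, forall i, derivable f x (e_ i)}.
Proof. by move=> [[k fk] _]; apply: ae_all_count => i; exact: lipschitz_ae_partial fk. Qed.

Lemma intg_partialM i f g : lipschitz_bs f -> lipschitz_bs g ->
  intg (fun x => partial i f x * partial i g x).
Proof.
move=> lf lg; have [C fC] := lipschitz_bs_partial_bounded lf.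
have [C' gC'] := lipschitz_bs_partial_bounded lg.
apply: (intgM (M := C')) => //; last exact: lipschitz_bs_measurable_partial.
apply: (intg_bounded_support (k := C)) => //; first exact: lipschitz_bs_measurable_partial.
by apply: bounded_support_partial; exact: lf.2.
Qed.

Definition grad_dot f g x := \sum_i partial i f x * partial i g x.

Lemma intg_grad_dot f g : lipschitz_bs f -> lipschitz_bs g -> intg (grad_dot f g).
Proof. by move=> lf lg; apply: intg_sum => i; exact: intg_partialM. Qed.

Lemma bounded_lipschitzM f g (C C' k k' : R) :
  (forall x, `|f x| <= C) -> (forall x, `|g x| <= C') ->
  (forall x y, `|f x - f y| <= k * `|x - y|) -> (forall x y, `|g x - g y| <= k' * `|x - y|) ->
  forall x y, `|f x * g x - f y * g y| <= (C * k' + C' * k) * `|x - y|.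
Proof.
move=> fC gC fk gk x y.
have -> : f x * g x - f y * g y = f x * (g x - g y) + g y * (f x - f y) by ring.
rewrite (le_trans (ler_normD _ _))// mulrDl !normrM -!mulrA.
by rewrite lerD// ler_pM.
Qed.

Lemma lipschitz_bsM f g : lipschitz_bs f -> lipschitz_bs g -> lipschitz_bs (fun x => f x * g x).
Proof.
move=> lf lg; have [C _ fC] := lipschitz_bs_bounded lf; have [C' _ gC'] := lipschitz_bs_bounded lg.
case: lf => [[k fk] [M fM]]; case: lg => [[k' gk'] _]; split.
  by exists (C * k' + C' * k); exact: bounded_lipschitzM.
by exists M => x /fM ->; rewrite mul0r.
Qed.

Lemma C1_lipschitz_bs f : Ck 1 f -> bounded_support f -> lipschitz_bs f.
Proof. by move=> cf sf; split => //; have [L _ fL] := C1_lipschitz cf sf; exists L. Qed.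

Lemma measurable_laplacian phi : Ck 2 phi -> measurable_fun setT (laplacian phi).
Proof.
move=> cphi; apply: measurable_sum => i; apply: continuous_measurable_rV.
by apply: (@Ck_continuous _ _ 0); apply: Ck_partial; exact: Ck_partial.
Qed.

Lemma bounded_support_laplacian phi : bounded_support phi -> bounded_support (laplacian phi).
Proof.
move=> [M pM]; exists M => x xM; rewrite /laplacian big1// => i _.
have far f : (forall x, M < `|x| -> f x = 0) -> forall x, M < `|x| -> partial i f x = 0.
  move=> fM y My; apply: (@partial_eq0 _ _ _ _ (cball0 M)); first exact: closed_cball0.
  - by move=> z /negP; rewrite -ltNge => /fM.
  - by apply/negP; rewrite -ltNge.
by apply: (far _ (far _ pM)).
Qed.

(** For each [i] the two integrands add up almost everywhere to the [i]-th partial derivative of the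
    Lipschitz function [f * partial i phi], whose integral is 0. *)
Lemma itg_grad_laplacian f phi : lipschitz_bs f -> Ck 2 phi -> bounded_support phi ->
  itg (grad_dot f phi) = - itg (fun x => f x * laplacian phi x).
Proof.
move=> lf cphi sphi.
have lphi : lipschitz_bs phi by apply: C1_lipschitz_bs => //; exact: CkS.
have lp i : lipschitz_bs (partial i phi).
  by apply: C1_lipschitz_bs; [exact: Ck_partial|exact: bounded_support_partial].
have [C _ fC] := lipschitz_bs_bounded lf.
have Ifpp i : intg (fun x => f x * partial i (partial i phi) x).
  have [C' pC'] := lipschitz_bs_partial_bounded (lp i).
  apply: (intgM (M := C')) => //; first exact: lipschitz_bs_intg.
  exact: lipschitz_bs_measurable_partial.
rewrite /grad_dot itg_sum; last by move=> i; exact: intg_partialM.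
have -> : itg (fun x => f x * laplacian phi x) =
    \sum_i itg (fun x => f x * partial i (partial i phi) x).
  by rewrite -itg_sum//; apply: eq_Rintegral => x _; rewrite mulr_sumr.
rewrite -sumrN; apply: eq_bigr => i _.
apply/eqP; rewrite -addr_eq0 -itgD//; last exact: intg_partialM.
have lfp := lipschitz_bsM lf (lp i).
have [[k fk] sfp] := lfp.
rewrite -(itg_partial_eq0 i fk sfp); apply/eqP.
apply: itg_ae_eq.
- apply: measurable_funD; apply: intg_measurable; [exact: intg_partialM|exact: Ifpp].
- exact: lipschitz_bs_measurable_partial.
- apply: ae_imp (lipschitz_bs_ae lf) => x df.
  rewrite partialM//; last by have [_ + _] := Ck_partial i cphi; exact.
  by rewrite mulrC addrC [partial i phi x * _]mulrC.
Qed.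

End lipschitz_compact_support.

Section quadratic_form.
Context {R : realType} {N : nat}.
Local Notation E := 'rV[R]_N.
Local Notation mu := (@lebesgue_rV R N).
Local Notation intg f := (mu.-integrable setT (EFin \o f)).
Local Notation itg f := (\int[mu]_x f x).
Local Notation e_ i := (delta_mx (ord0 : 'I_1) i : E).
Variables (Omega : set E) (V : E -> R).
Hypothesis VL : L1loc Omega V.
Implicit Types (xi eta zeta : W1inf_c Omega) (f g h : E -> R).

Lemma itg_in (D : set E) f : (forall x, ~ D x -> f x = 0) ->
  \int[mu]_(x in D) f x = itg f.
Proof.
move=> f0; rewrite Rintegral_mkcond; apply: eq_Rintegral => x _.
by rewrite patchE; case: ifPn => //; rewrite notin_setE => /f0.
Qed.

Lemma compact_bounded_norm (K : set E) : compact K -> exists M : R, forall x, K x -> `|x| <= M.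
Proof.
move=> /compact_bounded[M [_ MP]]; exists (M + 1) => x Kx.
by apply: MP => //; rewrite ltrDl.
Qed.

Lemma compact_lty (K : set E) : compact K -> (mu K < +oo)%E.
Proof.
move=> cK; have [M KM] := compact_bounded_norm cK.
apply: le_lt_trans (cball0_lty M); apply: le_measure; rewrite ?inE.
- exact: compact_measurable_rV.
- exact: measurable_cball0.
- exact: KM.
Qed.

(** Nothing is known of [g] outside [Omega]; it is replaced by its restriction to [K], which carries
    [h]. *)
Lemma L1loc_intg g h (K : set E) (M : R) : L1loc Omega g -> compacts_in Omega K ->
  measurable_fun setT h -> (forall x, `|h x| <= M) -> (forall x, ~ K x -> h x = 0) ->
  intg (fun x => g x * h x).
Proof.
move=> gL cK mh hM hK; have mK : measurable K by apply: compact_measurable_rV; exact: cK.1.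
have Ig : intg (g \_ K).
  by have /integrable_mkcond := gL _ cK; move=> /(_ mK); rewrite restrict_EFin.
apply: eq_intg (intgM Ig mh hM) => x.
by rewrite patchE; case: ifPn => //; rewrite notin_setE => /hK ->; rewrite !mulr0.
Qed.

Lemma W_lipschitz_bs xi : lipschitz_bs xi.
Proof.
case: xi => f /= /[dup] + /asboolP[/lipschitzP[k fk] [K [cK _] fK]] => _.
split; first by exists k.
have [M KM] := compact_bounded_norm cK; exists M => x Mx; apply: fK => /KM.
by rewrite leNgt Mx.
Qed.

Lemma W_support xi : exists2 K, compacts_in Omega K & forall x, ~ K x -> xi x = 0.
Proof. by case: xi => f /= /asboolP[_ [K cK fK]]; exists K. Qed.

Lemma W_eq0 xi x : ~ Omega x -> xi x = 0.
Proof. by have [K [_ KO] xK] := W_support xi => Ox; apply: xK => /KO. Qed.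

Lemma W_partial_support xi : exists2 K, compacts_in Omega K &
  (forall x, ~ K x -> xi x = 0) /\ (forall i x, ~ K x -> partial i xi x = 0).
Proof.
have [K cK xK] := W_support xi; exists K => //; split => // i x.
apply: partial_eq0 => //; apply: compact_closed; last exact: cK.1.
exact: norm_hausdorff.
Qed.

Lemma W_partial_eq0 xi i x : ~ Omega x -> partial i xi x = 0.
Proof. by have [K [_ KO] [_ xK]] := W_partial_support xi => Ox; apply: xK => /KO. Qed.

Lemma mk_W f : lipschitz_bs f -> compactly_supported Omega f -> f \in lip_c Omega.
Proof. by move=> [[k fk] _] sf; apply/asboolP; split => //; apply/lipschitzP; exists k. Qed.

Lemma intg_V xi h : measurable_fun setT h -> (exists M : R, forall x, `|h x| <= M) ->
  intg (fun x => V x * (xi x * h x)).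
Proof.
move=> mh [M hM]; have [K cK xK] := W_support xi.
have lx := W_lipschitz_bs xi; have [C C0 xC] := lipschitz_bs_bounded lx.
apply: (@L1loc_intg _ _ K (C * M)) => //.
- by apply: measurable_funM => //; exact: lipschitz_bs_measurable.
- by move=> x; rewrite normrM ler_pM.
- by move=> x /xK ->; rewrite mul0r.
Qed.

Lemma intg_VW xi eta : intg (fun x => V x * (xi x * eta x)).
Proof.
have le := W_lipschitz_bs eta; have [C C0 eC] := lipschitz_bs_bounded le.
by apply: intg_V; [exact: lipschitz_bs_measurable|exists C].
Qed.

Definition Q_form xi eta : R := itg (fun x => grad_dot xi eta x + V x * (xi x * eta x)).

Lemma intg_Q_form xi eta : intg (fun x => grad_dot xi eta x + V x * (xi x * eta x)).
Proof.
apply: intgD; last exact: intg_VW.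
by apply: intg_grad_dot; exact: W_lipschitz_bs.
Qed.

Lemma Q_formE xi eta : Q_form xi eta =
  itg (grad_dot xi eta) + itg (fun x => V x * (xi x * eta x)).
Proof.
by rewrite /Q_form itgD//; [apply: intg_grad_dot; exact: W_lipschitz_bs|exact: intg_VW].
Qed.

Lemma Q_V_form xi : Q_V V xi = Q_form xi xi.
Proof.
rewrite /Q_V itg_in; last first.
  move=> x Ox; rewrite W_eq0// expr0n mulr0 addr0 /grad_sq big1// => i _.
  by rewrite W_partial_eq0// expr0n.
by apply: eq_Rintegral => x _; congr (_ + _).
Qed.

Lemma Q_form_sym xi eta : Q_form xi eta = Q_form eta xi.
Proof.
apply: eq_Rintegral => x _; congr (_ + _ * _); last by rewrite mulrC.
by apply: eq_bigr => i _; rewrite mulrC.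
Qed.

(** An identity almost everywhere: at a point where a function is not derivable, the default value
    of its partial derivative does not respect sums. *)
Lemma W_partial_lin a xi eta : {ae mu, forall x, forall i,
  partial i (a *: xi + eta : W1inf_c Omega) x = a * partial i xi x + partial i eta x}.
Proof.
apply: ae_imp2 (lipschitz_bs_ae (W_lipschitz_bs xi)) (lipschitz_bs_ae (W_lipschitz_bs eta)) => x dx de i.
rewrite (_ : (a *: xi + eta : W1inf_c Omega) = (fun y => a * xi y + eta y) :> (E -> R))//.
rewrite partialD//; last exact: (derivableZ (k := a) (dx i)).
by rewrite partialZ.
Qed.

Lemma Q_form_lin a xi eta zeta :
  Q_form (a *: xi + eta) zeta = a * Q_form xi zeta + Q_form eta zeta.
Proof.
rewrite /Q_form -itgZ; last exact: intg_Q_form.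
rewrite -itgD; [|by apply: intgZ; exact: intg_Q_form|exact: intg_Q_form].
apply: itg_ae_eq.
- by apply: intg_measurable; exact: intg_Q_form.
- by apply: intg_measurable; apply: intgD; [apply: intgZ|]; exact: intg_Q_form.
apply: ae_imp (W_partial_lin a xi eta) => x plin.
have -> : grad_dot (a *: xi + eta : W1inf_c Omega) zeta x = a * grad_dot xi zeta x + grad_dot eta zeta x.
  rewrite /grad_dot mulr_sumr -big_split/=; apply: eq_bigr => i _.
  by rewrite plin; ring.
rewrite (_ : (a *: xi + eta : W1inf_c Omega) x = a * xi x + eta x)//.
by ring.
Qed.

Hypothesis Qpos : Q_nonneg Omega V.

Lemma Q_form_ge0 xi : 0 <= Q_form xi xi.
Proof. by rewrite -Q_V_form. Qed.

Lemma norm_L_form xi : norm_L V xi = Num.sqrt (Q_form xi xi).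
Proof. by rewrite /norm_L Q_V_form. Qed.

Lemma norm_L_seminorm : is_seminorm (@norm_L _ _ Omega V).
Proof.
have := form_seminorm Q_form_sym Q_form_lin Q_form_ge0.
by congr is_seminorm; apply/funext => xi; rewrite norm_L_form.
Qed.

Lemma Q_form_CS xi eta : `|Q_form xi eta| <= norm_L V xi * norm_L V eta.
Proof. by rewrite !norm_L_form; exact: (form_cauchy_schwarz Q_form_sym Q_form_lin Q_form_ge0). Qed.

Lemma W_norm_subproof xi : (fun x => `|xi x|) \in lip_c Omega.
Proof.
have [[k xk] [M xM]] := W_lipschitz_bs xi; have [K cK xK] := W_support xi.
apply: mk_W; last by exists K => // x /xK ->; rewrite normr0.
split; last by exists M => x /xM ->; rewrite normr0.
by exists k => x y; apply: le_trans (xk x y); exact: ler_dist_dist.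
Qed.

Definition W_norm xi : W1inf_c Omega := W1infC (W_norm_subproof xi).

(** Where [f] does not vanish its sign is locally constant. Where it vanishes, the quotients of
    [|f|] with positive steps are the absolute values of those of [f]. *)
Lemma partial_norm_sq f i x : continuous f -> derivable f x (e_ i) ->
  derivable (fun x => `|f x|) x (e_ i) ->
  partial i (fun x => `|f x|) x ^+ 2 = partial i f x ^+ 2.
Proof.
move=> cf df dnf; have [fx0|fx0|fx0] := ltgtP (f x) 0.
- have fN : \near x, `|f x| = - f x.
    have : \forall y \near x, f y < 0 by have := cf x; move=> /cvgr_lt; exact.
    by apply: filterS => y fy; rewrite ltr0_norm.
  rewrite (partial_near_eq _ fN).
  rewrite (_ : (fun x => - f x) = fun x => -1 * f x); last by apply/funext => y; rewrite mulN1r.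
  by rewrite partialZ// mulN1r sqrrN.
- have fN : \near x, `|f x| = f x.
    have : \forall y \near x, 0 < f y by have := cf x; move=> /cvgr_gt; exact.
    by apply: filterS => y fy; rewrite gtr0_norm.
  by rewrite (partial_near_eq _ fN).
- have c1 : (fun n => `|dquot f (e_ i) n.+1%:R^-1 x|) @ \oo --> `|partial i f x|.
    by apply: cvg_norm; exact: cvg_dquot_harmonic.
  suff -> : partial i (fun x => `|f x|) x = `|partial i f x|.
    by rewrite real_normK// num_real.
  rewrite -(cvg_lim (@Rhausdorff R) c1); apply/esym; apply: cvg_lim => //.
  rewrite (_ : (fun n => _) = (fun n => dquot (fun x => `|f x|) (e_ i) n.+1%:R^-1 x)).
    exact: cvg_dquot_harmonic.
  apply/funext => n; rewrite /dquot fx0 normr0 !subr0 normrM.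
  by rewrite gtr0_norm// invr_gt0.
Qed.

(** This permits a nonnegative minimizing sequence. *)
Lemma Q_form_norm xi : Q_form (W_norm xi) (W_norm xi) = Q_form xi xi.
Proof.
apply: itg_ae_eq; [by apply: intg_measurable; exact: intg_Q_form..|].
apply: ae_imp2 (lipschitz_bs_ae (W_lipschitz_bs xi)) (lipschitz_bs_ae (W_lipschitz_bs (W_norm xi))).
move=> x dx dn; congr (_ + _ * _); last by rewrite /= -normrM -expr2 ger0_norm ?sqr_ge0// expr2.
apply: eq_bigr => i _; rewrite -!expr2.
by apply: partial_norm_sq => //; exact: (lipschitz_bs_cont (W_lipschitz_bs xi)).
Qed.

End quadratic_form.

(** * Exhaustion by compacts *)

Section compact_exhaustion.
Context {R : realType} {N : nat}.
Local Notation E := 'rV[R]_N.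
Local Notation mu := (@lebesgue_rV R N).
Local Notation intg f := (mu.-integrable setT (EFin \o f)).
Local Notation itg f := (\int[mu]_x f x).
Implicit Types (f g : E -> R) (K A D : set E) (x y c : E).

Lemma bounded_closed_compact_rV (A : set E) (M : R) : closed A -> (forall x, A x -> `|x| <= M) -> compact A.
Proof.
move=> cA AM; apply: bounded_closed_compact => //.
by exists M; split => [|r Mr x /AM /le_trans]; [exact: num_real|apply; exact: ltW].
Qed.

Lemma closed_compact_rV K : compact K -> closed K.
Proof. by apply: compact_closed; exact: norm_hausdorff. Qed.

Lemma continuous_sq_dist c : continuous (sq_dist c).
Proof. exact: (@Ck_continuous _ _ 0 _ (Ck_sq_dist 0 c)). Qed.

Lemma enorm_lt_sq c x (r : R) : 0 < r -> (enorm (x - c) < r) = (sq_dist c x < r ^+ 2).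
Proof. by move=> r0; rewrite -enorm_sq ltr_pXn2r// nnegrE ?enorm_ge0// ltW. Qed.

Lemma enorm_le_sq c x (r : R) : 0 < r -> (enorm (x - c) <= r) = (sq_dist c x <= r ^+ 2).
Proof. by move=> r0; rewrite -enorm_sq ler_pXn2r// nnegrE ?enorm_ge0// ltW. Qed.

Lemma open_open_ball c (r : R) : 0 < r -> open (open_ball c r).
Proof.
move=> r0; rewrite (_ : open_ball c r = sq_dist c @^-1` [set t | t < r ^+ 2]).
  apply: open_comp => [x _|]; [exact: continuous_sq_dist|exact: open_lt].
by apply/seteqP; split => x; rewrite /open_ball/= enorm_lt_sq.
Qed.

Lemma closed_closed_ball_e c (r : R) : 0 < r -> closed (closed_ball_e c r).
Proof.
move=> r0; rewrite (_ : closed_ball_e c r = sq_dist c @^-1` [set t | t <= r ^+ 2]).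
  apply: closed_comp => [x _|]; [exact: continuous_sq_dist|exact: closed_le].
by apply/seteqP; split => x; rewrite /closed_ball_e/= enorm_le_sq.
Qed.

Lemma compact_closed_ball_e c (r : R) : 0 < r -> compact (closed_ball_e c r).
Proof.
move=> r0; apply: (@bounded_closed_compact_rV _ (`|c| + r)); first exact: closed_closed_ball_e.
move=> x /= xr; have := le_trans (norm_le_enorm _) xr; have := lerB_dist x c; lra.
Qed.

Lemma open_ball_center c (r : R) : 0 < r -> open_ball c r c.
Proof.
move=> r0; rewrite /open_ball/= subrr /enorm big1 ?sqrtr0// => i _.
by rewrite mxE expr0n.
Qed.

Lemma closure_open_ball c (r : R) : 0 < r -> closure (open_ball c r) `<=` closed_ball_e c r.
Proof.
move=> r0; have /closure_id -> := @closed_closed_ball_e c r r0.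
by apply: closure_subset => x /= /ltW.
Qed.

Lemma open_closed_ball_sub D x : open D -> D x -> exists2 r : R, 0 < r & closed_ball_e x r `<=` D.
Proof.
move=> oD Dx; have /nbhs_ballP[r /= r0 rD] : nbhs x D by exact: open_nbhs_nbhs.
exists (r / 2); first by rewrite divr_gt0.
move=> y /= yr; apply: rD; rewrite -ball_normE /ball_/= distrC.
by have := le_trans (norm_le_enorm _) yr; lra.
Qed.

Lemma compact_ball_cover K (r : E -> R) : compact K -> (forall c, K c -> 0 < r c) ->
  exists2 s : seq E, (forall c, c \in s -> K c) & forall x, K x -> exists2 c, c \in s & open_ball c (r c) x.
Proof.
rewrite compact_cover => cK r0.
have [||F FK KF] := cK E K (fun c => open_ball c (r c)).
- by move=> c Kc; apply: open_open_ball; exact: r0.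
- by move=> x Kx; exists x => //; apply: open_ball_center; exact: r0.
exists (finmap.enum_fset F) => [c cF|x Kx].
  by have := FK c cF; rewrite inE.
by have [c cF xc] := KF _ Kx; exists c.
Qed.

Variable Omega : set E.
Hypothesis Oopen : open Omega.

(** The distance to the complement is bounded below through a quantifier, which remains meaningful
    when [Omega] is the whole space. *)
Definition exh (n : nat) : set E :=
  [set x | `|x| <= n%:R /\ forall y, ~ Omega y -> n.+1%:R^-1 <= `|x - y|].

Lemma exh_compacts_in n : compacts_in Omega (exh n).
Proof.
split; last first.
  move=> x [_ xO]; apply: contrapT => /xO; rewrite subrr normr0 leNgt.
  by rewrite invr_gt0 ltr0Sn.
apply: (@bounded_closed_compact_rV _ n%:R); last by move=> x [].
have -> : exh n = cball0 n%:R `&` \bigcap_(y in ~` Omega) (fun x => `|x - y|) @^-1` [set t | n.+1%:R^-1 <= t].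
  by apply/seteqP; split => x [xn xO]; split => // y /xO.
apply: closedI; first exact: closed_cball0.
apply: closed_bigI => y _; apply: closed_comp; last exact: closed_ge.
have cd : continuous (fun x : E => `|x - y|).
  apply: (lipschitz_cont (k := 1)) => u v.
  by rewrite mul1r (le_trans (ler_dist_dist _ _))// opprB addrA subrK.
by move=> x _; exact: cd.
Qed.

(** The near-covering form of compactness leaves a local claim: if the ball of radius [r] about [x]
    lies in [Omega], all points within [r / 2] of [x] belong to [exh n] for large [n]. *)
Lemma exh_absorb K : compacts_in Omega K -> exists n, K `<=` exh n.
Proof.
move=> [/compact_near_coveringP cK KO].
have [|n _ /(_ n) Kn] := @cK nat \oo (fun n x => exh n x) _; last by exists n; exact: Kn (leqnn n).
move=> x /KO Ox; have /nbhs_ballP[r /= r0 rO] : nbhs x Omega by exact: open_nbhs_nbhs.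
have nx : \forall y \near x, `|x - y| < r / 2.
  by apply/nbhs_ballP; exists (r / 2) => [|y]; [rewrite /= divr_gt0|rewrite -ball_normE].
have r2 : 0 < r / 2 by rewrite divr_gt0.
near=> y n => /=.
have yx : `|x - y| < r / 2.
  by near: y; exact: nx.
split.
  have : `|x| + r <= n%:R by near: n; exact: nbhs_infty_ger.
  have := ler_distD x y 0; rewrite !subr0 distrC; lra.
move=> z Oz; have h1 : n.+1%:R^-1 <= r / 2.
  by apply: ltW; near: n; exact: (near_infty_natSinv_lt (PosNum r2)).
have : r <= `|x - z|.
  rewrite leNgt; apply/negP => xz; apply: Oz; apply: rO.
  by rewrite -ball_normE /ball_/=.
move: (n.+1%:R^-1) h1 yx (ler_distD y x z) => t /=; lra.
Unshelve. all: by end_near.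
Qed.

Lemma compact_neighborhood K : compacts_in Omega K ->
  exists2 e : R, 0 < e & exists2 K', compacts_in Omega K' &
    forall x y, K x -> `|y - x| <= e -> K' y.
Proof.
(* Half of the distance [n.+1%:R^-1] to the complement is spent on the displacement; the remaining
   half is [n.+1.*2%:R^-1], enough for membership in [exh n.+1.*2]. *)
move=> /exh_absorb[n Kn]; exists (n.+1.*2%:R^-1); first by rewrite invr_gt0 ltr0n double_gt0.
exists (exh n.+1.*2); first exact: exh_compacts_in.
move=> x y /Kn[xn xO] yx; have yx1 : `|y - x| <= 1.
  by rewrite (le_trans yx)// invf_le1 ?ltr0n ?double_gt0// ler1n double_gt0.
split.
  have : (n%:R + 1 : R) <= n.+1.*2%:R by rewrite natr1 ler_nat -addnn leq_addr.
  have := ler_distD x y 0; rewrite !subr0; lra.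
move=> z /xO xz; have : n.+1.*2.+1%:R^-1 <= n.+1.*2%:R^-1 :> R.
  by rewrite lef_pV2 ?posrE ?ltr0n ?double_gt0// ler_nat.
have : n.+1%:R^-1 = n.+1.*2%:R^-1 + n.+1.*2%:R^-1 :> R.
  by rewrite -mul2n natrM invfM; field; rewrite addrC natr1 pnatr_eq0.
move: (_^-1) (_^-1) (_^-1) xz yx (ler_distD y x z) => s t t'.
by rewrite [`|x - y|]distrC; lra.
Qed.

Lemma bigcup_exh : \bigcup_n exh n = Omega.
Proof.
apply/seteqP; split => x; first by move=> [n _]; have [_] := exh_compacts_in n; apply.
move=> Ox; have [|n xn] := @exh_absorb [set x]; last by exists n => //; exact: xn.
by split; [exact: compact_set1|move=> _ ->].
Qed.

Lemma L1loc_measurable g : L1loc Omega g -> measurable_fun setT (g \_ Omega).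
Proof.
move=> gL; have mO : measurable Omega by exact: open_measurable_rV.
have mK n : measurable (exh n) by apply: compact_measurable_rV; have [] := exh_compacts_in n.
apply: (proj1 (measurable_restrictT g mO)).
suff : measurable_fun (\bigcup_n exh n) g by rewrite bigcup_exh.
apply/(measurable_fun_bigcup g mK) => n.
by have /measurable_int/measurable_EFinP := gL _ (exh_compacts_in n).
Qed.

Lemma L1loc_restrict g K : L1loc Omega g -> compacts_in Omega K -> intg (g \_ K).
Proof.
move=> gL cK; have mK : measurable K by apply: compact_measurable_rV; exact: cK.1.
by have /integrable_mkcond := gL _ cK; move=> /(_ mK); rewrite restrict_EFin.
Qed.

(** Countably many compacts exhaust [Omega], and finitely many of the given balls cover each of
    them. *)
Lemma local_ae (P : E -> Prop) :
  (forall c, Omega c -> exists2 r : R, 0 < r & {ae mu, forall x, open_ball c r x -> P x}) ->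
  {ae mu, forall x, Omega x -> P x}.
Proof.
move=> locP.
have /choice[r rP] : forall c, exists r : R, Omega c -> 0 < r /\ {ae mu, forall x, open_ball c r x -> P x}.
  move=> c; have [Oc|nO] := pselect (Omega c); last by exists 0 => /nO.
  by have [r r0 rP] := locP c Oc; exists r.
have aeK n : {ae mu, forall x, exh n x -> P x}.
  have [cn nO] := exh_compacts_in n.
  have [|s sK Ks] := compact_ball_cover (r := r) cn; first by move=> c /nO /rP[].
  have : {ae mu, forall x, forall c, c \in s -> open_ball c (r c) x -> P x}.
    elim: s sK {Ks} => [_|c s IH sK]; first by apply: ae_all.
    have [_] := rP c (nO _ (sK c (mem_head _ _))).
    apply: ae_imp2 (IH _) => [x Hs Hc c'|c' c's]; last by apply: sK; rewrite inE c's orbT.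
    by rewrite inE => /orP[/eqP ->|/Hs].
  by apply: ae_imp => x Hs /Ks[c /Hs].
apply: ae_imp (ae_all_count aeK) => x Hx; rewrite -bigcup_exh => -[n _].
exact: Hx.
Qed.

Lemma ball_ess_inf_pos_local f c : ball_ess_inf_pos Omega f -> Omega c ->
  exists2 r : R, 0 < r & exists2 m : R, 0 < m & {ae mu, forall x, open_ball c r x -> m <= f x}.
Proof.
move=> fpos Oc; have [r r0 rO] := open_closed_ball_sub Oopen Oc.
exists r => //; have cB : compactly_inside (open_ball c r) Omega.
  split; last by apply: subset_trans rO; exact: closure_open_ball.
  apply: (subclosed_compact _ (@compact_closed_ball_e c r r0)); first exact: closed_closure.
  exact: closure_open_ball.
have := fpos c r r0 cB; rewrite /ess_inf_on => fp.
(* The essential infimum is an extended real; should it be infinite, [m = 1] will do. *)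
have [m m0 mf] : exists2 m : R, 0 < m & (m%:E <= ess_inf mu (patch (cst +oo%E) (open_ball c r) (EFin \o f)))%E.
  move: fp; case: (ess_inf _ _) => [a| |//]; last by exists 1; rewrite ?leey.
  by rewrite lte_fin => a0; exists a.
exists m => //; have /ess_infP := mf.
by apply: ae_imp => x + Bx; rewrite /patch mem_set//= lee_fin.
Qed.

Lemma compact_lower_bound f K : ball_ess_inf_pos Omega f -> compacts_in Omega K ->
  exists2 m : R, 0 < m & {ae mu, forall x, K x -> m <= f x}.
Proof.
move=> fpos [cK KO].
have /choice[rm rmP] : forall c, exists rm : R * R, Omega c ->
    [/\ 0 < rm.1, 0 < rm.2 & {ae mu, forall x, open_ball c rm.1 x -> rm.2 <= f x}].
  move=> c; have [Oc|nO] := pselect (Omega c); last by exists (0, 0) => /nO.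
  by have [r r0 [m m0 H]] := ball_ess_inf_pos_local fpos Oc; exists (r, m).
have [|s sK Ks] := compact_ball_cover (r := fun c => (rm c).1) cK; first by move=> c /KO /rmP[].
suff [m m0 H] : exists2 m : R, 0 < m & {ae mu, forall x, forall c, c \in s -> open_ball c (rm c).1 x -> m <= f x}.
  by exists m => //; apply: ae_imp H => x Hs /Ks[c /Hs].
elim: s sK {Ks} => [_|c s IH sK]; first by exists 1 => //; apply: ae_all.
have [|m m0 H] := IH; first by move=> c' c's; apply: sK; rewrite inE c's orbT.
have [_ p0] := rmP c (KO _ (sK c (mem_head _ _))).
exists (Num.min m (rm c).2); first by rewrite lt_min m0.
apply: ae_imp2 p H => x Hc Hs c'; rewrite inE ge_min => /orP[/eqP -> /Hc ->|/Hs h /h ->//].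
by rewrite orbT.
Qed.

Lemma ball_ess_inf_pos_ae f : ball_ess_inf_pos Omega f -> {ae mu, forall x, Omega x -> 0 < f x}.
Proof.
move=> fpos; apply: local_ae => c /(ball_ess_inf_pos_local fpos)[r r0 [m m0 H]].
by exists r => //; apply: ae_imp H => x + Bx => /(_ Bx); exact: lt_le_trans.
Qed.

End compact_exhaustion.

(** * Picone's inequality and supersolutions *)

Section picone_inequality.
Context {R : realType} {N : nat}.
Local Notation E := 'rV[R]_N.
Local Notation mu := (@lebesgue_rV R N).
Local Notation intg f := (mu.-integrable setT (EFin \o f)).
Local Notation itg f := (\int[mu]_x f x).
Local Notation e_ i := (delta_mx (ord0 : 'I_1) i : E).
Implicit Types (f g h k u v xi : E -> R) (K A D : set E) (x y c : E) (d e r : R).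

Definition smooth_kernel d k :=
  [/\ forall l, Ck l k, forall z, 0 <= k z, intg k, itg k = 1 &
      forall z, d <= `|z| -> k z = 0].

Lemma smooth_kernel_bounded_support d k : smooth_kernel d k -> bounded_support k.
Proof. by move=> [_ _ _ _ kd]; exists d => z /ltW; exact: kd. Qed.

Lemma smooth_kernel_bounded d k : smooth_kernel d k -> exists2 M : R, 0 <= M & forall z, `|k z| <= M.
Proof.
move=> sk; apply: continuous_bounded_support_bounded (smooth_kernel_bounded_support sk).
by case: sk => ck _ _ _ _; exact: Ck_continuous (ck 0%N).
Qed.

Lemma smooth_kernel_le d d' k : d <= d' -> smooth_kernel d k -> smooth_kernel d' k.
Proof. by move=> dd' [? ? ? ? kd]; split => // z d'z; apply: kd; exact: le_trans d'z. Qed.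

Lemma inv_shift_dist_le (a b d : R) : 0 <= a -> 0 <= b -> 0 < d ->
  `|(a + d)^-1 - (b + d)^-1| <= d^-1 ^+ 2 * `|a - b|.
Proof.
move=> a0 b0 d0; have ad : 0 < a + d by rewrite ltr_wpDl.
have bd : 0 < b + d by rewrite ltr_wpDl.
have -> : (a + d)^-1 - (b + d)^-1 = (a + d)^-1 * (b + d)^-1 * (b - a).
  by field; rewrite !gt_eqF.
rewrite normrM distrC ler_wpM2r// ger0_norm; last by rewrite mulr_ge0// invr_ge0 ltW.
by rewrite expr2; apply: ler_pM; rewrite ?invr_ge0 ?(ltW ad) ?(ltW bd)// lef_pV2 ?posrE// lerDr.
Qed.

Lemma inv_shift_le (a d : R) : 0 <= a -> 0 < d -> 0 < (a + d)^-1 <= d^-1.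
Proof.
move=> a0 d0; have ad : 0 < a + d by rewrite ltr_wpDl.
by rewrite invr_gt0 ad lef_pV2 ?posrE// lerDr.
Qed.

Lemma measurable_inv_shift v d : (forall x, 0 <= v x) -> 0 < d -> measurable_fun setT v ->
  measurable_fun setT (fun x => (v x + d)^-1).
Proof.
move=> v0 d0 mv.
(* Truncation at 0 makes the reciprocal a monotone function on the whole line, hence measurable. *)
rewrite (_ : (fun x => _) = (fun t : R => (Num.max t 0 + d)^-1) \o v); last first.
  by apply/funext => x /=; rewrite max_l.
have p (t : R) : 0 < Num.max t 0 + d by rewrite ltr_wpDl// le_max lexx orbT.
apply: measurableT_comp => //; apply: nonincreasing_measurable => // s t st.
by rewrite lef_pV2 ?posrE// lerD2r ge_max !le_max lexx st orbT.
Qed.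

Lemma conv_ge0 f k x : (forall y, 0 <= f y) -> (forall z, 0 <= k z) -> 0 <= conv f k x.
Proof. by move=> f0 k0; apply: itg_ge0 => y; rewrite mulr_ge0. Qed.

Lemma lipschitz_bs_quotient xi v d : lipschitz_bs xi -> lipschitz_bs v -> (forall x, 0 <= v x) -> 0 < d ->
  lipschitz_bs (fun x => xi x ^+ 2 * (v x + d)^-1).
Proof.
move=> lx [[k vk] _] v0 d0; have lx2 := lipschitz_bsM lx lx.
have [C _ xC] := lipschitz_bs_bounded lx2.
case: lx2 => -[kx xk] [M xM]; split; last by exists M => x /xM; rewrite -expr2 => ->; rewrite mul0r.
exists (C * (d^-1 ^+ 2 * k) + d^-1 * kx).
apply: (@bounded_lipschitzM R N (fun x => xi x ^+ 2) (fun x => (v x + d)^-1) C (d^-1) kx (d^-1 ^+ 2 * k)).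
- by move=> x; rewrite expr2.
- by move=> x; have /andP[p0 p1] := inv_shift_le (v0 x) d0; rewrite gtr0_norm.
- by move=> x y; rewrite !expr2.
- move=> x y; rewrite -mulrA; apply: le_trans (inv_shift_dist_le (v0 x) (v0 y) d0) _.
  by apply: ler_wpM2l => //; rewrite exprn_ge0// invr_ge0 ltW.
Qed.

(** For each [i] the difference of the two sides is the square of [partial i xi x - xi x * partial i
    v x / (v x + d)]. The derivative of the quotient [w] is obtained by differentiating the product
    [w * (v + d) = xi ^+ 2]. *)
Lemma picone_pointwise xi v d x : lipschitz_bs xi -> lipschitz_bs v -> (forall x, 0 <= v x) -> 0 < d ->
  (forall i, [/\ derivable xi x (e_ i), derivable v x (e_ i) &
     derivable (fun x => xi x ^+ 2 * (v x + d)^-1) x (e_ i)]) ->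
  grad_dot (fun x => xi x ^+ 2 * (v x + d)^-1) v x <= grad_dot xi xi x.
Proof.
move=> lx lv v0 d0 df; apply: ler_sum => i _; have [dx dv dw] := df i.
set w := (fun x => xi x ^+ 2 * (v x + d)^-1) in dw *.
have vd : 0 < v x + d by rewrite ltr_wpDl.
have dc : derivable (cst d : E -> R) x (e_ i) by exact: derivable_cst.
have dvd : derivable (fun x => v x + d) x (e_ i).
  by apply: (@derivableD _ E R v (cst d)).
have pvd : partial i (fun x => v x + d) x = partial i v x.
  rewrite (partialD dv dc).
  by rewrite {2}/partial (derive_cst (d : R)) addr0.
have H : w x * partial i v x + (v x + d) * partial i w x = 2 * (xi x * partial i xi x).
  rewrite -pvd -partialM//.
  rewrite (_ : (fun y => w y * (v y + d)) = (fun y => xi y * xi y)).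
    by rewrite partialM//; ring.
  by apply/funext => y; rewrite /w mulfVK ?expr2// gt_eqF// ltr_wpDl.
have -> : partial i w x = (2 * (xi x * partial i xi x) - w x * partial i v x) / (v x + d).
  by rewrite -H addrC addKr mulrC mulKf// gt_eqF.
rewrite -subr_ge0.
have -> : partial i xi x * partial i xi x -
    (2 * (xi x * partial i xi x) - w x * partial i v x) / (v x + d) * partial i v x =
    (partial i xi x - xi x * partial i v x / (v x + d)) ^+ 2.
  by rewrite /w; field; rewrite gt_eqF.
exact: sqr_ge0.
Qed.

(** The smooth equation is tested with [w] and the pointwise inequality integrated. The equation is
    asked only where [xi] does not vanish: a mollified solution satisfies it only away from the
    boundary of the set to which the solution was restricted. *)
Lemma picone_mollified u g k xi d e : intg u -> intg g -> (forall x, 0 <= u x) -> bounded_support u ->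
  smooth_kernel e k -> lipschitz_bs xi -> 0 < d ->
  (forall x, xi x != 0 -> laplacian (conv u k) x = - conv g k x) ->
  itg (fun x => xi x ^+ 2 * (conv u k x + d)^-1 * conv g k x) <= itg (grad_dot xi xi).
Proof.
move=> Iu Ig u0 su sk lx d0 lap; have bk := smooth_kernel_bounded_support sk.
have [ck k0 _ _ _] := sk; set v := conv u k; set w := fun x => xi x ^+ 2 * (v x + d)^-1.
have v0 x : 0 <= v x by exact: conv_ge0.
have cv l : Ck l v by exact: Ck_conv.
have sv : bounded_support v by exact: bounded_support_conv.
have lv : lipschitz_bs v by exact: C1_lipschitz_bs.
have lw : lipschitz_bs w by exact: lipschitz_bs_quotient.
have -> : itg (fun x => w x * conv g k x) = - itg (fun x => w x * laplacian v x).
  rewrite -[RHS]mulN1r -itgZ; last first.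
    have clap : continuous (laplacian v).
      by apply: (@Ck_continuous _ _ 0); apply: Ck_sum => i; apply: Ck_partial; apply: Ck_partial.
    have [C' _ vC'] := continuous_bounded_support_bounded clap (bounded_support_laplacian sv).
    apply: (intgM (M := C')) => //; first exact: lipschitz_bs_intg.
    exact: measurable_laplacian.
  apply: eq_Rintegral => x _; have [x0|/lap ->] := eqVneq (xi x) 0.
    by rewrite /w x0 expr0n/= !mul0r mulr0.
  by ring.
rewrite -(itg_grad_laplacian lw (cv 2) sv); apply: le_itg_ae; [exact: intg_grad_dot..|].
apply: ae_imp2 (lipschitz_bs_ae lx) (lipschitz_bs_ae lw) => x dx dw.
by apply: picone_pointwise => // i; split => //; exact: (@Ck_derivable R N 0 v x i (cv 1%N)).
Qed.

(* The excess of [`|g|] over a large constant; it makes the passage to the limit in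
   [picone] possible without extracting subsequences. *)
Lemma intg_truncation g e : intg g -> 0 < e -> exists2 A : R, 0 <= A & exists2 t : E -> R,
  intg t /\ itg t <= e & forall x, 0 <= t x /\ `|g x| <= A + t x.
Proof.
move=> Ig e0; pose t (n : nat) (x : E) := Num.max 0 (`|g x| - n%:R).
have mg := intg_measurable Ig.
have mt n : measurable_fun setT (t n).
  apply: measurable_maxr => //; apply: measurable_funB => //; exact: measurableT_comp.
have t0 n x : 0 <= t n x by rewrite /t le_max lexx.
have tg n x : `|t n x| <= `|g x|.
  by rewrite ger0_norm// /t ge_max normr_ge0/= gerBl.
have [||||_ /cvgrPdist_lt/(_ _ e0)[n _ /(_ n (leqnn n))/=]] := @itg_dct _ E R mu t (fun=> 0) (fun x => `|g x|) mt.
- exact: measurable_cst.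
- apply: ae_all => x; apply: cvg_near_cst; exists (Num.truncn `|g x|).+1 => // n /= nx.
  apply/max_idPl; rewrite subr_le0; apply: ltW; apply: lt_le_trans (truncnS_gt _) _.
  by rewrite ler_nat.
- exact: intg_norm.
- exact: tg.
rewrite itg0 sub0r normrN => /(le_lt_trans (ler_norm _))/ltW te.
exists n%:R => //; exists (t n); first by split => //; apply: le_intg (intg_norm Ig).
by move=> x; split => //; rewrite -lerBlDl le_max lexx orbT.
Qed.

Lemma picone u g xi r d : intg u -> intg g -> (forall x, 0 <= u x) -> bounded_support u ->
  bounded_support g -> lipschitz_bs xi -> 0 < r -> 0 < d ->
  (forall k, smooth_kernel r k -> forall x, xi x != 0 -> laplacian (conv u k) x = - conv g k x) ->
  itg (fun x => g x * (xi x ^+ 2 * (u x + d)^-1)) <= itg (grad_dot xi xi).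
Proof.
move=> Iu Ig u0 su sg lx r0 d0 lap.
have mu_ := intg_measurable Iu; have mg := intg_measurable Ig.
have lx2 := lipschitz_bsM lx lx; have [M M0 xM] := lipschitz_bs_bounded lx2.
have mx := lipschitz_bs_measurable lx.
have xM2 x : xi x ^+ 2 <= M by rewrite (le_trans (ler_norm _))// expr2.
have id0 : 0 <= d^-1 by rewrite invr_ge0 ltW.
have w_le v (v0 : forall x, 0 <= v x) x : `|xi x ^+ 2 * (v x + d)^-1| <= M * d^-1.
  have /andP[p0 p1] := inv_shift_le (v0 x) d0.
  rewrite normrM (ger0_norm (sqr_ge0 _)) (gtr0_norm p0).
  by apply: ler_pM; rewrite ?sqr_ge0 ?(ltW p0).
have m_w v : (forall x, 0 <= v x) -> measurable_fun setT v -> measurable_fun setT (fun x => xi x ^+ 2 * (v x + d)^-1).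
  move=> v0 mv; apply: measurable_funM; first exact: measurable_funX.
  exact: measurable_inv_shift.
apply/ler_addgt0Pr => eps eps0.
(* The error [eps] is shared equally between the excess [t] and the two mollification errors. The
   denominators are the coefficients with which their integrals enter that of [B], plus 1 to be
   positive. *)
have B0 : 0 < M * (d^-1 + d^-1) + 1 by rewrite ltr_wpDl// mulr_ge0// addr_ge0.
have [|A A0 [t [It tA] tP]] := @intg_truncation g (eps / 2 / (M * (d^-1 + d^-1) + 1)) Ig.
  by rewrite !divr_gt0.
have B1 : 0 < M * (d^-1 + A * d^-1 ^+ 2) + 1.
  by rewrite ltr_wpDl// mulr_ge0// addr_ge0// mulr_ge0// exprn_ge0.
set e := eps / 2 / (M * (d^-1 + A * d^-1 ^+ 2) + 1).
have e0 : 0 < e by rewrite !divr_gt0.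
have [du du0 duP] := conv_L1_close Iu e0.
have [dg dg0 dgP] := conv_L1_close Ig e0.
pose r' := Num.min r (Num.min du dg).
have r'0 : 0 < r' by rewrite !lt_min r0 du0.
have [k kP] := @mollifier R N _ r'0; have sk : smooth_kernel r' k by exact: kP.
have [Mk _ kMk] := smooth_kernel_bounded sk.
have bk := smooth_kernel_bounded_support sk.
have [ck k0 Ik Ik1 kd] := sk.
have rr : r' <= r by rewrite ge_min lexx.
have H := picone_mollified Iu Ig u0 su sk lx d0 (lap k (smooth_kernel_le rr sk)).
have lconv f : intg f -> bounded_support f -> lipschitz_bs (conv f k).
  by move=> If sf; apply: C1_lipschitz_bs; [exact: Ck_conv|exact: bounded_support_conv].
have Iconv f : intg f -> bounded_support f -> intg (conv f k).
  by move=> If sf; exact: lipschitz_bs_intg (lconv f If sf).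
have ru : r' <= du by rewrite !ge_min lexx orbT.
have rg : r' <= dg by rewrite !ge_min lexx !orbT.
have ckc : continuous k by exact: Ck_continuous (ck 0%N).
have cu : itg (fun x => `|conv u k x - u x|) <= e.
  by apply: duP ckc kMk k0 Ik Ik1 _ (Iconv _ Iu su) => z /(le_trans ru); exact: kd.
have cg : itg (fun x => `|conv g k x - g x|) <= e.
  by apply: dgP ckc kMk k0 Ik Ik1 _ (Iconv _ Ig sg) => z /(le_trans rg); exact: kd.
set v := conv u k in H cu *; set G := conv g k in H cg *.
have v0 x : 0 <= v x by exact: conv_ge0.
have mv : measurable_fun setT v := intg_measurable (Iconv _ Iu su).
have IwG : intg (fun x => xi x ^+ 2 * (v x + d)^-1 * G x).
  apply: eq_intg (intgM (Iconv _ Ig sg) (m_w _ v0 mv) (w_le _ v0)) => x; exact: mulrC.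
have Ivu : intg (fun x => `|v x - u x|) by apply: intg_norm; apply: intgB => //; exact: Iconv.
have IGg : intg (fun x => `|G x - g x|) by apply: intg_norm; apply: intgB => //; exact: Iconv.
(* The first term replaces [G] by [g] against a bounded factor; the second compares the two
   reciprocals on the part of [g] bounded by [A]; on the excess [t] the reciprocals are merely
   bounded by [d^-1]. *)
pose B x := M * d^-1 * `|G x - g x| + (M * A * d^-1 ^+ 2 * `|v x - u x| + M * (d^-1 + d^-1) * t x).
have IB : intg B by apply: intgD; [exact: intgZ|apply: intgD; exact: intgZ].
have pw x : g x * (xi x ^+ 2 * (u x + d)^-1) <= xi x ^+ 2 * (v x + d)^-1 * G x + B x.
  have -> : g x * (xi x ^+ 2 * (u x + d)^-1) = xi x ^+ 2 * (v x + d)^-1 * G x +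
      ((xi x ^+ 2 * (v x + d)^-1) * (g x - G x) + g x * (xi x ^+ 2 * ((u x + d)^-1 - (v x + d)^-1))).
    by ring.
  rewrite lerD2l; apply: lerD.
    rewrite (le_trans (ler_norm _))// normrM distrC ler_wpM2r//; exact: w_le.
  have [t0 gt] := tP x.
  set q := (u x + d)^-1 - (v x + d)^-1.
  have q1 : `|q| <= d^-1 ^+ 2 * `|v x - u x| by rewrite distrC; exact: inv_shift_dist_le.
  have q2 : `|q| <= d^-1 + d^-1.
    have /andP[pu pu1] := inv_shift_le (u0 x) d0; have /andP[pv pv1] := inv_shift_le (v0 x) d0.
    by rewrite (le_trans (ler_normB _ _))// lerD// gtr0_norm.
  apply: (@le_trans _ _ ((A + t x) * (M * `|q|))).
    rewrite (le_trans (ler_norm _))// normrM ler_pM// normrM ler_wpM2r// ger0_norm ?sqr_ge0//.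
  rewrite mulrDl; apply: lerD.
    rewrite (_ : M * A * d^-1 ^+ 2 * `|v x - u x| = A * (M * (d^-1 ^+ 2 * `|v x - u x|))); last by ring.
    by rewrite ler_wpM2l// ler_wpM2l.
  by rewrite mulrCA -mulrA [t x * _]mulrC; apply: ler_wpM2l => //; exact: ler_wpM2r.
have := le_itg (intgM Ig (m_w _ u0 mu_) (w_le _ u0)) (intgD IwG IB) pw.
rewrite itgD// => /le_trans; apply; apply: lerD => //.
rewrite /B itgD; [|exact: intgZ|by apply: intgD; exact: intgZ].
rewrite itgD; [|exact: intgZ..].
rewrite !itgZ//.
have b1 : M * d^-1 * itg (fun x => `|G x - g x|) <= M * d^-1 * e by rewrite ler_wpM2l// mulr_ge0.
have b2 : M * A * d^-1 ^+ 2 * itg (fun x => `|v x - u x|) <= M * A * d^-1 ^+ 2 * e.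
  by rewrite ler_wpM2l// !mulr_ge0// exprn_ge0.
have b3 : M * (d^-1 + d^-1) * itg t <= eps / 2.
  apply: (@le_trans _ _ (M * (d^-1 + d^-1) * (eps / 2 / (M * (d^-1 + d^-1) + 1)))).
    by rewrite ler_wpM2l// mulr_ge0// addr_ge0.
  by rewrite mulrA ler_pdivrMr// mulrC ler_wpM2l ?divr_ge0 ?(ltW eps0)// lerDl.
have b4 : M * d^-1 * e + M * A * d^-1 ^+ 2 * e <= eps / 2.
  rewrite -mulrDl -mulrA -mulrDr /e mulrA ler_pdivrMr// mulrC ler_wpM2l ?divr_ge0 ?(ltW eps0)//.
  by rewrite lerDl.
by rewrite [eps]splitr addrA; apply: lerD b3; apply: le_trans b4; apply: lerD.
Qed.

End picone_inequality.

(** * Energy inequality, positivity and local L^1 bounds from a nonnegative supersolution *)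

Section supersolutions.
Context {R : realType} {N : nat}.
Local Notation E := 'rV[R]_N.
Local Notation mu := (@lebesgue_rV R N).
Local Notation intg f := (mu.-integrable setT (EFin \o f)).
Local Notation itg f := (\int[mu]_x f x).
Variables (Omega : set E) (V u f : E -> R).
Hypothesis Oopen : open Omega.
Hypothesis VL : L1loc Omega V.
Hypothesis fL : L1loc Omega f.
Hypothesis sol : distributional_solution Omega V u f.
Hypothesis u_ge0 : {ae mu, forall x, Omega x -> 0 <= u x}.
Implicit Types (xi : W1inf_c Omega) (K : set E) (x y : E).

Let uL : L1loc Omega u. Proof. by case: sol. Qed.
Let VuL : L1loc Omega (fun x => V x * u x). Proof. by case: sol. Qed.

Lemma L1locB (g h : E -> R) : L1loc Omega g -> L1loc Omega h -> L1loc Omega (fun x => g x - h x).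
Proof.
move=> gL hL K cK; have mK : measurable K by apply: compact_measurable_rV; exact: cK.1.
exact: (integrableB mK (gL K cK) (hL K cK)).
Qed.

Lemma itg_restrict (g h : E -> R) K : (forall x, ~ K x -> h x = 0) ->
  itg (fun x => (g \_ K) x * h x) = itg (fun x => g x * h x).
Proof.
move=> h0; apply: eq_Rintegral => x _; rewrite patchE.
by case: ifPn => //; rewrite notin_setE => /h0 ->; rewrite !mulr0.
Qed.

(** The translate of [k] by [x] is supported in [K], so it is a test function and does not see the
    cutting of the data by [K], which makes them integrable. *)
Lemma conv_weak_solution k K x : compacts_in Omega K -> (forall l, Ck l k) -> bounded_support k ->
  (forall y, ~ K y -> k (y - x) = 0) ->
  laplacian (conv (u \_ K) k) x = - conv ((fun y => f y - V y * u y) \_ K) k x.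
Proof.
move=> cK ck bk kK; have [_ _ /(_ (fun y => k (y - x)))] := sol.
have gL : L1loc Omega (fun y => f y - V y * u y) by exact: L1locB.
rewrite laplacian_conv//; last exact: L1loc_restrict uL cK.
have clK : closed K by apply: closed_compact_rV; exact: cK.1.
have lapE y : laplacian (fun y => k (y - x)) y = laplacian k (y - x).
  apply: eq_bigr => i _.
  have -> : partial i (fun y => k (y - x)) = (fun y => partial i k (y - x)).
    by apply/funext => z; exact: partial_shift.
  exact: partial_shift.
have lap0 y : ~ K y -> laplacian k (y - x) = 0.
  move=> Ky; rewrite -lapE /laplacian big1// => i _.
  by apply: partial_eq0 Ky => // z Kz; apply: partial_eq0 Kz.
have [C _ kC] := continuous_bounded_support_bounded (Ck_continuous (ck 0%N)) bk.
have clap : continuous (laplacian k).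
  by apply: (@Ck_continuous _ _ 0); apply: Ck_sum => i; apply: Ck_partial; exact: Ck_partial.
have [C' _ kC'] := continuous_bounded_support_bounded clap (bounded_support_laplacian bk).
have mk : measurable_fun setT (fun y => k (y - x)).
  by apply: measurable_shift; apply: continuous_measurable_rV; exact: Ck_continuous (ck 0%N).
have ml : measurable_fun setT (fun y => laplacian k (y - x)).
  by apply: measurable_shift; exact: continuous_measurable_rV.
have I1 : intg (fun y => u y * laplacian k (y - x)) by exact: (L1loc_intg uL cK ml (fun z => kC' (z - x)) lap0).
have I2 : intg (fun y => V y * u y * k (y - x)) by exact: (L1loc_intg VuL cK mk (fun z => kC (z - x)) kK).
have I3 : intg (fun y => f y * k (y - x)) by exact: (L1loc_intg fL cK mk (fun z => kC (z - x)) kK).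
have -> : conv (u \_ K) (laplacian k) x = itg (fun y => u y * laplacian k (y - x)) by exact: itg_restrict.
have -> : conv ((fun y => f y - V y * u y) \_ K) k x =
    itg (fun y => f y * k (y - x)) - itg (fun y => V y * u y * k (y - x)).
  by rewrite /conv itg_restrict// -itgB//; apply: eq_Rintegral => y _; rewrite mulrBl.
rewrite itg_in; last first.
  move=> y Oy; have Ky : ~ K y by move=> /cK.2.
  by rewrite lapE lap0// kK// oppr0 mulr0 addr0 mulr0.
rewrite (@itg_in _ _ Omega (fun y => f y * k (y - x))); last by move=> y Oy; rewrite kK ?mulr0// => /cK.2.
have -> : itg (fun y => u y * (- laplacian (fun y => k (y - x)) y + V y * k (y - x))) =
    itg (fun y => V y * u y * k (y - x)) - itg (fun y => u y * laplacian k (y - x)).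
  by rewrite -itgB//; apply: eq_Rintegral => y _; rewrite lapE; ring.
have T : test_function Omega (fun y => k (y - x)) by split; [move=> l; exact: Ck_shift|exists K].
by move=> /(_ T) <-; rewrite opprB opprD opprK addrA subrr add0r.
Qed.

(** A representative of [u] that is measurable on the whole space and nonnegative at every point, so
    that the quotients by [U + d] are defined without exceptional sets. *)
Let U x := `|(u \_ Omega) x|.

Let U0 x : 0 <= U x. Proof. exact: normr_ge0. Qed.

Let mU : measurable_fun setT U.
Proof. by apply: measurableT_comp => //; exact: L1loc_measurable. Qed.

Let UE x : Omega x -> U x = `|u x|.
Proof. by move=> Ox; rewrite /U patchE mem_set. Qed.

Let Uu : {ae mu, forall x, Omega x -> U x = u x}.
Proof. by apply: ae_imp u_ge0 => x + Ox => /(_ Ox) u0; rewrite UE// ger0_norm. Qed.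

Let w xi (d : R) x := xi x ^+ 2 * (U x + d)^-1.

Let w_ge0 xi d x : 0 < d -> 0 <= w xi d x.
Proof. by move=> d0; rewrite mulr_ge0 ?sqr_ge0// invr_ge0 addr_ge0// ltW. Qed.

Let w_measurable xi d : 0 < d -> measurable_fun setT (w xi d).
Proof.
move=> d0; apply: measurable_funM; last exact: measurable_inv_shift.
by apply: measurable_funX; apply: lipschitz_bs_measurable; exact: W_lipschitz_bs.
Qed.

Let intg_w xi d g : 0 < d -> L1loc Omega g -> intg (fun x => g x * w xi d x).
Proof.
move=> d0 gL; have [K cK xK] := W_support xi.
have [C C0 xC] := lipschitz_bs_bounded (W_lipschitz_bs xi).
apply: (@L1loc_intg _ _ Omega _ _ K (C ^+ 2 * d^-1)) => //; first exact: w_measurable.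
  move=> x; have /andP[p0 p1] := inv_shift_le (U0 x) d0.
  rewrite normrM (gtr0_norm p0); apply: ler_pM; rewrite ?normr_ge0 ?(ltW p0)//.
  by rewrite normrX lerXn2r ?nnegrE.
by move=> x /xK x0; rewrite /w x0 expr0n mul0r.
Qed.

(** The compact [K'] contains all points within [e] of the support of [xi]. Kernels of radius [e]
    centred on this support therefore see only the data on [K'], and [picone] applies to the
    integrable restrictions. *)
Lemma supersolution_inequality xi d : 0 < d ->
  itg (fun x => (f x - V x * u x) * w xi d x) <= itg (grad_dot xi xi).
Proof.
move=> d0; have [K cK xK] := W_support xi.
have [e e0 [K' cK' KK']] := compact_neighborhood Oopen cK.
have [M K'M] := compact_bounded_norm cK'.1.
have sK' (g : E -> R) : bounded_support (g \_ K').
  exists M => x Mx; rewrite patchE; case: ifPn => //; rewrite inE => /K'M.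
  by rewrite leNgt Mx.
have gL : L1loc Omega (fun x => f x - V x * u x) by exact: L1locB.
have IuK : intg (u \_ K') by exact: L1loc_restrict uL cK'.
have IUK : intg (fun x => `|(u \_ K') x|) by exact: intg_norm.
have uK0 x : 0 <= `|(u \_ K') x| by exact: normr_ge0.
have suK : bounded_support (fun x => `|(u \_ K') x|).
  by have [M' h] := sK' u; exists M' => x /h ->; rewrite normr0.
have lap k : smooth_kernel e k -> forall x, xi x != 0 ->
    laplacian (conv (fun x => `|(u \_ K') x|) k) x = - conv ((fun y => f y - V y * u y) \_ K') k x.
  move=> sk x x0; have [ck _ _ _ kd] := sk; have bk := smooth_kernel_bounded_support sk.
  rewrite -(conv_weak_solution cK' ck bk); last first.
    move=> y K'y; apply: kd; rewrite leNgt; apply/negP => /ltW yx; apply: K'y.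
    by apply: KK' yx; apply: contrapT => /xK xx0; rewrite xx0 eqxx in x0.
  congr (laplacian _ x); apply/funext => z.
  have mk : measurable_fun setT (fun y => k (y - z)).
    by apply: measurable_shift; apply: continuous_measurable_rV; exact: Ck_continuous (ck 0%N).
  apply: itg_ae_eq.
  - by apply: measurable_funM => //; exact: intg_measurable IUK.
  - by apply: measurable_funM => //; exact: intg_measurable IuK.
  - apply: ae_imp u_ge0 => y u0; rewrite patchE; case: ifPn; last by rewrite normr0.
    by rewrite inE => /cK'.2 /u0 h; rewrite ger0_norm.
have := picone IUK (L1loc_restrict gL cK') uK0 suK (sK' _) (W_lipschitz_bs xi) e0 d0 lap.
congr (_ <= _); apply: eq_Rintegral => x _.
have [Kx|/xK x0] := pselect (K x); last by rewrite /w x0 expr0n !mul0r !mulr0.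
have K'x : K' x by apply: KK' Kx _; rewrite subrr normr0 ltW.
by rewrite !patchE !mem_set// /w UE//; exact: cK'.2.
Qed.

Let supersolution_f xi d : 0 < d ->
  itg (fun x => f x * w xi d x) <= itg (grad_dot xi xi) + itg (fun x => V x * u x * w xi d x).
Proof.
move=> d0; rewrite -lerBlDr -itgB; [|exact: intg_w..].
apply: le_trans (supersolution_inequality xi d0).
by rewrite le_eqVlt; apply/orP; left; apply/eqP; apply: eq_Rintegral => x _; rewrite mulrBl.
Qed.

(** Since [|u| <= U + d] on [Omega], the majorant is independent of [d]. *)
Let V_w_le xi d x : 0 < d -> `|V x * u x * w xi d x| <= `|V x * xi x ^+ 2|.
Proof.
move=> d0; have [Ox|/W_eq0 x0] := pselect (Omega x); last by rewrite /w x0 expr0n mul0r !mulr0.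
have Ud : 0 < U x + d by rewrite ltr_wpDl.
rewrite /w -mulrA normrM [leRHS]normrM ler_wpM2l// mulrCA normrM -[leRHS]mulr1 ler_wpM2l//.
rewrite normrM -UE// gtr0_norm ?invr_gt0// ler_pdivrMr// mul1r lerDl ltW//.
Qed.

Let intg_Vxi2 xi : intg (fun x => V x * xi x ^+ 2).
Proof. by apply: eq_intg (intg_VW VL xi xi) => x; rewrite expr2. Qed.

(** Where [u] vanishes, [xi ^+ 2 / (u + d)] is [xi ^+ 2 / d], while the energy inequality is bounded
    independently of [d]. Hence [f * xi ^+ 2] has integral 0 over that set, and [f] is positive,
    with [xi = 1] on the half ball. *)
Lemma supersolution_gt0 : ball_ess_inf_pos Omega f -> {ae mu, forall x, Omega x -> 0 < u x}.
Proof.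
move=> fpos; apply: local_ae => // c Oc; have [r r0 rO] := open_closed_ball_sub Oopen Oc.
have sB : compactly_supported Omega (plateau c r).
  exists (closed_ball_e c r) => [|x /negP]; first by split => //; exact: compact_closed_ball_e.
  by rewrite -ltNge => /ltW; apply: plateau_eq0; exact: ltW.
have bB : bounded_support (plateau c r).
  have [K [cK _] xK] := sB; have [M KM] := compact_bounded_norm cK.
  by exists M => x Mx; apply: xK => /KM; rewrite leNgt Mx.
pose xi : W1inf_c Omega := W1infC (mk_W (C1_lipschitz_bs (Ck_plateau 1 c r) bB) sB).
exists (r / 2); first by rewrite divr_gt0.
pose Z x : R := \1_[set x | U x = 0] x.
have mZ : measurable_fun setT Z.
  apply: measurable_indic; rewrite -[X in measurable X]setTI.
  exact: (mU measurableT (measurable_set1 0)).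
have If2 : intg (fun x => f x * (xi x ^+ 2 * Z x)).
  have [K cK xK] := W_support xi; have [C C0 xC] := lipschitz_bs_bounded (W_lipschitz_bs xi).
  apply: (@L1loc_intg _ _ Omega _ _ K (C ^+ 2)) => //.
  - apply: measurable_funM => //; apply: measurable_funX.
    by apply: lipschitz_bs_measurable; exact: W_lipschitz_bs.
  - move=> x; rewrite normrM -[leRHS]mulr1; apply: ler_pM => //.
      by rewrite normrX lerXn2r ?nnegrE.
    by rewrite /Z indicE; case: (_ \in _); rewrite ?normr1 ?normr0.
  - by move=> x /xK ->; rewrite expr0n mul0r.
set C := itg (grad_dot xi xi) + itg (fun x => `|V x * xi x ^+ 2|).
have fae := ball_ess_inf_pos_ae Oopen fpos.
(* The shift is [d = n.+1%:R^-1], and [Z] is the indicator of the zero set. *)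
have bound n : n.+1%:R * itg (fun x => f x * (xi x ^+ 2 * Z x)) <= C.
  have d0 : 0 < n.+1%:R^-1 :> R by rewrite invr_gt0.
  apply: (@le_trans _ _ (itg (fun x => f x * w xi n.+1%:R^-1 x))).
    rewrite -itgZ//; apply: le_itg_ae; [exact: intgZ|exact: intg_w|].
    apply: ae_imp fae => x f0; have [Ox|/W_eq0 x0] := pselect (Omega x); last first.
      by rewrite /w x0 expr0n !mul0r !mulr0.
    rewrite mulrCA; apply: ler_wpM2l; first by rewrite ltW// f0.
    rewrite mulrCA /w; apply: ler_wpM2l; first exact: sqr_ge0.
    rewrite /Z indicE; case: (boolP (x \in _)) => [|_]; last by rewrite mulr0 invr_ge0 addr_ge0// ltW.
    by rewrite inE /= => ->; rewrite add0r invrK mulr1.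
  apply: le_trans (supersolution_f xi d0) _; rewrite lerD2l.
  apply: le_itg; [exact: intg_w|by apply: intg_norm; exact: intg_Vxi2|].
  by move=> x; apply: le_trans (ler_norm _) _; exact: V_w_le.
have le0 : itg (fun x => f x * (xi x ^+ 2 * Z x)) <= 0.
  rewrite leNgt; apply/negP => I0.
  have := bound (Num.truncn (C / itg (fun x => f x * (xi x ^+ 2 * Z x)))).
  by rewrite leNgt -ltr_pdivrMr// truncnS_gt.
have ae0 : {ae mu, forall x, `|f x * (xi x ^+ 2 * Z x)| = 0}.
  apply: itg_le0_ae => //; first exact: intg_norm.
  apply: le_trans le0; rewrite le_eqVlt; apply/orP; left; apply/eqP; apply: itg_ae_eq.
  - by apply: measurableT_comp => //; exact: intg_measurable If2.
  - exact: intg_measurable If2.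
  - apply: ae_imp fae => x f0; have [Ox|/W_eq0 x0] := pselect (Omega x); last first.
      by rewrite x0 expr0n !mul0r !mulr0 normr0.
    rewrite ger0_norm//; apply: mulr_ge0; first by rewrite ltW// f0.
    by apply: mulr_ge0; [exact: sqr_ge0|rewrite /Z indicE; case: (_ \in _)].
apply: ae_imp (ae_imp2 (fun x => @conj _ _) (ae_imp2 (fun x => @conj _ _) ae0 fae) u_ge0) => x [[x0 f0] u0] Bx.
have Ox : Omega x.
  by apply: rO; move: Bx; rewrite /open_ball /closed_ball_e/=; lra.
rewrite lt_neqAle u0// andbT eq_sym; apply/eqP => ux0; move/normr0P: x0.
rewrite mulf_eq0 (gt_eqF (f0 Ox))/= plateau_eq1//; last exact: ltW.
by rewrite expr1n mul1r /Z indicE mem_set ?oner_eq0//= UE// ux0 normr0.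
Qed.

Hypothesis fpos : ball_ess_inf_pos Omega f.
Hypothesis Qpos : Q_nonneg Omega V.

Lemma supersolution_L1_bound K : compacts_in Omega K ->
  exists2 C : R, 0 <= C & forall xi, \int[mu]_(x in K) `|xi x| <= C * norm_L V xi.
Proof.
move=> cK; have mK : measurable K by apply: compact_measurable_rV; exact: cK.1.
have [c c0 fc] := compact_lower_bound Oopen fpos cK.
have I1K : intg (\1_K : E -> R) by apply: intg_indic => //; exact: compact_lty cK.1.
have IUK : intg (fun x => (U \_ K) x).
  apply: eq_intg (intg_norm (L1loc_restrict uL cK)) => x.
  rewrite !patchE; case: ifPn; last by rewrite normr0.
  by rewrite inE => /cK.2 Ox; rewrite UE.
have UK0 x : 0 <= (U \_ K) x by rewrite patchE; case: ifPn.
set A := c^-1 * itg (U \_ K).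
have A0 : 0 <= A by rewrite mulr_ge0 ?invr_ge0 ?(ltW c0)// itg_ge0.
exists (Num.sqrt A); first exact: sqrtr_ge0.
move=> xi; set X := \int[mu]_(x in K) _.
have lx := W_lipschitz_bs xi; have mx := lipschitz_bs_measurable lx.
have XE : X = itg (fun x => `|xi x| * \1_K x).
  rewrite /X Rintegral_mkcond; apply: eq_Rintegral => x _.
  by rewrite patchE indicE; case: ifPn; rewrite ?mulr1 ?mulr0.
have IX : intg (fun x => `|xi x| * \1_K x).
  apply: (intgM (M := 1)); first by apply: intg_norm; exact: lipschitz_bs_intg.
    exact: measurable_indic.
  by move=> x; rewrite indicE; case: (_ \in _); rewrite ?normr1 ?normr0.
have X0 : 0 <= X by rewrite XE; apply: itg_ge0 => x; rewrite mulr_ge0.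
have fae := ball_ess_inf_pos_ae Oopen fpos; have uae := supersolution_gt0 fpos.
pose d n : R := n.+1%:R^-1; have d0 n : 0 < d n by rewrite invr_gt0.
(* The pointwise limit relies on the positivity of [u] just established. *)
have cI : (fun n => itg (fun x => V x * u x * w xi (d n) x)) @ \oo --> itg (fun x => V x * xi x ^+ 2).
  have [|||||_ h] := @itg_dct _ _ _ mu (fun n x => V x * u x * w xi (d n) x) (fun x => V x * xi x ^+ 2) (fun x => `|V x * xi x ^+ 2|); last exact: h.
  - by move=> n; apply: intg_measurable; exact: intg_w.
  - by apply: intg_measurable; exact: intg_Vxi2.
  - apply: ae_imp2 uae Uu => x u0 Ux.
    have [Ox|/W_eq0 x0] := pselect (Omega x); last first.
      by rewrite /w x0 expr0n/= mulr0; apply: cvg_near_cst; apply: nearW => n; rewrite mul0r mulr0.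
    have U1 : 0 < U x by rewrite Ux// u0.
    rewrite (_ : V x * xi x ^+ 2 = V x * u x * (xi x ^+ 2 * (U x + 0)^-1)); last first.
      by rewrite addr0 -Ux//; field; rewrite gt_eqF.
    apply: cvgM; first exact: cvg_cst.
    apply: cvgM; first exact: cvg_cst.
    apply: cvgV; first by rewrite addr0 gt_eqF.
    by apply: cvgD; [exact: cvg_cst|exact: cvg_harmonic].
  - by apply: intg_norm; exact: intg_Vxi2.
  - by move=> n x; exact: V_w_le.
(* Multiplied by [2 * t], the pointwise inequality on [K] is polynomial in [t], and the difference
   of its sides, with [f] replaced by its lower bound [c], is a positive factor times a square. *)
have pt (t : R) n : 0 < t -> 2 * t * X <=
    t ^+ 2 * (itg (grad_dot xi xi) + itg (fun x => V x * u x * w xi (d n) x)) +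
    c^-1 * (itg (U \_ K) + d n * itg (\1_K : E -> R)).
  move=> t0.
  have step : itg (fun x => 2 * t * (`|xi x| * \1_K x)) <=
     itg (fun x => t ^+ 2 * (f x * w xi (d n) x) + c^-1 * ((U \_ K) x + d n * \1_K x)).
    apply: le_itg_ae; first exact: intgZ.
      apply: intgD; first by apply: intgZ; exact: intg_w.
      by apply: intgZ; apply: intgD => //; exact: intgZ.
    apply: ae_imp2 fae fc => x f0 fc.
    have Ud : 0 < U x + d n by rewrite ltr_wpDl.
    have [Kx|nK] := pselect (K x); last first.
      rewrite patchE indicE memNset// !mulr0 addr0 mulr0 addr0.
      have [Ox|/W_eq0 x0] := pselect (Omega x); last by rewrite /w x0 expr0n !mul0r !mulr0.
      apply: mulr_ge0; first exact: sqr_ge0.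
      by apply: mulr_ge0; [rewrite ltW// f0|exact: w_ge0].
    rewrite patchE indicE mem_set// !mulr1.
    apply: (@le_trans _ _ (t ^+ 2 * (c * w xi (d n) x) + c^-1 * (U x + d n))); last first.
      rewrite lerD2r ler_wpM2l ?sqr_ge0// ler_wpM2r ?fc//.
      exact: w_ge0.
    rewrite /w -subr_ge0 -(real_normK (num_real (xi x))).
    rewrite (_ : _ - _ = c^-1 * (U x + d n)^-1 * (c * t * `|xi x| - (U x + d n)) ^+ 2); last first.
      by field; rewrite !gt_eqF.
    apply: mulr_ge0; last exact: sqr_ge0.
    by apply: mulr_ge0; rewrite invr_ge0 ltW.
  rewrite itgZ// in step; rewrite XE; apply: le_trans step _.
  rewrite itgD; last 2 first.
  - by apply: intgZ; exact: intg_w.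
  - by apply: intgZ; apply: intgD => //; exact: intgZ.
  rewrite itgZ; last exact: intg_w.
  rewrite itgZ; last by apply: intgD => //; exact: intgZ.
  rewrite (itgD IUK (intgZ (d n) I1K)) (itgZ (d n) I1K) lerD2r ler_wpM2l ?sqr_ge0//.
  exact: supersolution_f.
have lim (t : R) : 0 < t -> 2 * t * X <= t ^+ 2 * Q_form V xi xi + A.
  move=> t0.
  have c2 : (fun n => t ^+ 2 * (itg (grad_dot xi xi) + itg (fun x => V x * u x * w xi (d n) x)) +
    c^-1 * (itg (U \_ K) + d n * itg (\1_K : E -> R))) @ \oo -->
    t ^+ 2 * (itg (grad_dot xi xi) + itg (fun x => V x * xi x ^+ 2)) +
    c^-1 * (itg (U \_ K) + 0 * itg (\1_K : E -> R)).
    apply: cvgD; apply: cvgM; try exact: cvg_cst.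
      by apply: cvgD => //; exact: cvg_cst.
    apply: cvgD; first exact: cvg_cst.
    by apply: cvgM; [exact: cvg_harmonic|exact: cvg_cst].
  have : 2 * t * X <= t ^+ 2 * (itg (grad_dot xi xi) + itg (fun x => V x * xi x ^+ 2)) +
      c^-1 * (itg (U \_ K) + 0 * itg (\1_K : E -> R)).
    by apply: (ler_cvg_to (cvg_cst (2 * t * X)) c2); apply: nearW => n; exact: pt.
  by rewrite mul0r addr0 Q_formE.
have Q0 : 0 <= Q_form V xi xi by exact: Q_form_ge0.
rewrite norm_L_form// -sqrtrM// -(ger0_norm X0) -sqrtr_sqr; apply: ler_wsqrtr.
(* Optimizing over [t] amounts to a discriminant condition. For nonpositive [t] every term of the
   quadratic polynomial is nonnegative. *)
rewrite mulrC -(sqrrN X); apply: quadratic_ge0_discriminant => // t.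
have [t0|t0] := ltP 0 t; first by have := lim t t0; lra.
rewrite addr_ge0// addr_ge0//; first by rewrite mulr_ge0 ?sqr_ge0.
by rewrite -mulrA mulr_ge0// mulr_le0// oppr_le0.
Qed.

End supersolutions.

Section subcriticality.
Context {R : realType} {N : nat}.
Local Notation E := 'rV[R]_N.
Local Notation mu := (@lebesgue_rV R N).
Variables (Omega : set E) (V : E -> R).

Lemma L1_bound_subcritical : Q_nonneg Omega V ->
  (forall K, compacts_in Omega K -> exists2 C : R, 0 <= C &
    forall xi : W1inf_c Omega, \int[mu]_(x in K) `|xi x| <= C * norm_L V xi) ->
  L1_subcritical Omega V.
Proof.
move=> Qpos bound; split => // xi0 K /bound[C C0 CP].
move=> A /nbhs_ballP[e /= e0 eA]; exists (e / (C + 1)) => /=; first by rewrite divr_gt0// ltr_wpDl.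
move=> xi /= xid; apply: eA; rewrite -ball_normE /ball_/=; rewrite sub0r normrN ger0_norm; last by apply: Rintegral_ge0.
have := CP (xi - xi0); move=> /le_lt_trans; apply.
rewrite ltr_pdivlMr ?ltr_wpDl// mulrC in xid; apply: le_lt_trans xid.
by rewrite ler_wpM2r ?sqrtr_ge0// lerDl.
Qed.

End subcriticality.

(** * Extensions to completions *)

Section functionals_on_completions.
Context {R : realType}.

Lemma le0_eps (r C : R) : 0 <= C -> (forall e : R, 0 < e -> r <= C * e) -> r <= 0.
Proof.
move=> C0 H; apply/ler_addgt0Pr => e e0; rewrite add0r.
have C1 : 0 < C + 1 by rewrite ltr_wpDl.
apply: le_trans (H (e / (C + 1)) _) _; first by rewrite divr_gt0.
by rewrite mulrA ler_pdivrMr// mulrC ler_wpM2l ?(ltW e0)// lerDl.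
Qed.

Section functional.
Context {W : lmodType R} (p : W -> R).
Local Notation iota := (to_completion p).

Lemma to_completion_dist (x y : W) : `|iota x - iota y| = snorm p (x - y).
Proof. by rewrite -linearB to_completion_norm. Qed.

(* The value at [u] is the least upper bound of the [l x - C * `|u - iota x|],
   which lies below all the [l x + C * `|u - iota x|]. *)
Lemma functional_extension (l : W -> R) (C : R) : 0 <= C ->
  (forall a x y, l (a *: x + y) = a * l x + l y) -> (forall x, `|l x| <= C * snorm p x) ->
  exists L : completion p -> R, [/\ forall a u v, L (a *: u + v) = a * L u + L v,
    forall x, L (iota x) = l x & forall u, `|L u| <= C * `|u|].
Proof.
move=> C0 llin lC.
have lB x y : l x - l y = l (x - y) by rewrite [x - y]addrC -(scaleN1r y) llin; ring.
have l0 : l 0 = 0 by rewrite -(subrr 0) -lB subrr.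
have lle u x y : l x - C * `|u - iota x| <= l y + C * `|u - iota y|.
  rewrite -subr_ge0; have := le_trans (ler_norm _) (lC (x - y)).
  rewrite -lB -to_completion_dist => h.
  have : C * `|iota x - iota y| <= C * (`|u - iota x| + `|u - iota y|).
    by rewrite ler_wpM2l// (le_trans (ler_distD u _ _))// lerD// distrC.
  by rewrite mulrDr; lra.
pose S u : set R := [set l x - C * `|u - iota x| | x in setT].
pose L u := sup (S u).
have hS u : has_sup (S u).
  split; first by exists (l 0 - C * `|u - iota 0|); exists 0.
  by exists (l 0 + C * `|u - iota 0|) => _ [x _ <-]; exact: lle.
(* This estimate contains everything: linearity, the values on [W] and the bound all follow by
   approximating with elements of [W]. *)
have LP u x : `|L u - l x| <= C * `|u - iota x|.
  rewrite ler_norml; apply/andP; split.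
    have : l x - C * `|u - iota x| <= L u by apply: ub_le_sup; [case: (hS u)|exists x].
    by lra.
  have : L u <= l x + C * `|u - iota x|.
    by apply: ge_sup; [case: (hS u)|move=> _ [y _ <-]; exact: lle].
  by lra.
have Lu u : `|L u| <= C * `|u|.
  have i0 : iota 0 = 0 by exact: linear0.
  by have := LP u 0; rewrite l0 i0 !subr0.
exists L; split => // [a u v|x]; last first.
  have := LP (iota x) x; rewrite subrr normr0 mulr0 normr_le0 subr_eq0.
  by move=> /eqP.
apply/eqP; rewrite -subr_eq0 -normr_le0.
apply: (@le0_eps _ (C * (`|a| + 1) *+ 2)).
  by rewrite mulrn_wge0// mulr_ge0// addr_ge0.
move=> e e0; have [x xe] := to_completion_dense u e0; have [y ye] := to_completion_dense v e0.
have -> : L (a *: u + v) - (a * L u + L v) = (L (a *: u + v) - l (a *: x + y)) -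
    (a * (L u - l x) + (L v - l y)) by rewrite llin; ring.
have n1 : `|a *: u + v - iota (a *: x + y)| <= (`|a| + 1) * e.
  rewrite linearP opprD addrACA -scalerBr (le_trans (ler_normD _ _))// mulrDl mul1r.
  by rewrite normrZ lerD ?ler_wpM2l// ltW.
have n2 : C * `|a *: u + v - iota (a *: x + y)| <= C * ((`|a| + 1) * e) by rewrite ler_wpM2l.
have n3 : `|a * (L u - l x)| <= `|a| * (C * e).
  by rewrite normrM ler_wpM2l// (le_trans (LP _ _))// ler_wpM2l// ltW.
have n4 : `|L v - l y| <= C * e by rewrite (le_trans (LP _ _))// ler_wpM2l// ltW.
rewrite (le_trans (ler_normB _ _))// mulr2n mulrDl lerD//.
  by rewrite -mulrA; exact: le_trans (LP _ _) n2.
by rewrite (le_trans (ler_normD _ _))// (_ : _ * e = `|a| * (C * e) + C * e) ?lerD//; ring.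
Qed.

Lemma eq_on_dense (L : completion p -> R) (C : R) : 0 <= C ->
  (forall a u v, L (a *: u + v) = a * L u + L v) ->
  (forall u, `|L u| <= C * `|u|) -> (forall x, L (iota x) = 0) -> forall u, L u = 0.
Proof.
move=> C0 Llin LC L0 u; apply/eqP; rewrite -normr_le0; apply: (le0_eps C0) => e e0.
have [x xe] := to_completion_dense u e0.
have -> : L u = L (u - iota x).
  by rewrite addrC -scaleN1r Llin L0 mulr0 add0r.
by rewrite (le_trans (LC _))// ler_wpM2l// ltW.
Qed.

Lemma cclass_cvg (s : cseq p) : (fun n => `|cclass s - iota (s n)|) @ \oo --> (0 : R).
Proof.
apply/cvgrPdist_lt => e e0.
have e2 : 0 < e / 2 by rewrite divr_gt0.
have [n0 H] := cseqP s e2; exists n0 => // n /= n0n.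
rewrite sub0r normrN normr_id.
apply: (@le_lt_trans _ _ (e / 2)); last lra.
rewrite /to_completion -cclassN -cclassD norm_cclass.
apply: (ler_cvg_to (@cclass_norm _ _ _ (s - CSeq (cst_cseq_subproof p (s n)))) (cvg_cst _)).
by exists n0 => // m /= n0m; apply/ltW/H.
Qed.

Lemma bounded_linear_continuous (L : completion p -> R) (C : R) : 0 <= C ->
  (forall a u v, L (a *: u + v) = a * L u + L v) ->
  (forall u, `|L u| <= C * `|u|) -> continuous L.
Proof.
move=> C0 Llin LC u A /nbhs_ballP[e /= e0 eA]; apply/nbhs_ballP.
have C1 : 0 < C + 1 by rewrite ltr_wpDl.
exists (e / (C + 1)) => /=; first by rewrite divr_gt0.
move=> v; rewrite -ball_normE /ball_/= ltr_pdivlMr// => uv.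
apply: eA; rewrite -ball_normE /ball_/=.
have -> : L u - L v = L (u - v) by rewrite [u - v]addrC -(scaleN1r v) Llin mulN1r addrC.
apply: le_lt_trans (LC _) _; apply: le_lt_trans uv; rewrite mulrC ler_wpM2l//.
by rewrite lerDl.
Qed.

End functional.

(** The extension is made in the first variable for fixed [y], then in the second. At each stage
    linearity in the other variable survives because it holds on a dense subspace. *)
Lemma bilinear_extension (W1 W2 : lmodType R) (p1 : W1 -> R) (p2 : W2 -> R) (b : W1 -> W2 -> R) (C : R) :
  0 <= C -> (forall a x x' y, b (a *: x + x') y = a * b x y + b x' y) ->
  (forall a x y y', b x (a *: y + y') = a * b x y + b x y') ->
  (forall x y, `|b x y| <= C * snorm p1 x * snorm p2 y) ->
  exists bb : completion p1 -> completion p2 -> R,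
  [/\ forall a u u' v, bb (a *: u + u') v = a * bb u v + bb u' v,
      forall a u v v', bb u (a *: v + v') = a * bb u v + bb u v',
      forall x y, bb (to_completion p1 x) (to_completion p2 y) = b x y &
      forall u v, `|bb u v| <= C * `|u| * `|v|].
Proof.
move=> C0 bl br bC.
have Cy y : 0 <= C * snorm p2 y by rewrite mulr_ge0// snorm_ge0.
have /choice[L LP] : forall y, exists L : completion p1 -> R,
    [/\ forall a u v, L (a *: u + v) = a * L u + L v,
    forall x, L (to_completion p1 x) = b x y & forall u, `|L u| <= C * snorm p2 y * `|u|].
  move=> y; apply: functional_extension => // x.
  by rewrite mulrAC; exact: bC.
have Llin u a y y' : L (a *: y + y') u = a * L y u + L y' u.
  apply/eqP; rewrite -subr_eq0; apply/eqP.
  have [l1 e1 c1] := LP (a *: y + y'); have [l2 e2 c2] := LP y; have [l3 e3 c3] := LP y'.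
  apply: (@eq_on_dense _ p1 (fun u => L (a *: y + y') u - (a * L y u + L y' u))
     (C * snorm p2 (a *: y + y') + (`|a| * (C * snorm p2 y) + C * snorm p2 y'))).
  - by rewrite !addr_ge0// mulr_ge0.
  - by move=> a' v v'; rewrite l1 l2 l3; ring.
  - move=> v; rewrite (le_trans (ler_normB _ _))// mulrDl lerD//.
    by rewrite (le_trans (ler_normD _ _))// mulrDl lerD// normrM -mulrA ler_wpM2l.
  - by move=> x; rewrite e1 e2 e3 br subrr.
have Cu (u : completion p1) : 0 <= C * `|u| by rewrite mulr_ge0.
have /choice[bb bbP] : forall u, exists bb : completion p2 -> R,
    [/\ forall a v v', bb (a *: v + v') = a * bb v + bb v',
    forall y, bb (to_completion p2 y) = L y u & forall v, `|bb v| <= C * `|u| * `|v|].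
  move=> u; apply: functional_extension => // y.
  by rewrite mulrAC; have [_ _] := LP y; exact.
exists bb; split.
- move=> a u u' v; apply/eqP; rewrite -subr_eq0; apply/eqP.
  have [l1 e1 c1] := bbP (a *: u + u'); have [l2 e2 c2] := bbP u; have [l3 e3 c3] := bbP u'.
  apply: (@eq_on_dense _ p2 (fun v => bb (a *: u + u') v - (a * bb u v + bb u' v))
     (C * `|a *: u + u'| + (`|a| * (C * `|u|) + C * `|u'|))).
  + by rewrite !addr_ge0// mulr_ge0.
  + by move=> a' w w'; rewrite l1 l2 l3; ring.
  + move=> w; rewrite (le_trans (ler_normB _ _))// mulrDl lerD//.
    by rewrite (le_trans (ler_normD _ _))// mulrDl lerD// normrM -mulrA ler_wpM2l.
  + by move=> y; rewrite e1 e2 e3; have [-> _ _] := LP y; rewrite subrr.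
- by move=> a u v v'; have [] := bbP u.
- by move=> x y; have [_ -> _] := bbP (to_completion p1 x); have [_ -> _] := LP y.
- by move=> u v; have [_ _] := bbP u; exact.
Qed.

End functionals_on_completions.

Section functions_from_completions.
Context {R : realType} {N : nat}.
Local Notation E := 'rV[R]_N.
Local Notation mu := (@lebesgue_rV R N).
Local Notation intg f := (mu.-integrable setT (EFin \o f)).
Local Notation itg f := (\int[mu]_x f x).
Variables (Omega : set E) (p : W1inf_c Omega -> R) (om : E -> R) (M C : R).
Local Notation iota := (to_completion p).
Hypotheses (mom : measurable_fun setT om) (om0 : forall x, 0 <= om x) (omM : forall x, om x <= M).
Hypothesis C0 : 0 <= C.
Hypothesis omC : forall xi : W1inf_c Omega, itg (fun x => om x * `|xi x|) <= C * snorm p xi.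
Implicit Types (xi eta : W1inf_c Omega) (u v : completion p).

Let mW xi : measurable_fun setT xi.
Proof. by apply: lipschitz_bs_measurable; exact: W_lipschitz_bs. Qed.

Let Iom xi : intg (fun x => om x * `|xi x|).
Proof.
apply: eq_intg (intgM (M := M) (intg_norm (lipschitz_bs_intg (W_lipschitz_bs xi))) mom _) => x.
  by rewrite mulrC.
by rewrite ger0_norm.
Qed.

Let omB xi eta : itg (fun x => om x * `|xi x - eta x|) <= C * `|iota xi - iota eta|.
Proof. by rewrite to_completion_dist; exact: (omC (xi - eta)). Qed.

(* If [`|u - iota (w k)| < 2 ^- k], then [\sum_k om * `|w k.+1 - w k|] is integrable,
   hence [w k] converges almost everywhere on [0 < om]; it is dominated by this sum. *)
Lemma rapid_limit u : exists g : E -> R, measurable_fun setT g /\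
  forall xi, intg (fun x => om x * `|g x - xi x|) /\
    itg (fun x => om x * `|g x - xi x|) <= C * `|u - iota xi|.
Proof.
have e0 k : 0 < 2^-1 ^+ k :> R by rewrite exprn_gt0// invr_gt0.
have /choice[w wu] k := to_completion_dense u (e0 k).
pose s k x := om x * `|w k.+1 x - w k x|.
have s0 k x : 0 <= s k x by rewrite mulr_ge0.
have Is k : intg (s k) by exact: (Iom (w k.+1 - w k)).
have is_ k : itg (s k) <= C * 2 * 2^-1 ^+ k.
  apply: le_trans (omB _ _) _; rewrite -mulrA ler_wpM2l// (le_trans (ler_distD u _ _))//.
  have h1 := ltW (wu k.+1); have h2 := ltW (wu k).
  have h3 : 2^-1 ^+ k.+1 <= 2^-1 ^+ k :> R by rewrite exprS ler_piMl ?ltW// invf_lt1// ltr1n.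
  by rewrite distrC mulr_natl mulr2n; lra.
pose S x : \bar R := (\sum_(0 <= k <oo) (s k x)%:E)%E.
have mS : measurable_fun setT S.
  by apply: ge0_emeasurable_sum => [k x _ _|k _]; [rewrite lee_fin|exact/measurable_EFinP/intg_measurable].
have S0 x : (0 <= S x)%E by apply: nneseries_ge0 => k _ _; rewrite lee_fin.
have IS : (\int[mu]_x S x < +oo)%E.
  rewrite /S integral_nneseries//; last 2 first.
  - by move=> k; exact/measurable_EFinP/intg_measurable.
  - by move=> k x _; rewrite lee_fin.
  apply: (@le_lt_trans _ _ (C * 2 * 2)%:E); last exact: ltry.
  apply: lime_le; first by apply: is_cvg_nneseries => k _ _; apply: integral_ge0 => x _; rewrite lee_fin.
  apply: nearW => n; rewrite (eq_bigr (fun k => (itg (s k))%:E)); last by move=> k _; rewrite itgE.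
  rewrite sumEFin lee_fin; apply: (@le_trans _ _ (C * 2 * \sum_(0 <= k < n) 2^-1 ^+ k)).
    by rewrite mulr_sumr; apply: ler_sum => k _; exact: is_.
  apply: ler_wpM2l; first by rewrite mulr_ge0.
  suff -> : \sum_(0 <= k < n) 2^-1 ^+ k = 2 - 2 * 2^-1 ^+ n :> R.
    by rewrite lerBlDr lerDl mulr_ge0// exprn_ge0// invr_ge0.
  elim: n => [|n IH]; first by rewrite big_nil expr0; ring.
  by rewrite big_nat_recr//= IH exprS; field.
have IfS : intg (fine \o S).
  have mfS : measurable_fun setT (fine \o S) by apply: measurableT_comp => //; exact: fine_measurable.
  apply/integrableP; split; first exact/measurable_EFinP.
  apply: le_lt_trans IS; apply: ge0_le_integral => //.
  - by apply: measurableT_comp => //; exact/measurable_EFinP.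
  - by move=> x _ /=; case: (S x) (S0 x) => [r|//|//] /=; rewrite ?lee_fin => r0; rewrite ?ger0_norm// ?normr0 ?leey.
have aeS : {ae mu, forall x, S x \is a fin_num}.
  have IeS : mu.-integrable setT S.
    by apply/integrableP; split => //; under eq_integral do rewrite gee0_abs//.
  by apply: ae_imp (integrable_ae measurableT IeS) => x /(_ I).
pose A := [set x | S x \is a fin_num] `&` [set x | 0 < om x].
have mA : measurable A.
  apply: measurableI; first by rewrite -[X in measurable X]setTI; apply: emeasurable_fin_num.
  rewrite (_ : [set x | _] = om @^-1` `]0, +oo[%classic); last by apply/seteqP; split => x /=; rewrite in_itv/= andbT.
  by rewrite -[X in measurable X]setTI; exact: mom.
have partS n x : A x -> \sum_(0 <= k < n) s k x <= fine (S x).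
  move=> [Sx _]; rewrite -lee_fin fineK// -sumEFin.
  by apply: (@nneseries_lim_ge R (fun k => (s k x)%:E) xpredT 0%N n) => k _ _; rewrite lee_fin.
have telew n x : w n x = w 0 x + \sum_(0 <= k < n) (w k.+1 x - w k x) by rewrite telescope_sumr// addrC subrK.
have cw x : A x -> cvgn (fun n => w n x).
  move=> Ax; have [_ om1] := Ax.
  rewrite (_ : (fun n => w n x) = (fun n => w 0 x + series (fun k => w k.+1 x - w k x) n)); last first.
    by apply/funext => n; rewrite telew.
  apply: is_cvgD; first exact: is_cvg_cst.
  apply: normed_cvg; apply: nondecreasing_is_cvgn.
    apply/nondecreasing_seqP => n.
    change (\sum_(0 <= k < n) `|w k.+1 x - w k x| <= \sum_(0 <= k < n.+1) `|w k.+1 x - w k x|).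
    by rewrite big_nat_recr//= lerDl.
  exists ((om x)^-1 * fine (S x)) => _ [n _ <-].
  rewrite mulrC ler_pdivlMr// mulrC /series/= mulr_sumr; exact: partS.
(* Cutting by [A] makes the sequence converge at every point. Nothing is lost for the weighted
   integrals: off [A], either [om] vanishes or [x] is in the null set where [S] is infinite. *)
pose h n x := \1_A x * w n x.
have mh n : measurable_fun setT (h n) by apply: measurable_funM => //; exact: measurable_indic.
pose g x := limn (h^~ x).
have hg x : h^~ x @ \oo --> g x.
  rewrite /g /h indicE; case: (boolP (x \in A)) => [|_]; last first.
    rewrite (_ : (fun n => _) = (fun=> 0)); first exact: is_cvg_cst.
    by apply/funext => n; rewrite mul0r.
  rewrite inE => /cw cwx; rewrite (_ : (fun n => _) = (fun n => w n x))//.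
  by apply/funext => n; rewrite mul1r.
have mg : measurable_fun setT g by apply: measurable_fun_cvg => // x _; exact: hg.
exists g; split => // xi.
have omA x : S x \is a fin_num -> \1_A x != 1 :> R -> om x = 0.
  move=> Sx; rewrite indicE; case: (boolP (x \in A)); first by rewrite eqxx.
  rewrite notin_setE => nA _; apply/eqP; rewrite eq_le om0 andbT leNgt; apply/negP => ox.
  by apply: nA; split.
pose F n x := om x * `|h n x - \1_A x * xi x|.
pose G x := om x * `|g x - \1_A x * xi x|.
have mF n : measurable_fun setT (F n).
  apply: measurable_funM => //; apply: measurableT_comp => //; apply: measurable_funB => //.
  by apply: measurable_funM => //; exact: measurable_indic.
have mG : measurable_fun setT G.
  apply: measurable_funM => //; apply: measurableT_comp => //; apply: measurable_funB => //.
  by apply: measurable_funM => //; exact: measurable_indic.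
have [|||IG cF] := @itg_dct _ _ _ mu F G (fun x => om x * `|w 0 x - xi x| + fine (S x)) mF mG.
- apply: ae_all => x; apply: cvgM; first exact: cvg_cst.
  by apply: cvg_norm; apply: cvgB; [exact: hg|exact: cvg_cst].
- by apply: intgD => //; exact: (Iom (w 0 - xi)).
- move=> n x; have fS0 : 0 <= fine (S x) by apply: fine_ge0.
  rewrite ger0_norm ?mulr_ge0// /F /h -mulrBr indicE; case: (boolP (x \in A)); last first.
    by rewrite mul0r normr0 mulr0 addr_ge0// mulr_ge0.
  rewrite inE mul1r => Ax; apply: le_trans (lerD (lexx _) (partS n x Ax)).
  rewrite /s -mulr_sumr -mulrDr ler_wpM2l// telew addrAC (le_trans (ler_normD _ _))//.
  by rewrite lerD//; exact: ler_norm_sum.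
have gG x : S x \is a fin_num -> om x * `|g x - xi x| = G x.
  move=> Sx; rewrite /G; have [->|/(omA x Sx) ->] := eqVneq (\1_A x : R) 1; by rewrite ?mul1r ?mul0r.
have mgx : measurable_fun setT (fun x => om x * `|g x - xi x|).
  by apply: measurable_funM => //; apply: measurableT_comp => //; exact: measurable_funB.
split.
  by apply: (intg_ae_eq IG mgx); apply: ae_imp aeS => x /gG.
rewrite (_ : itg (fun x => om x * `|g x - xi x|) = itg G); last first.
  by apply: itg_ae_eq => //; apply: ae_imp aeS => x /gG.
have FE n : itg (F n) = itg (fun x => om x * `|w n x - xi x|).
  apply: itg_ae_eq => //; first exact: intg_measurable (Iom (w n - xi)).
  apply: ae_imp aeS => x Sx; rewrite /F /h -mulrBr.
  by have [->|/(omA x Sx) ->] := eqVneq (\1_A x : R) 1; rewrite ?mul1r ?mul0r.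
have lim2 : (fun n => C * (2^-1 ^+ n + `|u - iota xi|)) @ \oo --> C * (0 + `|u - iota xi|).
  apply: cvgM; first exact: cvg_cst.
  apply: cvgD; last exact: cvg_cst.
  by apply: cvg_expr; rewrite ger0_norm ?invr_ge0// invf_lt1// ltr1n.
rewrite add0r in lim2; apply: (ler_cvg_to cF lim2); apply: nearW => n.
rewrite FE (le_trans (omB _ _))// ler_wpM2l// (le_trans (ler_distD u _ _))// lerD2r.
by rewrite distrC ltW.
Qed.

Lemma weighted_L1 (K : set E) (c : R) (h : E -> R) : measurable K -> 0 < c ->
  (forall x, K x -> c <= om x) -> measurable_fun setT h -> intg (fun x => om x * `|h x|) ->
  L1 K h /\ \int[mu]_(x in K) `|h x| <= c^-1 * itg (fun x => om x * `|h x|).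
Proof.
move=> mK c0 cK mh Ih; have pw x : `|(h \_ K) x| <= c^-1 * (om x * `|h x|).
  rewrite patchE; case: ifPn => [|_]; last by rewrite normr0 !mulr_ge0// invr_ge0 ltW.
  by rewrite inE => /cK cx; rewrite mulrA ler_peMl// mulrC ler_pdivlMr// mul1r.
have IK : intg (h \_ K).
  by apply: le_intg pw (intgZ _ Ih); apply/(measurable_restrictT _ mK); exact: measurable_funS mh.
split; first by apply/(integrable_mkcond _ mK); rewrite restrict_EFin.
rewrite -itgZ// Rintegral_mkcond; apply: le_itg; [|exact: intgZ|].
  by apply: eq_intg (intg_norm IK) => x; rewrite !patchE; case: ifPn; rewrite ?normr0.
by move=> x; apply: le_trans (pw x); rewrite !patchE; case: ifPn; rewrite ?normr0.
Qed.

Variables (D : set E) (KK : set (set E)).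
Hypothesis om_gt0 : forall x, D x -> 0 < om x.
Hypothesis KKP : forall K, KK K ->
  measurable K /\ exists2 c : R, 0 < c & forall x, K x -> c <= om x.

(** Serves for [H_V] with the weight of [L1_weight], and for [B_V] with the indicator of [U]. The
    weighted estimate is recorded as well: it gives explicit rates along the minimizing sequence. *)
Lemma L1_extension_exists : exists J : completion p -> E -> R,
  [/\ L1_extension D KK J, forall u, measurable_fun setT (J u) &
      forall u xi, intg (fun x => om x * `|J u x - xi x|) /\
        itg (fun x => om x * `|J u x - xi x|) <= C * `|u - iota xi|].
Proof.
have /choice[J JP] := rapid_limit; exists J.
have mJ u : measurable_fun setT (J u) by have [] := JP u.
have IJ u xi : intg (fun x => om x * `|J u x - xi x|) by have [_ /(_ xi)[]] := JP u.
have CJ u xi : itg (fun x => om x * `|J u x - xi x|) <= C * `|u - iota xi|.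
  by have [_ /(_ xi)[]] := JP u.
(* The additivity defect is compared with Lipschitz approximants of [u] and [v], for which it is
   zero. *)
have Jlin a u v : intg (fun x => om x * `|J (a *: u + v) x - (a * J u x + J v x)|) /\
    itg (fun x => om x * `|J (a *: u + v) x - (a * J u x + J v x)|) <= 0.
  have mL : measurable_fun setT (fun x => om x * `|J (a *: u + v) x - (a * J u x + J v x)|).
    apply: measurable_funM => //; apply: measurableT_comp => //; apply: measurable_funB => //.
    by apply: measurable_funD => //; exact: measurable_funM.
  have pw xi eta x : om x * `|J (a *: u + v) x - (a * J u x + J v x)| <=
      om x * `|J (a *: u + v) x - (a *: xi + eta : W1inf_c Omega) x| +
      (`|a| * (om x * `|J u x - xi x|) + om x * `|J v x - eta x|).
    rewrite mulrCA -!mulrDr ler_wpM2l// -normrM.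
    have -> : J (a *: u + v) x - (a * J u x + J v x) = (J (a *: u + v) x - (a * xi x + eta x)) -
      (a * (J u x - xi x) + (J v x - eta x)) by ring.
    by rewrite (le_trans (ler_normB _ _))// lerD// ler_normD.
  have IR xi eta : intg (fun x => om x * `|J (a *: u + v) x - (a *: xi + eta : W1inf_c Omega) x| +
      (`|a| * (om x * `|J u x - xi x|) + om x * `|J v x - eta x|)).
    by apply: intgD => //; apply: intgD => //; exact: intgZ.
  have IL : intg (fun x => om x * `|J (a *: u + v) x - (a * J u x + J v x)|).
    by apply: le_intg mL _ (IR 0 0) => x; rewrite ger0_norm ?mulr_ge0.
  split => //; apply: (@le0_eps _ _ (C * (`|a| + 1) *+ 2)).
    by rewrite mulrn_wge0// mulr_ge0// addr_ge0.
  move=> e e0; have [xi xe] := to_completion_dense u e0; have [eta ee] := to_completion_dense v e0.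
  apply: le_trans (le_itg IL (IR xi eta) (pw xi eta)) _.
  rewrite itgD//; last by apply: intgD => //; exact: intgZ.
  rewrite itgD//; last exact: intgZ.
  rewrite itgZ//.
  have n1 : `|a *: u + v - iota (a *: xi + eta)| <= (`|a| + 1) * e.
    rewrite linearP opprD addrACA -scalerBr (le_trans (ler_normD _ _))// mulrDl mul1r.
    by rewrite normrZ lerD ?ler_wpM2l// ltW.
  have c1 := le_trans (CJ (a *: u + v) (a *: xi + eta)) (ler_wpM2l C0 n1).
  have c2 := ler_wpM2l (normr_ge0 a) (le_trans (CJ u xi) (ler_wpM2l C0 (ltW xe))).
  have c3 := le_trans (CJ v eta) (ler_wpM2l C0 (ltW ee)).
  by apply: le_trans (lerD c1 (lerD c2 c3)) _; rewrite le_eqVlt; apply/orP; left; apply/eqP; ring.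
have Jdist u v : intg (fun x => om x * `|J v x - J u x|) /\
    itg (fun x => om x * `|J v x - J u x|) <= C * `|u - v|.
  have mL : measurable_fun setT (fun x => om x * `|J v x - J u x|).
    by apply: measurable_funM => //; apply: measurableT_comp => //; exact: measurable_funB.
  have pw xi x : om x * `|J v x - J u x| <= om x * `|J v x - xi x| + om x * `|J u x - xi x|.
    by rewrite -mulrDr ler_wpM2l// [`|J u x - _|]distrC ler_distD.
  have IR xi : intg (fun x => om x * `|J v x - xi x| + om x * `|J u x - xi x|) by exact: intgD.
  have IL : intg (fun x => om x * `|J v x - J u x|).
    by apply: le_intg mL _ (IR 0) => x; rewrite ger0_norm ?mulr_ge0.
  split => //; rewrite -subr_le0; apply: (@le0_eps _ _ (C *+ 2)); first by rewrite mulrn_wge0.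
  move=> e e0; have [xi xe] := to_completion_dense u e0.
  have := le_itg IL (IR xi) (pw xi); rewrite itgD// => h.
  have c1 : C * `|v - iota xi| <= C * (`|u - v| + e).
    by rewrite ler_wpM2l// (le_trans (ler_distD u _ _))// lerD//; [rewrite distrC|rewrite ltW].
  have c2 : C * `|u - iota xi| <= C * e by rewrite ler_wpM2l// ltW.
  have := CJ v xi; have := CJ u xi; rewrite mulrDr in c1; rewrite mulr2n mulrDl; lra.
have zero_ae (h : E -> R) : intg (fun x => om x * `|h x|) -> itg (fun x => om x * `|h x|) <= 0 ->
    {ae mu, forall x, D x -> h x = 0}.
  move=> Ih h0; have := itg_le0_ae Ih _ h0.
  move=> /(_ (fun x => mulr_ge0 (om0 x) (normr_ge0 _))); apply: ae_imp => x /eqP.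
  by rewrite mulf_eq0 normr_eq0 => /orP[/eqP ox /om_gt0|/eqP //]; rewrite ox ltxx.
split => //; split.
- move=> u K /KKP[mK [c c0 cK]]; apply: (weighted_L1 mK c0 cK (mJ u) _).1.
  by apply: eq_intg (IJ u 0) => x; rewrite subr0.
- move=> a u v; have [I1 I2] := Jlin a u v.
  by apply: ae_imp (zero_ae _ I1 I2) => x H Dx; apply/eqP; rewrite -subr_eq0 H.
- move=> xi; have I2 := CJ (iota xi) xi; rewrite subrr normr0 mulr0 in I2.
  by apply: ae_imp (zero_ae _ (IJ _ _) I2) => x H Dx; apply/eqP; rewrite -subr_eq0 H.
- move=> u K /KKP[mK [c c0 cK]] A /nbhs_ballP[e /= e0 eA]; apply/nbhs_ballP.
  have C1 : 0 < C + 1 by rewrite ltr_wpDl.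
  exists (c * e / (C + 1)) => /=; first by rewrite divr_gt0// mulr_gt0.
  move=> v; rewrite -ball_normE /ball_/= ltr_pdivlMr// => uv.
  apply: eA; rewrite -ball_normE /ball_/= sub0r normrN ger0_norm; last exact: Rintegral_ge0.
  have [I1 I2] := Jdist u v.
  have := (weighted_L1 mK c0 cK (measurable_funB (mJ v) (mJ u)) I1).2.
  move=> /le_lt_trans; apply; rewrite mulrC ltr_pdivrMr// [e * c]mulrC.
  by apply: le_lt_trans I2 _; apply: le_lt_trans uv; rewrite mulrC ler_wpM2l// lerDl.
Qed.

End functions_from_completions.

(** * Local L^1 bounds and the integrable weight *)

Section weights.
Context {R : realType} {N : nat}.
Local Notation E := 'rV[R]_N.
Local Notation mu := (@lebesgue_rV R N).
Local Notation intg f := (mu.-integrable setT (EFin \o f)).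
Local Notation itg f := (\int[mu]_x f x).
Variables (Omega : set E) (V : E -> R).
Hypothesis Oopen : open Omega.
Hypothesis VL : L1loc Omega V.
Hypothesis sub : L1_subcritical Omega V.
Implicit Types xi : W1inf_c Omega.

Let Qpos : Q_nonneg Omega V. Proof. by case: sub. Qed.

Lemma itg_indicM (K : set E) (f : E -> R) : \int[mu]_(x in K) f x = itg (fun x => \1_K x * f x).
Proof.
rewrite Rintegral_mkcond; apply: eq_Rintegral => x _.
by rewrite patchE indicE; case: ifPn; rewrite ?mul1r ?mul0r.
Qed.

Lemma intg_indicM (K : set E) (f : E -> R) : measurable K -> intg f -> intg (fun x => \1_K x * f x).
Proof.
move=> mK If; have mI : measurable_fun setT (\1_K : E -> R) by exact: measurable_indic.
apply: eq_intg (intgM (M := 1) If mI _) => x; first exact: mulrC.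
by rewrite indicE; case: (_ \in _); rewrite ?normr1 ?normr0.
Qed.

Lemma intg_normW xi : intg (fun x => `|xi x|).
Proof. by apply: intg_norm; apply: lipschitz_bs_intg; exact: W_lipschitz_bs. Qed.

(** By homogeneity, continuity at 0 is a bound: rescaling brings [xi] into the ball of radius [d],
    where the integral over [K] is less than 1. *)
Lemma subcritical_L1_bound K : compacts_in Omega K -> exists2 C : R, 0 <= C &
  forall xi, \int[mu]_(x in K) `|xi x| <= C * norm_L V xi.
Proof.
move=> cK; have mK : measurable K by apply: compact_measurable_rV; exact: cK.1.
have [_ /(_ 0 K cK)] := sub; move=> /(_ _ (nbhsx_ballx _ _ (@ltr01 R)))[d /= d0 dP].
have [_ pZ] := norm_L_seminorm VL Qpos.
exists (2 / d); first by rewrite divr_ge0// ltW.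
move=> xi; set q := norm_L V xi; have q0 : 0 <= q by exact: sqrtr_ge0.
(* The scale [s] divides by [q + e'] in place of [q], which is not known to be positive here; [e']
   contributes exactly [e] to the final bound. *)
apply/ler_addgt0Pr => e e0; set e' := e / (2 / d).
have e'0 : 0 < e' by rewrite !divr_gt0.
set s := d / (2 * (q + e')).
have qe : 0 < q + e' by rewrite ltr_wpDl.
have s0 : 0 < s by rewrite divr_gt0// mulr_gt0.
have /dP : norm_L V (s *: xi - 0) < d.
  rewrite subr0 pZ gtr0_norm// -/q /s mulrAC ltr_pdivrMr ?mulr_gt0// ltr_pM2l//; lra.
rewrite -ball_normE /ball_/= sub0r normrN ger0_norm; last exact: Rintegral_ge0.
have -> : \int[mu]_(x in K) `|(s *: xi) x - (0 : W1inf_c Omega) x| = s * \int[mu]_(x in K) `|xi x|.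
  rewrite (itg_indicM K (fun x => `|(s *: xi) x - (0 : W1inf_c Omega) x|)).
  rewrite (itg_indicM K (fun x => `|xi x|)) -itgZ; last by apply: intg_indicM => //; exact: intg_normW.
  apply: eq_Rintegral => x _; rewrite (_ : (s *: xi) x - _ = s * xi x) ?subr0//.
  by rewrite normrM gtr0_norm//; ring.
rewrite -ltr_pdivlMl// mulr1 => /ltW /le_trans; apply.
rewrite /s invf_div mulrC mulrA [d^-1 * 2]mulrC mulrDr /e' [_ * (e / _)]mulrC divfK//.
by rewrite gt_eqF// divr_gt0.
Qed.

Lemma L1_weight : exists om : E -> R,
  [/\ measurable_fun setT om, forall x, 0 <= om x <= 1,
      forall K, compacts_in Omega K -> exists2 c : R, 0 < c & forall x, K x -> c <= om x &
      forall xi, itg (fun x => om x * `|xi x|) <= norm_L V xi].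
Proof.
have /choice[C CP] : forall n, exists C : R, 0 <= C /\
    forall xi, \int[mu]_(x in exh Omega n) `|xi x| <= C * norm_L V xi.
  by move=> n; have [C C0 H] := subcritical_L1_bound (exh_compacts_in Omega n); exists C.
have C0 n : 0 <= C n by have [] := CP n.
(* Both [a n] and [a n * C n] are at most [2^-1 ^+ n.+1], and these sum to at most 1: the first
   gives [om <= 1], the second the bound by [norm_L]. On [exh Omega n] the weight is at least
   [a n]. *)
pose a n : R := (2^-1 ^+ n.+1) / (C n + 1).
have C1 n : 0 < C n + 1 by rewrite ltr_wpDl.
have p0 n : 0 < 2^-1 ^+ n :> R by rewrite exprn_gt0// invr_gt0.
have a0 n : 0 < a n by rewrite divr_gt0.
have aC n : a n * C n <= 2^-1 ^+ n.+1.
  by rewrite /a mulrAC ler_pdivrMr// ler_wpM2l ?(ltW (p0 _))// lerDl.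
have a1 n : a n <= 2^-1 ^+ n.+1 by rewrite /a ler_pdivrMr// ler_peMr ?(ltW (p0 _))// lerDr.
have sum1 n : \sum_(0 <= k < n) 2^-1 ^+ k.+1 <= 1 :> R.
  suff -> : \sum_(0 <= k < n) 2^-1 ^+ k.+1 = 1 - 2^-1 ^+ n :> R by rewrite gerBl ltW.
  elim: n => [|n IH]; first by rewrite big_nil expr0 subrr.
  by rewrite big_nat_recr//= IH exprS; field.
have mK n : measurable (exh Omega n).
  by apply: compact_measurable_rV; have [] := exh_compacts_in Omega n.
pose t k x : R := a k * \1_(exh Omega k) x.
have t0 k x : 0 <= t k x by rewrite mulr_ge0 ?(ltW (a0 k)).
have t1 k x : t k x <= a k.
  by rewrite /t indicE; case: (_ \in _); rewrite ?mulr1 ?mulr0 ?(ltW (a0 k)).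
pose S n x := \sum_(0 <= k < n) t k x.
have mS n : measurable_fun setT (S n).
  by apply: measurable_sum => k; apply: measurable_funM => //; exact: measurable_indic.
have S0 n x : 0 <= S n x by apply: sumr_ge0 => k _.
have S1 n x : S n x <= 1.
  by apply: le_trans (sum1 n); apply: ler_sum => k _; exact: le_trans (t1 k x) (a1 k).
have cS x : cvgn (S^~ x).
  apply: nondecreasing_is_cvgn; last by exists 1 => _ [n _ <-].
  by apply/nondecreasing_seqP => n; rewrite /S big_nat_recr//= lerDl.
pose om x := limn (S^~ x).
have Som x : S^~ x @ \oo --> om x by exact: cS.
have om01 x : 0 <= om x <= 1.
  apply/andP; split.
    by apply: (ler_cvg_to (cvg_cst 0) (Som x)); apply: nearW => n.
  by apply: limr_le; [exact: cS|apply: nearW => n].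
exists om; split => //; first by apply: measurable_fun_cvg => // x _; exact: Som.
  move=> K cK; have [n Kn] := exh_absorb Oopen cK; exists (a n) => // x /Kn xn.
  apply: (ler_cvg_to (cvg_cst (a n)) (Som x)); exists n.+1 => // m /= nm.
  rewrite /S (@big_cat_nat _ _ _ n.+1 0 m)//= big_nat_recr//= -addrA addrCA.
  rewrite {1}/t indicE mem_set// mulr1 lerDl addr_ge0//; exact: sumr_ge0.
move=> xi; have Ix := intg_normW xi.
have mx : measurable_fun setT (fun x => `|xi x|) := intg_measurable Ix.
have [|||||_ cI] := @itg_dct _ _ _ mu (fun n x => S n x * `|xi x|) (fun x => om x * `|xi x|) (fun x => `|xi x|).
- by move=> n; exact: measurable_funM.
- by apply: measurable_funM => //; apply: measurable_fun_cvg => // x _; exact: Som.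
- by apply: ae_all => x; apply: cvgM; [exact: Som|exact: cvg_cst].
- exact: Ix.
- by move=> n x; rewrite normrM normr_id ger0_norm// ler_piMl.
apply: (ler_cvg_to cI (cvg_cst (norm_L V xi))); apply: nearW => n.
have -> : itg (fun x => S n x * `|xi x|) = \sum_(0 <= k < n) a k * \int[mu]_(x in exh Omega k) `|xi x|.
  transitivity (itg (fun x => \sum_(0 <= k < n) a k * (\1_(exh Omega k) x * `|xi x|))).
    by apply: eq_Rintegral => x _; rewrite /S mulr_suml; apply: eq_bigr => k _; rewrite /t mulrA.
  rewrite itg_sum; last by move=> k; apply: intgZ; exact: intg_indicM.
  apply: eq_bigr => k _; rewrite (itg_indicM (exh Omega k) (fun x => `|xi x|)) itgZ//.
  exact: intg_indicM.
have q0 : 0 <= norm_L V xi by exact: sqrtr_ge0.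
apply: (@le_trans _ _ ((\sum_(0 <= k < n) 2^-1 ^+ k.+1) * norm_L V xi)).
  rewrite mulr_suml; apply: ler_sum => k _; have [_ /(_ xi) h] := CP k.
  apply: le_trans (ler_wpM2l (ltW (a0 k)) h) _; rewrite mulrA; exact: ler_wpM2r.
by rewrite ler_piMl.
Qed.

End weights.

(** * The C^2 norm and the action of the potential on test functions *)

Section test_space_norm.
Context {R : realType} {N : nat}.
Local Notation E := 'rV[R]_N.
Local Notation mu := (@lebesgue_rV R N).
Local Notation intg f := (mu.-integrable setT (EFin \o f)).
Local Notation itg f := (\int[mu]_x f x).
Implicit Types (B : set E) (f g : E -> R).

Definition bounded_fct f := exists M : R, forall x, `|f x| <= M.

Lemma supnorm_ub B f x : bounded_fct f -> B x -> `|f x| <= supnorm B f.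
Proof.
move=> [M fM] Bx; apply: ub_le_sup; last by exists x.
by exists M => _ [y _ <-].
Qed.

Lemma supnorm_le B f c M : B c -> (forall x, B x -> `|f x| <= M) -> supnorm B f <= M.
Proof.
move=> Bc fM; apply: ge_sup; first by exists `|f c|; exists c.
by move=> _ [y By <-]; exact: fM.
Qed.

Lemma supnormD B f g c : B c -> bounded_fct f -> bounded_fct g ->
  supnorm B (fun x => f x + g x) <= supnorm B f + supnorm B g.
Proof.
move=> Bc bf bg; apply: (supnorm_le Bc) => x Bx.
by rewrite (le_trans (ler_normD _ _))// lerD//; exact: supnorm_ub.
Qed.

Lemma supnormZ B f c (a : R) : B c -> bounded_fct f ->
  supnorm B (fun x => a * f x) = `|a| * supnorm B f.
Proof.
move=> Bc bf.
have le (b : R) g : bounded_fct g -> supnorm B (fun x => b * g x) <= `|b| * supnorm B g.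
  by move=> bg; apply: (supnorm_le Bc) => x Bx; rewrite normrM ler_wpM2l// supnorm_ub.
have [->|a0] := eqVneq a 0.
  have := le 0 f bf; rewrite normr0 mul0r => h; apply/eqP; rewrite eq_le h/=.
  by apply: le_trans (supnorm_ub (f := fun x => 0 * f x) _ Bc) => //; exists 0 => x; rewrite mul0r normr0.
apply/eqP; rewrite eq_le le//= -ler_pdivlMl ?normr_gt0// -normfV.
rewrite {1}(_ : f = fun x => a^-1 * (a * f x)); last by apply/funext => x; rewrite mulKf.
by apply: le; have [M fM] := bf; exists (`|a| * M) => x; rewrite normrM ler_wpM2l.
Qed.

Variable B : set E.
Implicit Types phi psi : C2_c (interior B).

Lemma C2_Ck phi : Ck 2 phi.
Proof. by case: phi => f /= /asboolP[]. Qed.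

Lemma C2_support phi : exists2 K, compacts_in (interior B) K & forall x, ~ K x -> phi x = 0.
Proof. by case: phi => f /= /asboolP[_ [K cK fK]]; exists K. Qed.

Lemma C2_bounded_support phi : bounded_support phi.
Proof.
have [K cK xK] := C2_support phi; have [M KM] := compact_bounded_norm cK.1.
by exists M => x Mx; apply: xK => /KM; rewrite leNgt Mx.
Qed.

Lemma C2_eq0 phi x : ~ B x ->
  [/\ phi x = 0, forall i, partial i phi x = 0 & forall i j, partial i (partial j phi) x = 0].
Proof.
move=> nB; have [K [cK KB] fK] := C2_support phi.
have clK := closed_compact_rV cK.
have nK : ~ K x by move=> /KB /interior_subset.
split => [|i|i j]; first exact: fK.
  exact: partial_eq0 fK _ nK.
by apply: partial_eq0 nK => // y; exact: partial_eq0.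
Qed.

Lemma C2_bounded phi : [/\ bounded_fct phi, forall i, bounded_fct (partial i phi) &
  forall i j, bounded_fct (partial i (partial j phi))].
Proof.
have b0 f : continuous f -> bounded_support f -> bounded_fct f.
  by move=> cf sf; have [M _ fM] := continuous_bounded_support_bounded cf sf; exists M.
have sp := C2_bounded_support phi; have cp := C2_Ck phi.
split => [|i|i j]; apply: b0 => //.
- exact: Ck_continuous cp.
- exact: Ck_continuous (Ck_partial i cp).
- exact: bounded_support_partial.
- exact: Ck_continuous (Ck_partial i (Ck_partial j cp)).
- by apply: bounded_support_partial; exact: bounded_support_partial.
Qed.

Lemma supnorm_ge0 c f : B c -> bounded_fct f -> 0 <= supnorm B f.
Proof. by move=> Bc bf; apply: le_trans (supnorm_ub bf Bc). Qed.

Variable c : E.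
Hypothesis Bc : B c.

Lemma C2norm_seminorm : is_seminorm (@C2norm _ _ B).
Proof.
have pD phi psi : [/\ forall i, partial i (phi + psi : C2_c _) = (fun x => partial i phi x + partial i psi x) &
    forall i j, partial i (partial j (phi + psi : C2_c _)) =
      (fun x => partial i (partial j phi) x + partial i (partial j psi) x)].
  have p1 i : partial i (phi + psi : C2_c _) = (fun x => partial i phi x + partial i psi x).
    by apply/funext => x; apply: partialD; [exact: Ck_derivable (C2_Ck phi)|exact: Ck_derivable (C2_Ck psi)].
  split => // i j; rewrite p1; apply/funext => x.
  by apply: partialD; [exact: Ck_derivable (Ck_partial j (C2_Ck phi))|exact: Ck_derivable (Ck_partial j (C2_Ck psi))].
have pZ a phi : [/\ forall i, partial i (a *: phi : C2_c _) = (fun x => a * partial i phi x) &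
    forall i j, partial i (partial j (a *: phi : C2_c _)) = (fun x => a * partial i (partial j phi) x)].
  have p1 i : partial i (a *: phi : C2_c _) = (fun x => a * partial i phi x).
    by apply/funext => x; apply: partialZ; exact: Ck_derivable (C2_Ck phi).
  split => // i j; rewrite p1; apply/funext => x.
  by apply: partialZ; exact: Ck_derivable (Ck_partial j (C2_Ck phi)).
split => [phi psi|a phi].
  have [b1 b2 b3] := C2_bounded phi; have [b1' b2' b3'] := C2_bounded psi.
  have [p1 p2] := pD phi psi.
  have h1 := supnormD Bc b1 b1'.
  have h2 : \sum_(i < N) supnorm B (partial i (phi + psi : C2_c _)) <=
      \sum_(i < N) supnorm B (partial i phi) + \sum_(i < N) supnorm B (partial i psi).
    by rewrite -big_split; apply: ler_sum => i _; rewrite p1; apply: (supnormD Bc).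
  have h3 : \sum_(i < N) \sum_(j < N) supnorm B (partial i (partial j (phi + psi : C2_c _))) <=
      \sum_(i < N) \sum_(j < N) supnorm B (partial i (partial j phi)) +
      \sum_(i < N) \sum_(j < N) supnorm B (partial i (partial j psi)).
    rewrite -big_split; apply: ler_sum => i _; rewrite -big_split; apply: ler_sum => j _.
    by rewrite p2; apply: (supnormD Bc).
  apply: le_trans (lerD (lerD h1 h2) h3) _.
  by rewrite /C2norm [leRHS]addrACA [X in _ <= X + _]addrACA.
have [b1 b2 b3] := C2_bounded phi; have [p1 p2] := pZ a phi.
rewrite /C2norm !mulrDr; congr (_ + _ + _).
- exact: supnormZ Bc b1.
- by rewrite mulr_sumr; apply: eq_bigr => i _; rewrite p1 (supnormZ _ Bc).
- rewrite mulr_sumr; apply: eq_bigr => i _; rewrite mulr_sumr; apply: eq_bigr => j _.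
  by rewrite p2 (supnormZ _ Bc).
Qed.

(** The suprema run over [B], but outside [B] the function and its derivatives vanish, so the bounds
    are global. *)
Lemma C2norm_ub phi x : [/\ `|phi x| <= C2norm phi, forall i, `|partial i phi x| <= C2norm phi &
  `|laplacian phi x| <= C2norm phi].
Proof.
have [b1 b2 b3] := C2_bounded phi.
have s1 : 0 <= supnorm B phi by exact: supnorm_ge0 Bc b1.
have s2 : 0 <= \sum_(i < N) supnorm B (partial i phi) by apply: sumr_ge0 => i _; exact: supnorm_ge0 Bc _.
have s3 : 0 <= \sum_(i < N) \sum_(j < N) supnorm B (partial i (partial j phi)).
  by apply: sumr_ge0 => i _; apply: sumr_ge0 => j _; exact: supnorm_ge0 Bc _.
have n0 : 0 <= C2norm phi by rewrite /C2norm !addr_ge0.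
have [Bx|nB] := pselect (B x); last first.
  have [z1 z2 z3] := C2_eq0 phi nB; split => [|i|]; rewrite ?z1 ?z2 ?normr0//.
  by rewrite /laplacian big1 ?normr0// => i _; exact: z3.
split => [|i|].
- by apply: le_trans (supnorm_ub b1 Bx) _; rewrite /C2norm -addrA lerDl addr_ge0.
- apply: le_trans (supnorm_ub (b2 i) Bx) _.
  apply: (@le_trans _ _ (\sum_(j < N) supnorm B (partial j phi))).
    by rewrite (bigD1 i)//= lerDl; apply: sumr_ge0 => j _; exact: supnorm_ge0 Bc _.
  by rewrite /C2norm -addrA addrCA lerDl addr_ge0.
- rewrite /laplacian (le_trans (ler_norm_sum _ _ _))//.
  apply: (@le_trans _ _ (\sum_(i < N) \sum_(j < N) supnorm B (partial i (partial j phi)))); last first.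
    by rewrite /C2norm lerDr addr_ge0.
  apply: ler_sum => i _; rewrite (bigD1 i)//= -[leLHS]addr0; apply: lerD; first exact: supnorm_ub.
  by apply: sumr_ge0 => j _; exact: supnorm_ge0 Bc _.
Qed.

Lemma C2norm_ge0 phi : 0 <= C2norm phi.
Proof. by have [h _ _] := C2norm_ub phi 0; apply: le_trans h. Qed.

End test_space_norm.

Section potential_extensions.
Context {R : realType} {N : nat}.
Local Notation E := 'rV[R]_N.
Local Notation mu := (@lebesgue_rV R N).
Local Notation intg f := (mu.-integrable setT (EFin \o f)).
Local Notation itg f := (\int[mu]_x f x).
Variables (Omega : set E) (V : E -> R) (U B : set E) (c : E).
Hypotheses (VL : L1loc Omega V) (Qpos : Q_nonneg Omega V).
Hypotheses (oU : open U) (BU : B `<=` U) (cB : compacts_in Omega B) (Bc : B c).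
Implicit Types (xi : W1inf_c Omega) (phi : C2_c (interior B)).

Let mU : measurable U. Proof. exact: open_measurable_rV. Qed.
Let mB : measurable B. Proof. by apply: compact_measurable_rV; exact: cB.1. Qed.

Lemma norm_LU_seminorm : is_seminorm (@norm_LU _ _ Omega V U).
Proof.
have [pD pZ] := norm_L_seminorm VL Qpos.
split => [xi eta|a xi]; rewrite /norm_LU.
  rewrite addrACA; apply: lerD; first exact: pD.
  rewrite !(itg_indicM U (fun x => `| _ x|)) -itgD; [|by apply: intg_indicM => //; exact: intg_normW..].
  apply: le_itg; first by apply: intg_indicM => //; exact: (intg_normW (xi + eta)).
    by apply: intgD; apply: intg_indicM => //; exact: intg_normW.
  by move=> x; rewrite -mulrDr; apply: ler_wpM2l; [rewrite indicE|exact: ler_normD].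
rewrite pZ mulrDr; congr (_ + _).
rewrite !(itg_indicM U (fun x => `| _ x|)) -itgZ; last by apply: intg_indicM => //; exact: intg_normW.
by apply: eq_Rintegral => x _; rewrite mulrCA -normrM.
Qed.

Lemma C2_W_subproof phi : (phi : E -> R) \in lip_c Omega.
Proof.
have [K [cK KB] fK] := C2_support phi.
apply: mk_W; first by apply: C1_lipschitz_bs; [exact: CkS (C2_Ck phi)|exact: C2_bounded_support].
by exists K => //; split => // x /KB /interior_subset; exact: cB.2.
Qed.

Definition C2_W phi : W1inf_c Omega := W1infC (C2_W_subproof phi).

(** Integration by parts of the gradient term of [Q_form]. The right-hand side is controlled by
    [norm_LU] of [xi], although [V * xi] itself is not controlled in L^1; this is why the dual of
    [X_ B] appears. *)
Lemma potential_weak_form xi phi : \int[mu]_(x in B) (V x * xi x * phi x) =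
  Q_form V xi (C2_W phi) + itg (fun x => xi x * laplacian phi x).
Proof.
rewrite Q_formE// itg_grad_laplacian; [|exact: W_lipschitz_bs|exact: C2_Ck|exact: C2_bounded_support].
rewrite itg_in; last by move=> x /(C2_eq0 phi)[-> _ _]; rewrite mulr0.
by rewrite addrAC addNr add0r; apply: eq_Rintegral => x _; rewrite mulrA.
Qed.

(** The squared energy norm is at most [C2norm phi ^+ 2] times the sum of [N] times the measure of
    [B] and the integral of the absolute value of [V] over [B]. *)
Lemma norm_L_C2 : exists2 A : R, 0 <= A & forall phi, norm_L V (C2_W phi) <= A * C2norm phi.
Proof.
have I1 : intg (\1_B : E -> R) by apply: intg_indic => //; exact: compact_lty cB.1.
have IV : intg (fun x => `|(V \_ B) x|) by apply: intg_norm; exact: L1loc_restrict VL cB.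
set A := N%:R * itg (\1_B : E -> R) + itg (fun x => `|(V \_ B) x|).
have A0 : 0 <= A by rewrite addr_ge0 ?mulr_ge0// itg_ge0// => x; rewrite indicE.
exists (Num.sqrt A) => [|phi]; first exact: sqrtr_ge0.
have n0 := C2norm_ge0 Bc phi.
rewrite norm_L_form// -(ger0_norm n0) -sqrtr_sqr -sqrtrM//; apply: ler_wsqrtr.
have IR : intg (fun x => C2norm phi ^+ 2 * (N%:R * \1_B x + `|(V \_ B) x|)).
  by apply: intgZ; apply: intgD => //; exact: intgZ.
have := le_itg (intg_Q_form VL (C2_W phi) (C2_W phi)) IR; rewrite -/(Q_form V _ _).
have -> : itg (fun x => C2norm phi ^+ 2 * (N%:R * \1_B x + `|(V \_ B) x|)) = A * C2norm phi ^+ 2.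
  rewrite itgZ; last by apply: intgD => //; exact: intgZ.
  rewrite (itgD (intgZ N%:R I1) IV) (itgZ N%:R I1); exact: mulrC.
apply => x; have [b1 b2 _] := C2norm_ub Bc phi x.
have sq (t : R) : `|t| <= C2norm phi -> t * t <= C2norm phi ^+ 2.
  by move=> tC; rewrite -expr2 -(real_normK (num_real t)) lerXn2r ?nnegrE.
have [Bx|nB] := pselect (B x); last first.
  have [z1 z2 _] := C2_eq0 phi nB; rewrite /grad_dot big1 /= ?z1; last by move=> i _; rewrite /= z2 mul0r.
  by rewrite mul0r mulr0 addr0 mulr_ge0 ?sqr_ge0// addr_ge0// mulr_ge0// indicE.
rewrite indicE patchE mem_set// mulr1 mulrDr; apply: lerD.
  have -> : C2norm phi ^+ 2 * N%:R = \sum_(i < N) C2norm phi ^+ 2 by rewrite sumr_const card_ord mulr_natr.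
  apply: ler_sum => i _.
  exact: sq (b2 i).
rewrite mulrC; apply: le_trans (ler_norm _) _; rewrite normrM ler_wpM2r//.
by rewrite ger0_norm ?sq//= -expr2 sqr_ge0.
Qed.

(** Since [balanced] quantifies over all extensions, it yields information only once one of them is
    exhibited. *)
Lemma potential_extension_exists : exists VV : B_V Omega V U -> X_ B -> R, potential_extension VV.
Proof.
have [A A0 AP] := norm_L_C2.
pose b xi phi := \int[mu]_(x in B) (V x * xi x * phi x).
have Ixl xi phi : intg (fun x => xi x * laplacian phi x).
  apply: (intgM (M := C2norm phi)); first by apply: lipschitz_bs_intg; exact: W_lipschitz_bs.
    by apply: measurable_laplacian; exact: C2_Ck.
  by move=> x; have [] := C2norm_ub Bc phi x.
have bE xi phi : b xi phi = itg (fun x => V x * (xi x * C2_W phi x)).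
  rewrite /b itg_in; last by move=> x /(C2_eq0 phi)[-> _ _]; rewrite mulr0.
  by apply: eq_Rintegral => x _; rewrite mulrA.
have bl a xi xi' phi : b (a *: xi + xi') phi = a * b xi phi + b xi' phi.
  rewrite !bE -itgZ; last exact: intg_VW.
  rewrite -itgD; [|by apply: intgZ; exact: intg_VW|exact: intg_VW].
  apply: eq_Rintegral => x _; rewrite (_ : (a *: xi + xi' : W1inf_c Omega) x = a * xi x + xi' x)//; ring.
have br a xi phi phi' : b xi (a *: phi + phi') = a * b xi phi + b xi phi'.
  rewrite !bE -itgZ; last exact: intg_VW.
  rewrite -itgD; [|by apply: intgZ; exact: intg_VW|exact: intg_VW].
  apply: eq_Rintegral => x _; rewrite (_ : C2_W (a *: phi + phi') x = a * phi x + phi' x)//=; ring.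
have bC xi phi : `|b xi phi| <= (A + 1) * snorm (norm_LU V U) xi * snorm (@C2norm _ _ B) phi.
  rewrite (snormE norm_LU_seminorm) (snormE (C2norm_seminorm Bc)) /b potential_weak_form.
  have n0 := C2norm_ge0 Bc phi; have L0 : 0 <= norm_L V xi by exact: sqrtr_ge0.
  have U0 : 0 <= \int[mu]_(x in U) `|xi x| by exact: Rintegral_ge0.
  have h1 : `|Q_form V xi (C2_W phi)| <= A * norm_L V xi * C2norm phi.
    by rewrite (le_trans (Q_form_CS VL Qpos _ _))// [A * _]mulrC -mulrA ler_wpM2l.
  have h2 : `|itg (fun x => xi x * laplacian phi x)| <= C2norm phi * \int[mu]_(x in U) `|xi x|.
    rewrite (le_trans (normr_itg_le (Ixl xi phi)))// (itg_indicM U (fun x => `|xi x|)) -itgZ; last first.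
      by apply: intg_indicM => //; exact: intg_normW.
    apply: le_itg; first exact: intg_norm.
      by apply: intgZ; apply: intg_indicM => //; exact: intg_normW.
    move=> x; have [_ _ h] := C2norm_ub Bc phi x.
    have [/BU Ux|nB] := pselect (B x); first by rewrite indicE mem_set// mul1r mulrC normrM ler_wpM2r.
    rewrite (_ : laplacian phi x = 0).
      by rewrite mulr0 normr0 mulr_ge0// mulr_ge0// indicE.
    by rewrite /laplacian big1// => i _; have [_ _] := C2_eq0 phi nB; exact.
  apply: le_trans (ler_normD _ _) _; apply: le_trans (lerD h1 h2) _.
  rewrite /norm_LU -subr_ge0.
  rewrite (_ : _ - _ = C2norm phi * (A * \int[mu]_(x in U) `|xi x| + norm_L V xi)); last by ring.
  by rewrite mulr_ge0// addr_ge0// mulr_ge0.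
have A1 : 0 <= A + 1 by rewrite addr_ge0.
have [bb [bbl bbr bbE bbC]] := bilinear_extension A1 bl br bC.
have dual u : dual_element (bb u).
  split; first by move=> a phi psi; exact: bbr.
  apply: (bounded_linear_continuous (C := (A + 1) * `|u|)) => [|a v w|v]; [exact: mulr_ge0|exact: bbr|exact: bbC].
exists bb; split => //.
- by move=> xi; split => // phi; rewrite bbE.
- move=> u e e0; apply/nbhs_ballP; exists (e / (A + 1 + 1)) => /=; first by rewrite divr_gt0// ltr_wpDl.
  move=> v; rewrite -ball_normE /ball_/= ltr_pdivlMr ?ltr_wpDl// => uv phi.
  have -> : bb v phi - bb u phi = bb (v - u) phi.
    by rewrite [v - u]addrC -(scaleN1r u) bbl mulN1r addrC.
  rewrite (le_trans (bbC _ _))// ler_wpM2r// (le_trans _ (ltW uv))// mulrC distrC ler_wpM2l//.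
  by rewrite lerDl.
Qed.

End potential_extensions.

(** * Existence of the solution *)

Section localization.
Context {R : realType} {N : nat}.
Local Notation E := 'rV[R]_N.
Local Notation mu := (@lebesgue_rV R N).
Local Notation intg f := (mu.-integrable setT (EFin \o f)).
Local Notation itg f := (\int[mu]_x f x).
Variable Omega : set E.
Implicit Types (f g : E -> R).

(** A partition of unity, peeled off ball by ball. Quarter balls cover the support; the cutoff [chi]
    is 1 on the quarter ball and 0 outside the half ball, so [f * chi] is supported in the full ball
    and [f * (1 - chi)] vanishes off the remaining quarter balls. *)
Lemma test_function_localization (P : (E -> R) -> Prop) : P (fun=> 0) ->
  (forall f g, test_function Omega f -> test_function Omega g -> P f -> P g ->
     P (fun x => f x + g x)) ->
  (forall c, Omega c -> exists r : R, [/\ 0 < r, closed_ball_e c r `<=` Omega &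
     forall f, test_function (open_ball c r) f -> P f]) ->
  forall f, test_function Omega f -> P f.
Proof.
move=> P0 PD Ploc.
have /choice[r rP] : forall c, exists r : R, Omega c -> [/\ 0 < r, closed_ball_e c r `<=` Omega &
     forall f, test_function (open_ball c r) f -> P f].
  by move=> c; have [/Ploc[r H]|nO] := pselect (Omega c); [exists r|exists 0 => /nO].
suff main (s : seq E) f : (forall c, c \in s -> Omega c) -> test_function Omega f ->
    (forall x, (forall c, c \in s -> ~ open_ball c (r c / 4) x) -> f x = 0) -> P f.
  move=> f tf; have [_ [K [cK KO] Kf]] := tf.
  have [|s sK Ks] := compact_ball_cover (r := fun c => r c / 4) cK.
    by move=> c /KO /rP[r0 _ _]; rewrite divr_gt0.
  apply: (main s) => // [c /sK /KO//|x xs]; apply: Kf => /Ks[c cs xc].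
  exact: xs cs xc.
elim: s f => [|c s IH] f sO [cf sf] f0.
  by rewrite (_ : f = (fun=> 0))//; apply/funext => x; exact: f0.
have [r0 rO Pr] := rP c (sO c (mem_head _ _)).
have r2 : 0 < r c / 2 by rewrite divr_gt0.
pose chi := plateau c (r c / 2); have cchi k : Ck k chi by exact: Ck_plateau.
have sB : compacts_in (open_ball c (r c)) (closed_ball_e c (r c / 2)).
  split; first exact: compact_closed_ball_e.
  by move=> x; rewrite /closed_ball_e /open_ball/=; lra.
have t1 : test_function (open_ball c (r c)) (fun x => f x * chi x).
  split=> [k|]; first exact: CkM.
  exists (closed_ball_e c (r c / 2)) => // x /negP; rewrite -ltNge => /ltW h.
  by rewrite /chi plateau_eq0 ?mulr0// ltW.
have t1' : test_function Omega (fun x => f x * chi x).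
  split=> [k|]; first exact: CkM.
  by have [K cK fK] := sf; exists K => // x /fK ->; rewrite mul0r.
have t2 : test_function Omega (fun x => f x * (1 + -1 * chi x)).
  split=> [k|]; first by apply: CkM => //; apply: CkD; [exact: Ck_cst|exact: CkZ].
  by have [K cK fK] := sf; exists K => // x /fK ->; rewrite mul0r.
rewrite (_ : f = (fun x => f x * chi x + f x * (1 + -1 * chi x))); last first.
  by apply/funext => x; ring.
apply: PD => //; first exact: Pr.
apply: IH => // [c' c's|x xs]; first by apply: sO; rewrite inE c's orbT.
have [xc|xc] := pselect (open_ball c (r c / 4) x); last first.
  by rewrite f0 ?mul0r// => c'; rewrite inE => /orP[/eqP ->//|/xs].
have -> : chi x = 1.
  by apply: plateau_eq1 => //; move: xc; rewrite /open_ball/=; lra.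
by rewrite mulr1 subrr mulr0.
Qed.

Lemma L1loc_balls g : measurable_fun setT (g \_ Omega) ->
  (forall c, Omega c -> exists2 r : R, 0 < r & L1 (closed_ball_e c r) g) -> L1loc Omega g.
Proof.
move=> mg loc K [cK KO]; have mK := compact_measurable_rV cK.
have /choice[r rP] : forall c, exists r : R, Omega c -> 0 < r /\ L1 (closed_ball_e c r) g.
  by move=> c; have [/loc[r r0 H]|nO] := pselect (Omega c); [exists r|exists 0 => /nO].
have [|s sK Ks] := compact_ball_cover (r := r) cK; first by move=> c /KO /rP[].
have Is c : c \in s -> intg (g \_ (closed_ball_e c (r c))).
  move=> /sK /KO /rP[r0]; have mB := closed_measurable_rV (closed_closed_ball_e (c := c) r0).
  by move=> /(integrable_mkcond _ mB); rewrite restrict_EFin.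
have IS : intg (fun x => \sum_(c <- s) `|(g \_ (closed_ball_e c (r c))) x|).
  elim: s {sK Ks} Is => [_|c s IH Is]; first by apply: (@eq_intg _ _ _ _ (fun=> 0)); [move=> x; rewrite big_nil|exact: intg0].
  have I1 : intg (fun x => `|(g \_ (closed_ball_e c (r c))) x|).
    by apply: intg_norm; apply: Is; exact: mem_head.
  have I2 : intg (fun x => \sum_(c <- s) `|(g \_ (closed_ball_e c (r c))) x|).
    by apply: IH => c' c's; apply: Is; rewrite inE c's orbT.
  by apply: eq_intg (intgD I1 I2) => x; rewrite big_cons.
have mgK : measurable_fun setT (g \_ K).
  rewrite (_ : g \_ K = (g \_ Omega) \_ K).
    by apply/(measurable_restrictT _ mK); exact: measurable_funS mg.
  apply/funext => x; rewrite !patchE; case: ifPn => // /[!inE] /KO Ox.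
  by rewrite mem_set.
apply/(integrable_mkcond _ mK); rewrite restrict_EFin; apply: le_intg mgK _ IS => x.
rewrite {1}patchE; case: ifPn => [|_]; last by rewrite normr0 sumr_ge0.
rewrite inE => /Ks[c cs xc]; rewrite (big_rem c)//= patchE mem_set; last exact: ltW xc.
by rewrite lerDl sumr_ge0.
Qed.

End localization.

(** * Minimization of the energy functional *)

Section minimizer.
Context {R : realType} {N : nat}.
Local Notation E := 'rV[R]_N.
Local Notation mu := (@lebesgue_rV R N).
Local Notation intg f := (mu.-integrable setT (EFin \o f)).
Local Notation itg f := (\int[mu]_x f x).
Variables (Omega : set E) (V om : E -> R).
Hypotheses (VL : L1loc Omega V) (Qpos : Q_nonneg Omega V).
Hypotheses (mom : measurable_fun setT om) (om01 : forall x, 0 <= om x <= 1).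
Implicit Types xi eta phi : W1inf_c Omega.
Hypothesis omL : forall xi, itg (fun x => om x * `|xi x|) <= norm_L V xi.

Let Q xi := Q_form V xi xi.
Let Qsym := @Q_form_sym R N Omega V.
Let Qlin := Q_form_lin VL.

Let I_om xi : intg (fun x => om x * xi x).
Proof.
apply: eq_intg (intgM (M := 1) (lipschitz_bs_intg (W_lipschitz_bs xi)) mom _) => x; first exact: mulrC.
by have /andP[w0 w1] := om01 x; rewrite ger0_norm.
Qed.

Let T xi := itg (fun x => om x * xi x).

Let Tlin a xi eta : T (a *: xi + eta) = a * T xi + T eta.
Proof.
rewrite /T -(itgZ a (I_om xi)) -(itgD (intgZ a (I_om xi)) (I_om eta)).
apply: eq_Rintegral => x _; rewrite (_ : (a *: xi + eta : W1inf_c Omega) x = a * xi x + eta x)//; ring.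
Qed.

Let F xi := Q xi / 2 - T xi.

Let T_le xi : T xi <= itg (fun x => om x * `|xi x|).
Proof.
apply: le_itg => //; first exact: (I_om (W_norm xi)).
by move=> x; have /andP[w0 w1] := om01 x; rewrite ler_wpM2l// ler_norm.
Qed.

Lemma minimizing_sequence : exists xi_ : nat -> W1inf_c Omega,
  (forall n x, 0 <= xi_ n x) /\ forall n eta, F (xi_ n) <= F eta + n.+1%:R^-1.
Proof.
pose S := range F; have hS : has_inf S.
  split; first by exists (F 0); exists 0.
  (* With [q = norm_L V xi], the functional is at least [q ^+ 2 / 2 - q], whose minimum is -1/2. *)
  exists (- 2^-1) => _ [xi _ <-]; rewrite /F.
  have := le_trans (T_le xi) (omL xi).
  have : norm_L V xi ^+ 2 = Q xi by rewrite norm_L_form// sqr_sqrtr// Q_form_ge0.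
  have := sqr_ge0 (norm_L V xi - 1); rewrite sqrrB1; lra.
have /choice[xi_ xiP] : forall n, exists xi, F xi < inf S + n.+1%:R^-1.
  move=> n; have n0 : 0 < n.+1%:R^-1 :> R by rewrite invr_gt0.
  by have [_ [xi _ <-] H] := inf_adherent n0 hS; exists xi.
exists (fun n => W_norm (xi_ n)); split => [n x|n eta]; first exact: normr_ge0.
have : inf S <= F eta by apply: ge_inf; [case: hS|exists eta].
have := xiP n.
have : F (W_norm (xi_ n)) <= F (xi_ n).
  have h : T (xi_ n) <= T (W_norm (xi_ n)) := T_le (xi_ n).
  have hq : Q (W_norm (xi_ n)) = Q (xi_ n) by exact: Q_form_norm.
  by rewrite /F hq; apply: lerB.
move: (n.+1%:R^-1) => t; lra.
Qed.

Variable xi_ : nat -> W1inf_c Omega.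
Hypothesis xiP : forall n eta, F (xi_ n) <= F eta + n.+1%:R^-1.

Let inv_small (e : R) : 0 < e -> exists n0, forall n, (n0 <= n)%N -> n.+1%:R^-1 < e.
Proof.
move=> e0; have [n0 _ H] := near_infty_natSinv_lt (PosNum e0).
by exists n0 => n /H.
Qed.

Lemma minimizing_cauchy : xi_ \in cauchy_seqs (@norm_L _ _ Omega V).
Proof.
apply/asboolP => e e0; rewrite (snormE (norm_L_seminorm VL Qpos)).
(* Comparing with the midpoint, the parallelogram identity bounds the squared distance by 4 times
   the sum of the two defects, hence by [e ^+ 2]. *)
have e8 : 0 < e ^+ 2 / 8 by rewrite divr_gt0// exprn_gt0.
have [n0 H] := inv_small e8; exists n0 => m n /H hm /H hn.
rewrite -(ltr_pXn2r (n := 2)) ?nnegrE ?sqrtr_ge0 ?(ltW e0)//.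
rewrite norm_L_form// sqr_sqrtr; last exact: Q_form_ge0.
have P := form_parallelogram Qsym Qlin (xi_ m) (xi_ n).
have FM := xiP m (2^-1 *: (xi_ m + xi_ n)); have FN := xiP n (2^-1 *: (xi_ m + xi_ n)).
have TE : T (2^-1 *: (xi_ m + xi_ n)) = (T (xi_ m) + T (xi_ n)) / 2.
  rewrite -[_ *: _]addr0 Tlin -{1}(scale1r (xi_ m)) Tlin.
  have -> : T 0 = 0 by have := Tlin 1 0 0; rewrite scale1r addr0; lra.
  by field.
rewrite /F /Q TE in FM FN.
by move: (m.+1%:R^-1) (n.+1%:R^-1) hm hn FM FN => s t; lra.
Qed.

(** Near-minimality of [xi_ n] against [t *: phi + xi_ n] is a quadratic inequality valid for all
    [t]; its discriminant bounds the square of the error by [2 * Q phi * n.+1%:R^-1]. *)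
Lemma minimizing_euler_lagrange phi :
  (fun n => Q_form V (xi_ n) phi) @ \oo --> itg (fun x => om x * phi x).
Proof.
have bound n : (Q_form V (xi_ n) phi - T phi) ^+ 2 <= 2 * Q phi * n.+1%:R^-1.
  have q0 : 0 <= Q phi / 2 by rewrite divr_ge0// Q_form_ge0.
  have := @quadratic_ge0_discriminant R (Q phi / 2) ((Q_form V (xi_ n) phi - T phi) / 2) n.+1%:R^-1 q0.
  rewrite expr_div_n (_ : Q phi / 2 / _ = 2 * Q phi * n.+1%:R^-1 / 4); last first.
    by field; rewrite addrC natr1 pnatr_eq0.
  rewrite (_ : 2 ^+ 2 = 4); last by rewrite expr2 -natrM.
  rewrite ler_pM2r ?invr_gt0//; apply => t.
  have := xiP n (t *: phi + xi_ n).
  rewrite /F /Q (form_expand Qsym Qlin) Tlin (Qsym phi).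
  move: (n.+1%:R^-1) => s; lra.
apply/cvgrPdist_lt => e e0.
have q1 : 0 < 2 * Q phi + 1 by rewrite ltr_wpDl// mulr_ge0// Q_form_ge0.
have d0 : 0 < e ^+ 2 / (2 * Q phi + 1) by rewrite divr_gt0// exprn_gt0.
have [n0 H] := inv_small d0; exists n0 => // n /= /H; rewrite ltr_pdivlMr// => hn.
rewrite distrC -(ltr_pXn2r (n := 2)) ?nnegrE ?(ltW e0)//.
rewrite real_normK ?num_real//; apply: le_lt_trans (bound n) _; apply: le_lt_trans hn.
by rewrite mulrC ler_wpM2l ?invr_ge0// lerDl.
Qed.

End minimizer.

Section existence_of_solution.
Context {R : realType} {N : nat}.
Local Notation E := 'rV[R]_N.
Local Notation mu := (@lebesgue_rV R N).
Local Notation intg f := (mu.-integrable setT (EFin \o f)).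
Local Notation itg f := (\int[mu]_x f x).
Variables (Omega : set E) (V om : E -> R).
Hypotheses (Oopen : open Omega) (VL : L1loc Omega V) (bal : balanced Omega V).
Hypothesis sub : L1_subcritical Omega V.
Implicit Types xi eta phi : W1inf_c Omega.

Let Qpos : Q_nonneg Omega V. Proof. by case: sub. Qed.

Variables (xi_ : nat -> W1inf_c Omega) (ubar : E -> R).
Hypothesis mubar : measurable_fun setT ubar.
Hypothesis xi_cauchy : xi_ \in cauchy_seqs (@norm_L _ _ Omega V).
Hypothesis xi_EL : forall phi, (fun n => Q_form V (xi_ n) phi) @ \oo --> itg (fun x => om x * phi x).
Hypothesis ubarL : L1loc Omega ubar.
Hypothesis xi_cvg : forall K, compacts_in Omega K ->
  (fun n => \int[mu]_(x in K) `|ubar x - xi_ n x|) @ \oo --> (0 : R).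

Lemma limit_itgM (K : set E) (h : E -> R) (M : R) : compacts_in Omega K -> measurable_fun setT h ->
  (forall x, `|h x| <= M) -> (forall x, ~ K x -> h x = 0) ->
  (fun n => itg (fun x => xi_ n x * h x)) @ \oo --> itg (fun x => ubar x * h x).
Proof.
move=> cK mh hM hK; have mK := compact_measurable_rV cK.1.
have Iu : intg (fun x => ubar x * h x) by exact: (L1loc_intg ubarL cK mh hM hK).
have Ix n : intg (fun x => xi_ n x * h x).
  exact: (intgM (lipschitz_bs_intg (W_lipschitz_bs (xi_ n))) mh hM).
have M0 : 0 <= M by apply: le_trans (hM 0).
have bound n : `|itg (fun x => ubar x * h x) - itg (fun x => xi_ n x * h x)| <=
    M * \int[mu]_(x in K) `|ubar x - xi_ n x|.
  have Id : intg (fun x => (ubar \_ K) x - \1_K x * xi_ n x).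
    apply: intgB; first exact: L1loc_restrict ubarL cK.
    by apply: intg_indicM => //; apply: lipschitz_bs_intg; exact: W_lipschitz_bs.
  have dE x : `|(ubar \_ K) x - \1_K x * xi_ n x| = \1_K x * `|ubar x - xi_ n x|.
    by rewrite patchE indicE; case: (x \in K); rewrite ?mul1r// !mul0r subrr normr0.
  have Ik : intg (fun x => \1_K x * `|ubar x - xi_ n x|) by apply: eq_intg (intg_norm Id) => x; exact: dE.
  rewrite -itgB// (itg_indicM K (fun x => `|ubar x - xi_ n x|)) -itgZ//.
  have Iuh : intg (fun x => ubar x * h x - xi_ n x * h x) by exact: intgB.
  apply: le_trans (normr_itg_le Iuh) _.
  apply: le_itg; [exact: intg_norm|exact: intgZ|] => x; rewrite -mulrBl normrM.
  rewrite indicE; case: (boolP (x \in K)) => [_|]; first by rewrite mul1r mulrC ler_wpM2r.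
  by rewrite notin_setE => /hK ->; rewrite normr0 mulr0 mul0r mulr0.
have lim0 : (fun n => M * \int[mu]_(x in K) `|ubar x - xi_ n x|) @ \oo --> (0 : R).
  by rewrite -[X in _ --> X](mulr0 M); apply: cvgM; [exact: cvg_cst|exact: xi_cvg].
apply/cvgrPdist_lt => e e0.
have /cvgrPdist_lt/(_ e e0) := lim0; apply: filterS => n.
rewrite sub0r normrN => /(le_lt_trans (ler_norm _)); exact: le_lt_trans (bound n).
Qed.

(** The sequence has a limit [u'] in [B_V], whose image under the extension [J] is [ubar] on [U].
    Being balanced gives [VV u'] as [V * ubar], while continuity of [VV] and the weak form of the
    potential give it as the limit of computable integrals. *)
Lemma local_equation c (r : R) : 0 < r -> closed_ball_e c r `<=` Omega ->
  let B := closed_ball_e c r in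
  L1 B (fun x => V x * ubar x) /\ forall phi : C2_c (interior B),
    \int[mu]_(x in B) (V x * ubar x * phi x) =
    itg (fun x => om x * phi x) + itg (fun x => ubar x * laplacian phi x).
Proof.
move=> r0 BO B; have [_ /(_ c r r0 BO)[U [oU [ccU cUO] BU UP]]] := bal.
have mU := open_measurable_rV oU.
have cB : compacts_in Omega B by split => //; exact: compact_closed_ball_e.
have Bc : B c by apply: ltW; exact: open_ball_center r0.
have [CU CU0 CUP] := subcritical_L1_bound VL sub (conj ccU cUO).
have pU := norm_LU_seminorm VL Qpos oU.
have pL := norm_L_seminorm VL Qpos.
have IW xi : intg (fun x => `|xi x|) by exact: intg_normW.
have mcU : measurable (closure U) by exact: closed_measurable_rV (@closed_closure _ U).
have UcU xi : \int[mu]_(x in U) `|xi x| <= CU * norm_L V xi.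
  apply: le_trans (CUP xi); rewrite (itg_indicM U (fun x => `|xi x|)) (itg_indicM (closure U) (fun x => `|xi x|)).
  apply: le_itg; [exact: intg_indicM|exact: intg_indicM|] => x.
  rewrite ler_wpM2r// !indicE; case: (boolP (x \in U)) => // /[!inE] /subset_closure Ux.
  by rewrite mem_set.
have omU xi : itg (fun x => \1_U x * `|xi x|) <= 1 * snorm (norm_LU V U) xi.
  by rewrite mul1r (snormE pU) -(itg_indicM U (fun x => `|xi x|)) /norm_LU lerDr sqrtr_ge0.
have ind0 x : 0 <= \1_U x :> R by rewrite indicE.
have ind1 x : \1_U x <= 1 :> R by rewrite indicE; case: (_ \in _).
have mind : measurable_fun setT (\1_U : E -> R) by exact: measurable_indic.
have indU x : U x -> 0 < \1_U x :> R by move=> Ux; rewrite indicE mem_set.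
have KKU (K : set E) : [set U] K -> measurable K /\ exists2 c : R, 0 < c & forall x, K x -> c <= \1_U x.
  by move=> ->; split => //; exists 1 => // x Ux; rewrite indicE mem_set.
have [J [JU mJ JC]] := L1_extension_exists mind ind0 ind1 ler01 omU indU KKU.
have [VV VVP] := potential_extension_exists VL Qpos oU BU cB Bc.
(* By subcriticality on the compact closure of [U], the extra integral in [norm_LU] is bounded by a
   multiple of [norm_L]. *)
have xiU : xi_ \in cauchy_seqs (@norm_LU _ _ Omega V U).
  apply/asboolP => e e0; rewrite (snormE pU); move/asboolP: xi_cauchy.
  have C1 : 0 < 1 + CU by rewrite ltr_pwDl.
  move=> /(_ (e / (1 + CU)) (divr_gt0 e0 C1))[n0 H]; exists n0 => m n mn nn.
  have := H m n mn nn; rewrite (snormE pL) ltr_pdivlMr//; apply: le_lt_trans.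
  rewrite /norm_LU mulrDr mulr1 lerD2l mulrC; exact: UcU.
pose s : cseq (@norm_LU _ _ Omega V U) := CSeq xiU.
have sc := cclass_cvg s; set u' := cclass s in sc.
(* Both functions are limits of [xi_ n] in L^1(U): one by hypothesis, the other by the estimate for
   [J]. *)
have UJ : {ae mu, forall x, U x -> ubar x = J u' x}.
  have cU : (fun n => \int[mu]_(x in closure U) `|ubar x - xi_ n x|) @ \oo --> (0 : R) by exact: xi_cvg.
  have IK : intg (ubar \_ (closure U)) by exact: L1loc_restrict ubarL (conj ccU cUO).
  have Id n : intg (fun x => \1_(closure U) x * `|ubar x - xi_ n x|).
    have Id' : intg (fun x => (ubar \_ (closure U)) x - \1_(closure U) x * xi_ n x).
      apply: intgB => //; apply: intg_indicM => //; apply: lipschitz_bs_intg; exact: W_lipschitz_bs.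
    apply: eq_intg (intg_norm Id') => x.
    by rewrite patchE indicE; case: (x \in _); rewrite ?mul1r// !mul0r subrr normr0.
  have mH : measurable_fun setT (fun x => \1_U x * `|ubar x - J u' x|).
    by apply: measurable_funM => //; apply: measurableT_comp => //; exact: measurable_funB.
  have pw n x : \1_U x * `|ubar x - J u' x| <=
      \1_(closure U) x * `|ubar x - xi_ n x| + \1_U x * `|J u' x - xi_ n x|.
    rewrite !indicE; case: (boolP (x \in U)); last first.
      by rewrite !mul0r addr0 mulr_ge0.
    rewrite inE => /subset_closure cUx; rewrite mem_set// !mul1r [`|J u' x - _|]distrC.
    exact: ler_distD.
  have IR n : intg (fun x => \1_(closure U) x * `|ubar x - xi_ n x| + \1_U x * `|J u' x - xi_ n x|).
    by apply: intgD; [exact: Id|have [] := JC u' (xi_ n)].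
  have IH : intg (fun x => \1_U x * `|ubar x - J u' x|).
    by apply: le_intg mH _ (IR 0%N) => x; rewrite ger0_norm ?mulr_ge0.
  have le0 : itg (fun x => \1_U x * `|ubar x - J u' x|) <= 0.
    have lim : (fun n => \int[mu]_(x in closure U) `|ubar x - xi_ n x| + `|u' - to_completion _ (s n)|) @ \oo --> (0 : R).
      by rewrite -[X in _ --> X]addr0; exact: cvgD cU sc.
    apply: (ler_cvg_to (cvg_cst (itg (fun x => \1_U x * `|ubar x - J u' x|))) lim).
    apply: nearW => n; apply: le_trans (le_itg IH (IR n) (pw n)) _.
    have [I1 I2] := JC u' (xi_ n); rewrite itgD//; apply: lerD.
      by rewrite (itg_indicM (closure U) (fun x => `|ubar x - xi_ n x|)).
    by rewrite mul1r in I2.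
  have := itg_le0_ae IH (fun x => mulr_ge0 (ind0 x) (normr_ge0 _)) le0.
  apply: ae_imp => x + Ux; rewrite indicE mem_set// mul1r => /eqP.
  by rewrite normr_eq0 subr_eq0 => /eqP.
have [L1V [_ repV]] := UP J VV JU VVP u'.
have mB := compact_measurable_rV cB.1.
have mV : measurable_fun setT (V \_ B) := intg_measurable (L1loc_restrict VL cB).
have IVJ : intg ((fun x => V x * J u' x) \_ B).
  by move/(integrable_mkcond _ mB): L1V; rewrite restrict_EFin.
have mVu : measurable_fun setT ((fun x => V x * ubar x) \_ B).
  rewrite (_ : _ \_ B = (fun x => (V \_ B) x * ubar x)); first exact: measurable_funM.
  by apply/funext => x; rewrite !patchE; case: ifPn; rewrite ?mul0r.
have VuE : {ae mu, forall x, ((fun x => V x * J u' x) \_ B) x = ((fun x => V x * ubar x) \_ B) x}.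
  apply: ae_imp UJ => x H; rewrite !patchE; case: ifPn => // /[!inE] /BU /H ->.
  by [].
have IVu := intg_ae_eq IVJ mVu VuE.
split; first by apply/(integrable_mkcond _ mB); rewrite restrict_EFin.
move=> phi; have e1 := repV phi.
have phi0 x : ~ B x -> phi x = 0 by move=> /(C2_eq0 phi)[].
have mphi : measurable_fun setT phi.
  by apply: continuous_measurable_rV; exact: Ck_continuous (C2_Ck phi).
have -> : \int[mu]_(x in B) (V x * ubar x * phi x) = \int[mu]_(x in B) (V x * J u' x * phi x).
  rewrite itg_in; last by move=> x /phi0 ->; rewrite mulr0.
  rewrite (@itg_in _ _ B (fun x => V x * J u' x * phi x)); last by move=> x /phi0 ->; rewrite mulr0.
  rewrite -(itg_restrict _ phi0) -[RHS](itg_restrict _ phi0).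
  apply: itg_ae_eq; [by apply: measurable_funM|by apply: measurable_funM => //; exact: intg_measurable IVJ|].
  by apply: ae_imp VuE => x ->.
rewrite -e1.
have cVV : (fun n => VV (to_completion _ (xi_ n)) (to_completion _ phi)) @ \oo -->
    VV u' (to_completion (@C2norm _ _ B) phi).
  apply/cvgrPdist_lt => e e0.
  set P := `|to_completion (@C2norm _ _ B) phi|.
  have P0 : 0 <= P by exact: normr_ge0.
  have P1 : 0 < P + 1 by rewrite ltr_wpDl.
  have := potential_extension_continuous VVP u' (divr_gt0 e0 P1) => /nbhs_ballP[d /= d0 dP].
  have /cvgrPdist_lt/(_ d d0) := sc; apply: filterS => n.
  rewrite sub0r normrN normr_id => nd.
  have := dP (to_completion _ (xi_ n)) _; rewrite -ball_normE /ball_/= => /(_ nd (to_completion _ phi)).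
  rewrite distrC => /le_lt_trans; apply.
  by rewrite mulrAC ltr_pdivrMr// ltr_pM2l// ltrDl.
have lim2 : (fun n => VV (to_completion _ (xi_ n)) (to_completion (@C2norm _ _ B) phi)) @ \oo -->
    itg (fun x => om x * phi x) + itg (fun x => ubar x * laplacian phi x).
  rewrite (_ : (fun n => VV _ _) = (fun n => Q_form V (xi_ n) (C2_W cB phi) +
      itg (fun x => xi_ n x * laplacian phi x))); last first.
    apply/funext => n; have [_ ->] := potential_extension_eq VVP (xi_ n).
    exact: potential_weak_form.
  have lim1 : (fun n => Q_form V (xi_ n) (C2_W cB phi)) @ \oo --> itg (fun x => om x * phi x).
    have -> : itg (fun x => om x * phi x) = itg (fun x => om x * C2_W cB phi x) by [].
    exact: xi_EL.
  suff lim3 : (fun n => itg (fun x => xi_ n x * laplacian phi x)) @ \oo -->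
      itg (fun x => ubar x * laplacian phi x) by exact: cvgD lim1 lim3.
  apply: (limit_itgM (M := C2norm phi) cB).
  - by apply: measurable_laplacian; exact: C2_Ck.
  - by move=> x; have [_ _] := C2norm_ub Bc phi x.
  - by move=> x /(C2_eq0 phi)[_ _ h]; rewrite /laplacian big1.
by rewrite -(cvg_lim (@Rhausdorff R) cVV); exact: cvg_lim.
Qed.

Hypotheses (mom : measurable_fun setT om) (om01 : forall x, 0 <= om x <= 1).

Lemma weight_L1loc : L1loc Omega om.
Proof.
move=> K [cK _]; have mK := compact_measurable_rV cK.
apply/(integrable_mkcond _ mK); rewrite restrict_EFin.
have I1 : intg (\1_K : E -> R) by apply: intg_indic => //; exact: compact_lty.
apply: eq_intg (intgM (M := 1) I1 mom _) => x.
  by rewrite patchE indicE; case: ifPn; rewrite ?mul1r ?mul0r.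
by have /andP[w0 w1] := om01 x; rewrite ger0_norm.
Qed.

Lemma limit_solution : distributional_solution Omega V ubar om.
Proof.
have VuL : L1loc Omega (fun x => V x * ubar x).
  apply: L1loc_balls => [|c Oc].
    rewrite (_ : _ \_ Omega = (fun x => (V \_ Omega) x * ubar x)).
      by apply: measurable_funM => //; exact: L1loc_measurable.
    by apply/funext => x; rewrite !patchE; case: ifPn; rewrite ?mul0r.
  have [r r0 rO] := open_closed_ball_sub Oopen Oc; exists r => //.
  by have [] := local_equation r0 rO.
have test_facts f : test_function Omega f -> [/\ intg (fun x => V x * ubar x * f x),
    intg (fun x => om x * f x) & intg (fun x => ubar x * laplacian f x)].
  move=> [cf [K cK fK]].
  have bf : bounded_support f.
    by have [M KM] := compact_bounded_norm cK.1; exists M => x Mx; apply: fK => /KM; rewrite leNgt Mx.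
  have [M _ fM] := continuous_bounded_support_bounded (Ck_continuous (cf 0%N)) bf.
  have mf := continuous_measurable_rV (Ck_continuous (cf 0%N)).
  have clap : continuous (laplacian f).
    by apply: (@Ck_continuous _ _ 0); apply: Ck_sum => i; apply: Ck_partial; exact: Ck_partial.
  have [M' _ lM] := continuous_bounded_support_bounded clap (bounded_support_laplacian bf).
  have clK : closed K by apply: closed_compact_rV; exact: cK.1.
  split; [exact: (L1loc_intg VuL cK mf fM fK)|exact: (L1loc_intg weight_L1loc cK mf fM fK)|].
  apply: (L1loc_intg ubarL cK (continuous_measurable_rV clap) lM) => x nK.
  by rewrite /laplacian big1// => i _; apply: partial_eq0 nK => // y; exact: partial_eq0.
split => // f tf.
(* The equation as a property additive in the test function, to be localized; on a small ball it is
   [local_equation]. *)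
pose P f := itg (fun x => V x * ubar x * f x) = itg (fun x => om x * f x) + itg (fun x => ubar x * laplacian f x).
have P0 : P (fun=> 0).
    rewrite /P.
    have p0 i : partial i (fun=> 0 : R) = (fun=> 0) :> (E -> R).
      by apply/funext => x; rewrite /partial (derive_cst (0 : R)).
    have l0 : laplacian (fun=> 0 : R) = (fun=> 0) :> (E -> R).
      by apply/funext => x; rewrite /laplacian big1// => i _; rewrite !p0.
    have z (h : E -> R) : itg (fun x => h x * 0) = 0.
      by rewrite -[RHS](@itg0 _ E R mu); apply: eq_Rintegral => x _; rewrite mulr0.
    by rewrite l0 !z addr0.
have Pf : P f.
  apply: (@test_function_localization _ _ _ P P0) tf.
  - move=> g h tg th; have [g1 g2 g3] := test_facts g tg; have [h1 h2 h3] := test_facts h th.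
    rewrite /P => Pg Ph.
    have lapD : laplacian (fun x => g x + h x) = (fun x => laplacian g x + laplacian h x).
      apply/funext => x; rewrite /laplacian -big_split; apply: eq_bigr => i _ /=.
      have -> : partial i (fun x => g x + h x) = (fun x => partial i g x + partial i h x).
        apply/funext => y; apply: partialD; [exact: Ck_derivable (tg.1 1%N)|exact: Ck_derivable (th.1 1%N)].
      by apply: partialD; [exact: Ck_derivable (Ck_partial i (tg.1 2%N))|exact: Ck_derivable (Ck_partial i (th.1 2%N))].
    rewrite lapD.
    have D (k a b : E -> R) : intg (fun x => k x * a x) -> intg (fun x => k x * b x) ->
        itg (fun x => k x * (a x + b x)) = itg (fun x => k x * a x) + itg (fun x => k x * b x).
      by move=> ka kb; rewrite -itgD//; apply: eq_Rintegral => x _; rewrite mulrDr.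
    by rewrite !D// Pg Ph addrACA.
  - move=> c Oc; have [r r0 rO] := open_closed_ball_sub Oopen Oc; exists r.
    split; [exact: r0|exact: rO|move=> g [cg [K [cK KB] gK]]].
    have [_ eqn] := local_equation r0 rO.
    have KI : K `<=` interior (closed_ball_e c r).
      apply: subset_trans KB _; rewrite -open_subsetE; last exact: open_open_ball.
      by move=> y /ltW.
    have gC : g \in C2_c_pred (interior (closed_ball_e c r)).
      by apply/asboolP; split; [exact: cg|exists K].
    have := eqn (C2C gC); rewrite /= /P => <-.
    rewrite (@itg_in _ _ (closed_ball_e c r) (fun x => V x * ubar x * g x))// => x nB.
    by rewrite gK ?mulr0// => /KI /interior_subset; exact: nB.
have [f1 f2 f3] := test_facts f tf; have [cf [K [cK KO] fK]] := tf.
have f0 x : ~ Omega x -> f x = 0 by move=> Ox; apply: fK => /KO.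
have lap0 x : ~ Omega x -> laplacian f x = 0.
  have clK : closed K by exact: closed_compact_rV.
  move=> Ox; have nK : ~ K x by move=> /KO.
  by rewrite /laplacian big1// => i _; apply: partial_eq0 nK => // y; exact: partial_eq0.
rewrite itg_in; last by move=> x Ox; rewrite f0// lap0// mulr0 oppr0 addr0 mulr0.
rewrite (@itg_in _ _ Omega (fun x => om x * f x)); last by move=> x Ox; rewrite f0// mulr0.
have -> : itg (fun x => ubar x * (- laplacian f x + V x * f x)) =
    itg (fun x => V x * ubar x * f x) - itg (fun x => ubar x * laplacian f x).
  by rewrite -itgB//; apply: eq_Rintegral => x _; ring.
by rewrite Pf addrK.
Qed.

End existence_of_solution.

Theorem theorem8p12 (R : realType) (N : nat) (hN : (0 < N)%N)
    (Omega : set 'rV[R]_N) (Omega_open : open Omega)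
    (Omega_nonempty : Omega !=set0) (Omega_connected : connected Omega)
    (V : 'rV[R]_N -> R) (V_L1loc : L1loc Omega V)
    (Q_V_ge0 : Q_nonneg Omega V) :
  (balanced Omega V -> L1_subcritical Omega V ->
    exists J : H_V Omega V -> 'rV[R]_N -> R,
      L1_extension Omega (compacts_in Omega) J /\
      exists (ustar : 'rV[R]_N -> R) (u : H_V Omega V) (f : 'rV[R]_N -> R),
        [/\ L1loc Omega ustar,
            {ae @lebesgue_rV R N, forall x, Omega x -> 0 < ustar x},
            ae_eq (@lebesgue_rV R N) Omega ustar (J u) &
            [/\ L1loc Omega f,
                ball_ess_inf_pos Omega f &
                distributional_solution Omega V ustar f]]) /\
  ((exists u f : 'rV[R]_N -> R,
      [/\ L1loc Omega u,
          {ae @lebesgue_rV R N, forall x, Omega x -> 0 <= u x},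
          L1loc Omega f,
          ball_ess_inf_pos Omega f &
          distributional_solution Omega V u f]) ->
    L1_subcritical Omega V).
Proof.
split; last first.
  move=> [u [f [uL u0 fL fpos sol]]]; apply: L1_bound_subcritical => // K cK.
  exact: (supersolution_L1_bound Omega_open V_L1loc fL sol u0 fpos Q_V_ge0 cK).
move=> bal sub.
have [om [mom om01 omK omL]] := L1_weight Omega_open V_L1loc sub.
have pL := norm_L_seminorm V_L1loc Q_V_ge0.
have om0 x : 0 <= om x by have /andP[] := om01 x.
have om1 x : om x <= 1 by have /andP[] := om01 x.
have omS (xi : W1inf_c Omega) : \int[lebesgue_rV]_x (om x * `|xi x|) <= 1 * snorm (@norm_L _ _ Omega V) xi.
  by rewrite mul1r (snormE pL); exact: omL.
have omO x : Omega x -> 0 < om x.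
  move=> Ox; have [|c c0 cx] := omK [set x]; last exact: lt_le_trans c0 (cx x erefl).
  by split; [exact: compact_set1|move=> _ ->].
have KKP (K : set 'rV[R]_N) : compacts_in Omega K ->
    measurable K /\ exists2 c : R, 0 < c & forall x, K x -> c <= om x.
  by move=> cK; split; [exact: compact_measurable_rV cK.1|exact: omK].
have [J [JL mJ JC]] := L1_extension_exists mom om0 om1 ler01 omS omO KKP.
exists J; split => //.
have [xi_ [xi0 xiP]] := minimizing_sequence V_L1loc Q_V_ge0 mom om01 omL.
have xic := minimizing_cauchy V_L1loc Q_V_ge0 mom om01 xiP.
have xiE := minimizing_euler_lagrange V_L1loc Q_V_ge0 mom om01 xiP.
pose u : H_V Omega V := cclass (CSeq xic).
have uc : (fun n => `|u - to_completion _ (xi_ n)|) @ \oo --> (0 : R) by exact: (cclass_cvg (CSeq xic)).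
have mu_ := mJ u.
have uL : L1loc Omega (J u) by move=> K cK; exact: (L1_extension_L1 JL u cK).
have xicv K : compacts_in Omega K ->
    (fun n => \int[lebesgue_rV]_(x in K) `|J u x - xi_ n x|) @ \oo --> (0 : R).
  move=> cK; have [mK [c c0 cx]] := KKP K cK.
  apply: (squeeze_cvgr (f := cst 0) (h := fun n => c^-1 * `|u - to_completion _ (xi_ n)|)).
  - apply: nearW => n; rewrite Rintegral_ge0//=.
    have [I1 I2] := JC u (xi_ n); rewrite mul1r in I2.
    have mx : measurable_fun setT (fun x => J u x - xi_ n x).
      by apply: measurable_funB => //; apply: lipschitz_bs_measurable; exact: W_lipschitz_bs.
    have [_ h] := weighted_L1 om0 mK c0 cx mx I1.
    by apply: le_trans h _; rewrite ler_wpM2l// invr_ge0 ltW.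
  - exact: cvg_cst.
  - by rewrite -[X in _ --> X](mulr0 c^-1); apply: cvgM; [exact: cvg_cst|exact: uc].
have sol := limit_solution Omega_open V_L1loc bal sub mu_ xic xiE uL xicv mom om01.
have omloc := weight_L1loc mom om01.
(* The closure of the ball is a compact of [Omega], on which the weight is bounded below. *)
have ompos : ball_ess_inf_pos Omega om.
  move=> c r r0 cB; have [m m0 mP] := omK _ cB.
  apply: (@lt_le_trans _ _ m%:E); first by rewrite lte_fin.
  apply/ess_infP; apply: ae_all => x; rewrite /patch; case: ifPn => /=; last by rewrite leey.
  by rewrite inE lee_fin => /subset_closure; exact: mP.
have u_ge0 : {ae lebesgue_rV, forall x, Omega x -> 0 <= J u x}.
  (* Since each [xi_ n] is nonnegative, the negative part [h] of [J u] is at most the distance from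
     [J u] to [xi_ n], so its weighted integral vanishes in the limit. *)
  pose h x := Num.max 0 (- J u x).
  have h0 x : 0 <= h x by rewrite /h le_max lexx.
  have hle n x : om x * h x <= om x * `|J u x - xi_ n x|.
    rewrite ler_wpM2l// /h ge_max normr_ge0/= -normrN opprB.
    by apply: le_trans (ler_norm _); rewrite lerDr.
  have mh : measurable_fun setT (fun x => om x * h x).
    by apply: measurable_funM => //; apply: measurable_maxr => //; exact: measurable_funN.
  have Ih : (@lebesgue_rV R N).-integrable setT (EFin \o (fun x => om x * h x)).
    have [I1 _] := JC u (xi_ 0%N).
    by apply: le_intg mh _ I1 => x; rewrite ger0_norm ?mulr_ge0.
  have := itg_le0_ae Ih (fun x => mulr_ge0 (om0 x) (h0 x)) _.
  have h_le0 : \int[lebesgue_rV]_x (om x * h x) <= 0.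
    apply: (ler_cvg_to (cvg_cst (\int[lebesgue_rV]_x (om x * h x) : R)) uc); apply: nearW => n.
    have [I1 I2] := JC u (xi_ n); rewrite mul1r in I2; apply: le_trans I2.
    exact: le_itg.
  move=> /(_ h_le0); apply: ae_imp => x /eqP + Ox.
  rewrite mulf_eq0 (gt_eqF (omO x Ox))/= => /eqP hx.
  by rewrite -oppr_le0 -hx /h le_max lexx orbT.
exists (J u), u, om; split => //.
  exact: (supersolution_gt0 Omega_open V_L1loc (omloc Omega) sol u_ge0 ompos).
by apply: ae_all.
Qed.
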